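(* Let $\Omega\subset\mathbb{R}^d$ be a non-empty, bounded, open set and let $\Phi_k,\Phi\colon\mathbb{R}^N_+\to[0,\infty)$, $k\in\mathbb{N}$, with $\{\Phi_k\}$ equicoercive. Suppose $\Phi=\lim_k\Phi_k$ pointwise on $\mathbb{R}^N_+$ and $\Phi$ is also the $\Gamma$-limit of $\Phi_k$, and that $\Phi$ satisfies (Φ.3). Then $H^{\Phi,N}(\Omega)=\lim_k H^{\Phi_k,N}(\Omega)$, and for every $p\in[1,\infty)$, $\Lambda^{\Phi,N}_{1,p}(\Omega)=\lim_k\Lambda^{\Phi_k,N}_{1,p}(\Omega)$ and $\mathscr{L}^{\Phi,N}_{1,p}(\Omega)=\lim_k\mathscr{L}^{\Phi_k,N}_{1,p}(\Omega)$.
   Context: All sets are Lebesgue measurable; inclusions/disjointness up to null sets; $|E|$ Lebesgue measure, $P(E)$ perimeter. An $N$-set of $F$ is $(\mathcal E_1,\dots,\mathcal E_N)$ with $\mathcal E_i\subset F$, $|\mathcal E_i|>0$, $|\mathcal E_i\cap\mathcal E_j|=0$ for $i\ne j$; an $N$-cluster if moreover $P(\mathcal E_i)<\infty$. $H^{\Phi,N}(F)=\inf\{\Phi(P(\mathcal E_1)/|\mathcal E_1|,\dots,P(\mathcal E_N)/|\mathcal E_N|)\}$ over $N$-clusters. $BV_0(F)$, $W^{1,p}_0(F)$: functions in $BV(\mathbb{R}^d)$, resp. $W^{1,p}(\mathbb{R}^d)$, vanishing a.e. outside $F$. $\lambda_{1,1}(F)=\inf\{|Du|(\mathbb{R}^d):u\in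 BV_0(F),\|u\|_{L^1}=1\}$; for $p>1$, $\lambda_{1,p}(F)=\inf\{\int|\nabla u|^p:u\in W^{1,p}_0(F),\|u\|_{L^p}=1\}$; $\mathscr{L}^{\Phi,N}_{1,p}(F)=\inf\{\Phi(\lambda_{1,p}(\mathcal E_1),\dots,\lambda_{1,p}(\mathcal E_N))\}$ over $N$-sets. A $(1,N)$-function of $F$ is $u=(u_1,\dots,u_N)$ with $u_i\in BV_0(F)$, $u_i\ge0$, $\|u_i\|_{L^1}=1$, $u_iu_j=0$ a.e. ($i\ne j$), and $[u]_1=(|Du_i|(\mathbb{R}^d))_i$; for $p>1$ a $(p,N)$-function has $u_i\in W^{1,p}_0(F)$, $u_i\ge0$, $\|u_i\|_{L^p}=1$, $u_iu_j=0$ a.e., and $[u]_p^p=(\|\nabla u_i\|_{L^p}^p)_i$; $\Lambda^{\Phi,N}_{1,p}(F)=\inf\Phi([u]_p^p)$ over $(p,N)$-functions ($[u]_1^1:=[u]_1$). $\mathbb{R}^N_+$ with componentwise order; (Φ.3): $v\le w\Rightarrow\Phi(v)\le\Phi(w)$. $\{\Phi_k\}$ is equicoercive if there is $\delta>0$ with $\Phi_k(v)\ge\delta\sum_iv_i$ for all $k$ and $v\in\mathbb{R}^N_+$. $\Phi$ is the $\Gamma$-limit of $\Phi_k$ (w.r.t. the Euclidean distance on $\mathbb{R}^N_+$) if $\Phi(v)\le\liminf_k\Phi_k(v_k)$ whenever $v_k\to v$, and for every $v$ there exist $v_k\to v$ with $\limsup_k\Phi_k(v_k)\le\Phi(v)$.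 *)

(* Defs.v *)
From HB Require Import structures.
From mathcomp Require Import all_boot all_order all_algebra.
From mathcomp Require Import all_classical all_reals all_analysis.
Set Implicit Arguments. Unset Strict Implicit. Unset Printing Implicit Defensive.
Import Order.TTheory GRing.Theory Num.Theory.
Import numFieldNormedType.Exports.
Local Open Scope classical_set_scope.
Local Open Scope ring_scope.

Definition Rd_disc (R : realType) (d : nat) := 'rV[R]_d.
Section disc.
Context (R : realType) (d : nat).
HB.instance Definition _ := Choice.on (Rd_disc R d).
HB.instance Definition _ := isPointed.Build (Rd_disc R d) (0 : 'rV[R]_d).
HB.instance Definition _ := @isMeasurable.Build default_measure_display
  (Rd_disc R d) discrete_measurable discrete_measurable0
  discrete_measurableC discrete_measurableU.
End disc.

Definition obox (R : realType) (d : nat) (a b : 'rV[R]_d) : set 'rV[R]_d :=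
  [set x | forall i, a 0 i < x 0 i < b 0 i].
Definition box_vol (R : realType) (d : nat) (a b : 'rV[R]_d) : R :=
  \prod_(i < d) Num.max (b 0 i - a 0 i) 0.

Definition box_content (R : realType) (d : nat) (A : set (Rd_disc R d)) : \bar R :=
  ereal_inf [set v : \bar R | (A = set0 /\ v = 0%E) \/
    exists a b : 'rV[R]_d, A = obox a b /\ v = (box_vol a b)%:E].

Lemma box_content_ge0 R d (A : set (Rd_disc R d)) : (0 <= box_content A)%E.
Proof.
apply: le_ereal_inf_tmp => v [[_ ->]//|[a [b [_ ->]]]].
rewrite lee_fin; apply: prodr_ge0 => i _; by rewrite le_max lexx orbT.
Qed.

Lemma box_content0 R d : box_content (set0 : set (Rd_disc R d)) = 0%E.
Proof.
apply/eqP; rewrite eq_le box_content_ge0 andbT.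
by apply: ereal_inf_lbound; left.
Qed.

Definition RdP (R : realType) (d : nat) := 'rV[R]_d.
Section rdp.
Context (R : realType) (d : nat).
HB.instance Definition _ := Choice.on (RdP R d).
HB.instance Definition _ := isPointed.Build (RdP R d) (0 : 'rV[R]_d).
End rdp.

(* Lebesgue outer measure on R^d: inf over countable covers by open boxes *)
Definition leb_outer (R : realType) (d : nat) : set (RdP R d) -> \bar R :=
  mu_ext (@box_content R d).

Section lebo.
Context (R : realType) (d : nat).
HB.instance Definition _ := isOuterMeasure.Build R (RdP R d) (@leb_outer R d)
  (mu_ext0 (@box_content0 R d) (@box_content_ge0 R d))
  (mu_ext_ge0 (@box_content_ge0 R d))
  (le_mu_ext (@box_content R d))
  (mu_ext_sigma_subadditive (@box_content_ge0 R d)).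
End lebo.

Section lebesgue_Rd.
Context (R : realType) (d : nat).

Definition LebT := caratheodory_type (@leb_outer R d).
Definition Leb : set LebT -> \bar R := @leb_outer R d.
HB.instance Definition _ := isMeasure.Build _ _ _ Leb
  (@caratheodory_measure0 R (RdP R d) (@leb_outer R d))
  (@caratheodory_measure_ge0 R (RdP R d) (@leb_outer R d))
  (@caratheodory_measure_sigma_additive R (RdP R d) (@leb_outer R d)).
End lebesgue_Rd.
Arguments Leb {R d}.

Section calculus.
Context (R : realType) (d : nat).
Local Notation V := 'rV[R]_d.
Local Open Scope ereal_scope.

Definition evec (i : 'I_d) : V := delta_mx ord0 i.
Definition pderiv (i : 'I_d) (f : V -> R) (x : V) : R := 'D_(evec i) f x.

Definition C1c (f : V -> R) : Prop :=
  continuous f /\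
  (forall i x, derivable f x (evec i)) /\
  (forall i, continuous (pderiv i f)) /\
  compact (closure [set x | f x != 0%R]).

Definition divergence (phi : 'I_d -> V -> R) (x : V) : R :=
  (\sum_(j < d) pderiv j (phi j) x)%R.

Definition test_field (phi : 'I_d -> V -> R) : Prop :=
  (forall j, C1c (phi j)) /\ (forall x, (\sum_(j < d) phi j x ^+ 2 <= 1)%R).

Definition total_variation (u : V -> R) : \bar R :=
  ereal_sup [set \int[@Leb R d]_x ((u x * divergence phi x)%R)%:E | phi in test_field].

Definition perimeter (E : set V) : \bar R := total_variation (\1_E : V -> R).

Definition vanishes_outside (F : set V) (u : V -> R) : Prop :=
  {ae @Leb R d, forall x, ~ F x -> u x = 0%R}.

Definition in_L1 (u : V -> R) : Prop :=
  (@Leb R d).-integrable [set: LebT R d] (fun x => (u x)%:E).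

Definition BV0 (F : set V) (u : V -> R) : Prop :=
  in_L1 u /\ total_variation u < +oo /\ vanishes_outside F u.

Definition Lp_pow (p : R) (u : V -> R) : \bar R :=
  \int[@Leb R d]_x (`|u x| `^ p)%:E.

Definition in_Lp (p : R) (u : V -> R) : Prop :=
  measurable_fun [set: LebT R d] u /\ Lp_pow p u < +oo.

Definition weak_gradient (u : V -> R) (g : 'I_d -> V -> R) : Prop :=
  forall psi, C1c psi -> forall i,
    \int[@Leb R d]_x ((u x * pderiv i psi x)%R)%:E =
    - \int[@Leb R d]_x ((g i x * psi x)%R)%:E.

Definition W1p0 (p : R) (F : set V) (u : V -> R) (g : 'I_d -> V -> R) : Prop :=
  in_Lp p u /\ (forall i, in_Lp p (g i)) /\ weak_gradient u g /\
  vanishes_outside F u.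

Definition grad_pow (p : R) (g : 'I_d -> V -> R) : \bar R :=
  \int[@Leb R d]_x ((Num.sqrt (\sum_(i < d) g i x ^+ 2)) `^ p)%:E.

Definition lambda1 (p : R) (F : set V) : \bar R :=
  if p == 1%R then
    ereal_inf [set total_variation u | u in
      [set u | BV0 F u /\ \int[@Leb R d]_x (`|u x|)%:E = 1]]
  else
    ereal_inf [set grad_pow p ug.2 | ug in
      [set ug : (V -> R) * ('I_d -> V -> R) |
        W1p0 p F ug.1 ug.2 /\ Lp_pow p ug.1 = 1]].

Section N.
Variable N : nat.

Definition nset (F : set V) (E : 'I_N -> set V) : Prop :=
  (forall i, measurable (E i : set (LebT R d))) /\
  (forall i, @Leb R d (E i `\` F) = 0) /\
  (forall i, 0 < @Leb R d (E i)) /\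
  (forall i j, i != j -> @Leb R d (E i `&` E j) = 0).

Definition ncluster (F : set V) (E : 'I_N -> set V) : Prop :=
  nset F E /\ (forall i, perimeter (E i) < +oo).

Definition Cheeger (Phi : 'rV[R]_N -> R) (F : set V) : \bar R :=
  ereal_inf [set (Phi (\row_i (fine (perimeter (E i)) / fine (@Leb R d (E i))))%R)%:E
            | E in ncluster F].

Definition one_N_function (F : set V) (u : 'I_N -> V -> R) : Prop :=
  (forall i, BV0 F (u i)) /\
  (forall i, {ae @Leb R d, forall x, (0 <= u i x)%R}) /\
  (forall i, \int[@Leb R d]_x (`|u i x|)%:E = 1) /\
  (forall i j, i != j -> {ae @Leb R d, forall x, (u i x * u j x = 0)%R}).

Definition p_N_function (p : R) (F : set V) (u : 'I_N -> V -> R)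
    (g : 'I_N -> 'I_d -> V -> R) : Prop :=
  (forall i, W1p0 p F (u i) (g i)) /\
  (forall i, {ae @Leb R d, forall x, (0 <= u i x)%R}) /\
  (forall i, Lp_pow p (u i) = 1) /\
  (forall i j, i != j -> {ae @Leb R d, forall x, (u i x * u j x = 0)%R}).

Definition LambdaPhi (p : R) (Phi : 'rV[R]_N -> R) (F : set V) : \bar R :=
  if p == 1%R then
    ereal_inf [set (Phi (\row_i fine (total_variation (u i))))%:E
              | u in one_N_function F]
  else
    ereal_inf [set (Phi (\row_i fine (grad_pow p (ug.2 i))))%:E
              | ug in [set ug : ('I_N -> V -> R) * ('I_N -> 'I_d -> V -> R) |
                        p_N_function p F ug.1 ug.2]].

(* optimal partition value; N-sets with some lambda_{1,p}(E_i) = +oo give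
   the value +oo and are therefore omitted from the infimum *)
Definition LPhi (p : R) (Phi : 'rV[R]_N -> R) (F : set V) : \bar R :=
  ereal_inf [set (Phi (\row_i fine (lambda1 p (E i))))%:E
            | E in [set E | nset F E /\ (forall i, lambda1 p (E i) < +oo)]].
End N.
End calculus.

Section phi.
Context (R : realType) (N : nat).
Local Open Scope ereal_scope.

Definition nonneg_vec (v : 'rV[R]_N) : Prop := forall i, (0 <= v 0 i)%R.

Definition equicoercive (Phik : nat -> 'rV[R]_N -> R) : Prop :=
  exists2 delta : R, (0 < delta)%R &
    forall k v, nonneg_vec v -> (delta * \sum_(i < N) v 0 i <= Phik k v)%R.

Definition Gamma_limit (Phik : nat -> 'rV[R]_N -> R) (Phi : 'rV[R]_N -> R) : Prop :=
  (forall (v : 'rV[R]_N) (vk : nat -> 'rV[R]_N),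
     nonneg_vec v -> (forall k, nonneg_vec (vk k)) -> vk @ \oo --> v ->
     (Phi v)%:E <= limn_einf (fun k => (Phik k (vk k))%:E)) /\
  (forall v, nonneg_vec v -> exists vk : nat -> 'rV[R]_N,
     [/\ forall k, nonneg_vec (vk k), vk @ \oo --> v &
       limn_esup (fun k => (Phik k (vk k))%:E) <= (Phi v)%:E]).

Definition monotone_Phi (Phi : 'rV[R]_N -> R) : Prop :=
  forall v w, nonneg_vec v -> nonneg_vec w -> (forall i, (v 0 i <= w 0 i)%R) ->
    (Phi v <= Phi w)%R.
End phi.

(* Main.v *)
Require Import Defs.
From HB Require Import structures.
From mathcomp Require Import all_boot all_order all_algebra.
From mathcomp Require Import all_classical all_reals all_analysis.
From mathcomp Require Import measurable_realfun measurable_fun_approximation.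
From mathcomp Require Import ring lra.
Set Implicit Arguments. Unset Strict Implicit. Unset Printing Implicit Defensive.
Import Order.TTheory GRing.Theory Num.Theory.
Import numFieldNormedType.Exports.
Local Open Scope classical_set_scope.
Local Open Scope ring_scope.

(* All three quantities are infima of [Phi] over a set S of vectors.  Pointwise
   convergence gives the upper bound for the limit of the infima.  For the lower
   bound, near-minimising vectors are bounded by equicoercivity, so a subsequence
   converges to some v, and it is enough that some w in S lies below v.  Such a w
   comes from compactness of functions u with bounded energy: integration by parts
   bounds the L^1 distance of u, and of |u|^p, to its translates; hence the integrals
   over the cells of a fine grid determine u up to a small error, and a diagonal
   subsequence is L^1-Cauchy.  The energies are lower semicontinuous: for p = 1 as
   suprema, for p > 1 because minimising gradients are Cauchy in L^p by uniform
   convexity.  In the Cheeger problem this is applied to 1_E / |E|, whose limits have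
   the same form; for the spectral partitions the new sets are the nonzero sets of
   the limits of near-optimal functions. *)

(** * Limits of infima *)

(** An energy can drop in the limit, so the sets of achievable vectors are not treated as closed: a
    limit v only dominates an achievable w, and monotonicity of [Phi] absorbs the difference. For p
    > 1 the constraint that u has unit L^p norm does not survive L^1 convergence of u alone. This is
    why |u|^p is made compact together with u: its L^1 limit is identified almost everywhere with
    the p-th power of the limit function, and the norm passes. The measure comes from an outer
    measure on boxes; what the compactness argument takes from it is translation invariance, outer
    regularity and the nullity of hyperplanes. Grids suit these facts: halving a cell gives two
    translates of one set, so the difference of the integrals of u over the halves is the integral
    of an increment of u. Gradients are not handled by weak compactness. Fields that are weak
    gradients of functions L^1-close to the limit form nested classes stable under midpoints;
    near-minimisers of the energy in these classes converge strongly, and their limit is a weak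
    gradient of the limit function. *)

Definition subsequence (s : nat -> nat) := forall n, (s n < s n.+1)%N.

Lemma subsequence_le s n : subsequence s -> (n <= s n)%N.
Proof. by move=> ss; elim: n => // n /leq_ltn_trans; apply; exact: ss. Qed.

Lemma subsequence_mono s : subsequence s -> {homo s : m n / (m < n)%N}.
Proof. by move=> ss; apply: homo_ltn => //; exact: ltn_trans. Qed.

Lemma subsequence_comp s t : subsequence s -> subsequence t -> subsequence (s \o t).
Proof. by move=> ss st n; apply: (subsequence_mono ss); exact: st. Qed.

Lemma cvg_subsequence (T : topologicalType) s (u : nat -> T) (l : T) :
  subsequence s -> u @ \oo --> l -> (fun n => u (s n)) @ \oo --> l.
Proof.
move=> ss ul; apply: (cvg_comp _ _ _ ul) => A [N _ NA].
by exists N => // n /= Nn; apply: NA => /=; exact: (leq_trans Nn (subsequence_le n ss)).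
Qed.

Lemma extract_subsequence (P : nat -> nat -> Prop) :
  (forall n m, exists2 k, (m < k)%N & P n k) ->
  exists2 s, subsequence s & forall n, P n (s n).
Proof.
move=> H; have /choice[f Hf] : forall nm, exists k, (nm.2 < k)%N /\ P nm.1 k.
  by move=> [n m]; have [k ? ?] := H n m; exists k.
pose s := fix s n := if n is n'.+1 then f (n, s n') else f (0%N, 0%N).
by exists s => [n|[|n]] /=; [exact: (Hf (_, _)).1 | exact: (Hf (_, _)).2 | exact: (Hf (_, _)).2].
Qed.

Lemma ultra_fmap (S T : Type) (f : S -> T) (U : set_system S) :
  UltraFilter U -> UltraFilter (f @ U).
Proof.
move=> UU; split=> [|G PG UG]; first exact: fmap_proper_filter.
apply/seteqP; split=> A //= GA; last exact: UG.
case: (in_ultra_setVsetC (f @^-1` A) UU) => // UnA.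
by have /filter_ex[x []] : G (A `&` ~` A) by apply: filterI => //; exact: UG.
Qed.

(** An ultrafilter finer than the filter at infinity gives a limit to every bounded sequence at
    once, by compactness of segments, which replaces successive extractions. The n-th term of the
    subsequence is taken where the first n sequences are within 1/(n+1) of these limits. *)
Lemma diagonal (R : realType) (a : nat -> nat -> R) :
  (forall j, exists M : R, forall k, `|a j k| <= M) ->
  exists2 s, subsequence s & forall j, exists l : R, (fun n => a j (s n)) @ \oo --> l.
Proof.
move=> aM.
have [U [UU ooU]] := @ultraFilterLemma nat \oo _.
have FU : Filter U by exact: ultra_proper.
have [l Hl] : {l : nat -> R & forall j, a j @ U --> l j}.
  apply: (choice (P := fun j l => a j @ U --> l)) => j; have [M HM] := aM j.
  have /= := @segment_compact R (- M) M; rewrite compact_ultra => /(_ (a j @ U)).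
  have UM : U (a j @^-1` `[- M, M]).
    by apply: filterS filterT => k _ /=; rewrite in_itv /= -ler_norml.
  by move=> /(_ (ultra_fmap _ UU) UM)[l [_ ?]]; exists l.
have [|s ss Hs] := @extract_subsequence (fun n k => forall j, (j < n)%N -> `|a j k - l j| < n.+1%:R^-1).
  move=> n m; have : U [set k | (m < k)%N /\ forall j, (j < n)%N -> `|a j k - l j| < n.+1%:R^-1].
    apply: filterI; first by apply: ooU; exists m.+1.
    elim: {1}n => [|n' A]; first by apply: filterS filterT => k _.
    have B : U [set k | `|a n' k - l n'| < n.+1%:R^-1].
      by move/cvgrPdistC_lt : (Hl n') => /(_ n.+1%:R^-1); apply; rewrite invr_gt0.
    apply: filterS (filterI A B) => k [Ak Bk] j; rewrite ltnS leq_eqVlt => /orP[/eqP->//|]; exact: Ak.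
  by move=> /filter_ex[k [? ?]]; exists k.
exists s => // j; exists (l j); apply/cvgrPdistC_lt => e e0; near=> n.
have jn : (j < n)%N by near: n; exists j.+1.
apply: lt_trans (Hs n j jn) _; near: n; exact: near_infty_natSinv_lt (PosNum e0).
Unshelve. all: end_near. Qed.

Lemma cvg_rowP (R : realType) N (v : nat -> 'rV[R]_N) (l : 'rV[R]_N) :
  (forall i, (fun k => v k 0 i) @ \oo --> l 0 i) -> v @ \oo --> l.
Proof.
move=> H; apply/cvgrPdist_lt => e e0.
have : \forall n \near \oo, forall j : 'I_N, `|l 0 j - v n 0 j| < e.
  by apply: filter_forall => k; move/cvgrPdist_lt: (H k); apply.
apply: filterS => n An.
rewrite -[X in X < _]/(mx_norm _) mx_normrE; apply: bigmax_lt => // -[i j] _ /=.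
by rewrite (ord1 i) !mxE.
Qed.

Section infimum_convergence.
Variables (R : realType) (N : nat) (S : set 'rV[R]_N).
Variables (Phik : nat -> 'rV[R]_N -> R) (Phi : 'rV[R]_N -> R).
Hypothesis S_ge0 : forall v, S v -> nonneg_vec v.
Hypothesis Scl : forall (vk : nat -> 'rV[R]_N) (v : 'rV[R]_N), (forall k, S (vk k)) ->
  vk @ \oo --> v -> exists2 w, S w & forall i, w 0 i <= v 0 i.
Hypothesis Phi_ge0 : forall v, nonneg_vec v -> 0 <= Phi v.
Hypothesis Phik_coer : equicoercive Phik.
Hypothesis Phik_cvg : forall v, nonneg_vec v -> (fun k => Phik k v) @ \oo --> Phi v.
Hypothesis Phik_gamma : Gamma_limit Phik Phi.
Hypothesis Phi_mono : monotone_Phi Phi.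

Let inf_of (F : 'rV[R]_N -> R) : \bar R := ereal_inf [set (F v)%:E | v in S].

Let liminf_bound (c : R) : (c%:E < inf_of Phi)%E ->
  \forall k \near \oo, (c%:E <= inf_of (Phik k))%E.
Proof.
move=> cI; apply: contrapT => nearF.
have [|s ss Hs] := @extract_subsequence (fun n k => exists2 v, S v & Phik k v < c).
  move=> n m; apply: contrapT => Hex; apply: nearF; exists m.+1 => // k /= mk.
  apply: le_ereal_inf_tmp => _ [v Sv <-]; rewrite lee_fin leNgt; apply/negP => vc.
  by apply: Hex; exists k => //; exists v.
have /choice[v Hv] : forall n, exists v, S v /\ Phik (s n) v < c.
  by move=> n; have [v ? ?] := Hs n; exists v.
have [delta d0 Hd] := Phik_coer.
have vb n i : `|v n 0 i| <= c / delta.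
  have nn := S_ge0 (Hv n).1; rewrite ger0_norm // ler_pdivlMr // mulrC.
  apply: le_trans (ltW (Hv n).2); apply: le_trans (Hd _ _ nn); rewrite ler_pM2l //.
  by rewrite (bigD1 i) //= lerDl sumr_ge0.
(* The coordinates are numbered by all naturals, with the zero sequence at the indices j >= N. *)
have [|t tt Ht] := @diagonal R (fun j k => if insub j is Some i then v k 0 i else 0).
  move=> j; case: insubP => [i _ _|_]; first by exists (c / delta) => k.
  by exists 0 => k; rewrite normr0.
have [l Hl] : {l : 'I_N -> R & forall i, (fun n => v (t n) 0 i) @ \oo --> l i}.
  apply: (choice (P := fun i l => (fun n => v (t n) 0 i) @ \oo --> l)) => i.
  by have [l] := Ht i; rewrite valK; exists l.
pose lv : 'rV[R]_N := \row_i l i.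
have vl : (fun n => v (t n)) @ \oo --> lv.
  by apply: cvg_rowP => i; rewrite mxE; exact: Hl.
have [w Sw wl] := Scl (fun n => (Hv (t n)).1) vl.
have lv0 : nonneg_vec lv by move=> i; apply: le_trans (wl i); exact: S_ge0.
have st := subsequence_comp ss tt.
(* The liminf inequality speaks of full sequences: [u] equals v along the extracted indices and the
   limit [lv] elsewhere, which keeps it convergent. *)
pose u k : 'rV[R]_N := if pselect (exists n, k = s (t n)) is left e then v (t (projT1 (cid e))) else lv.
have ust n : u (s (t n)) = v (t n).
  rewrite /u; case: pselect => [e|[]]; last by exists n.
  case: cid => m /= e'; congr (v (t _)); apply: contrapT => /eqP.
  by rewrite neq_ltn => /orP[] /(subsequence_mono st) /=; rewrite e' ltnn.
have ucvg : u @ \oo --> lv.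
  apply/cvgrPdist_lt => e e0; move/cvgrPdist_lt: vl => /(_ e e0) [M _ HM].
  exists (s (t M)) => // k /= Mk; rewrite /u; case: pselect => [e'|_]; last by rewrite subrr normr0.
  case: cid => m /= km; apply: HM => /=; rewrite leqNgt; apply/negP => /(subsequence_mono st) /=.
  by rewrite -km ltnNge Mk.
have unn k : nonneg_vec (u k).
  by rewrite /u; case: pselect => // e; exact: S_ge0 (Hv _).1.
(* Every tail contains an index of the form s (t n), where the value is below c, so all tail infima
   are at most c. *)
have Phil : (Phi lv <= c)%R.
  rewrite -lee_fin; apply: le_trans (Phik_gamma.1 _ _ lv0 unn ucvg) _.
  rewrite limn_einf_lim; apply: lime_le; first exact: is_cvg_einfs.
  apply: nearW => n; apply: (@le_trans _ _ (Phik (s (t n)) (u (s (t n))))%:E).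
    by apply: ereal_inf_lbound; exists (s (t n)) => //=; exact: (subsequence_le n st).
  by rewrite ust lee_fin; exact: ltW (Hv _).2.
have : (inf_of Phi <= c%:E)%E.
  apply: (@le_trans _ _ (Phi w)%:E); first by apply: ereal_inf_lbound; exists w.
  by rewrite lee_fin; apply: le_trans Phil; apply: Phi_mono => //; exact: S_ge0.
by rewrite leNgt cI.
Qed.

Lemma inf_of_cvg : (fun k => inf_of (Phik k)) @ \oo --> inf_of Phi.
Proof.
have [S0|/set0P[v0 Sv0]] := eqVneq S set0.
  by rewrite /inf_of S0; under eq_fun do rewrite image_set0; rewrite image_set0; exact: cvg_cst.
have I0 : (0 <= inf_of Phi)%E.
  by apply: le_ereal_inf_tmp => _ [v Sv <-]; rewrite lee_fin; exact/Phi_ge0/S_ge0.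
have Ifin : inf_of Phi \is a fin_num.
  rewrite ge0_fin_numE //; apply: (@le_lt_trans _ _ (Phi v0)%:E); last exact: ltry.
  by apply: ereal_inf_lbound; exists v0.
have bounds (e : R) : 0 < e -> \forall k \near \oo,
    ((fine (inf_of Phi) - e)%:E <= inf_of (Phik k) <= (fine (inf_of Phi) + e)%:E)%E.
  move=> e0; have [_ [v Sv <-] ve] := lb_ereal_inf_adherent e0 Ifin.
  near=> k; apply/andP; split.
    near: k; apply: liminf_bound; rewrite -[ltRHS](fineK Ifin) lte_fin; lra.
  apply: (@le_trans _ _ (Phik k v)%:E); first by apply: ereal_inf_lbound; exists v.
  rewrite lee_fin; apply: ltW; near: k.
  apply: cvgr_lt (Phik_cvg (S_ge0 Sv)) _ _.
  by rewrite -lte_fin EFinD fineK.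
rewrite -(fineK Ifin); apply/fine_cvgP; split.
  apply: filterS (bounds 1 ltr01) => k /andP[].
  by case: (inf_of (Phik k)).
apply/cvgrPdist_le => e e0; apply: filterS (bounds e e0) => k /andP[].
case E: (inf_of (Phik k)) => [r||]//; rewrite !lee_fin /= => lo hi.
by rewrite ler_distlC; apply/andP; rewrite /= E.
Unshelve. all: end_near. Qed.
End infimum_convergence.

(** * Uniform convexity of powers *)

Section powR_inequalities.
Variable R : realType.
Implicit Types (a b p : R).

(** The tangent of the convex power lies below its graph. This is Young's inequality for a^(p-1) and
    b with the exponents p/(p-1) and p. *)
Lemma powR_tangent p a b : 1 < p -> 0 <= a -> 0 <= b ->
  a `^ p + p * a `^ (p - 1) * (b - a) <= b `^ p.
Proof.
move=> p1 a0 b0; have p0 : 0 < p by lra.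
have q0 : 0 < p / (p - 1) by apply: divr_gt0; lra.
have pq : (p / (p - 1))^-1 + p^-1 = 1 by field; apply/andP; split; lra.
have := conjugate_powR (powR_ge0 a (p - 1)) b0 q0 p0 pq.
rewrite -powRrM mulrCA divff ?mulr1; last by lra.
rewrite invf_div => H.
have : p * (a `^ (p - 1) * b) <= p * (a `^ p * ((p - 1) / p) + b `^ p / p) by rewrite ler_pM2l.
have -> : p * (a `^ p * ((p - 1) / p) + b `^ p / p) = (p - 1) * a `^ p + b `^ p by field; lra.
have := mulr_powRB1 a0 p0 => E H2.
have -> : p * a `^ (p - 1) * (b - a) = p * (a `^ (p - 1) * b) - p * a `^ p by rewrite -E; ring.
lra.
Qed.

Lemma powR_dist p a b : 1 < p -> 0 <= a -> 0 <= b ->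
  `|a `^ p - b `^ p| <= p * `|a - b| * (a `^ (p - 1) + b `^ (p - 1)).
Proof.
move=> p1; wlog ba : a b / b <= a.
  move=> W a0 b0; case: (leP b a) => [|/ltW] h; first exact: W.
  by rewrite distrC (distrC a) (addrC (a `^ _)); exact: W.
move=> a0 b0; have p0 : 0 <= p by lra.
rewrite ger0_norm ?subr_ge0 ?ge0_ler_powR // ger0_norm ?subr_ge0 //.
have := powR_tangent p1 a0 b0.
have : 0 <= p * (a - b) * b `^ (p - 1) by rewrite !mulr_ge0 ?subr_ge0 ?powR_ge0.
lra.
Qed.

(** In the sum of the two tangent inequalities at the midpoint the linear terms cancel. *)
Lemma powR_midpoint p a b : 1 <= p -> 0 <= a -> 0 <= b ->
  ((a + b) / 2) `^ p <= (a `^ p + b `^ p) / 2.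
Proof.
rewrite le_eqVlt => /predU1P[<-|p1] a0 b0.
  by rewrite !powRr1 ?divr_ge0 ?addr_ge0.
have m0 : 0 <= (a + b) / 2 by rewrite divr_ge0 ?addr_ge0.
have := powR_tangent p1 m0 a0; have := powR_tangent p1 m0 b0.
set q := _ `^ (p - 1); set m := _ `^ p.
have -> : p * q * (b - (a + b) / 2) = p * q * (b - a) / 2 by field.
have -> : p * q * (a - (a + b) / 2) = - (p * q * (b - a) / 2) by field.
lra.
Qed.

(** Let m = (1 + b)/2, t = (1 - b)/2 and let s = m - t/2 be halfway between b and m. The tangents at
    m, evaluated at 1 and s, and the tangent at s, evaluated at b, leave a gain of p (t/2) (m^(p-1)
    - s^(p-1)) / 2. It is bounded below because m >= 1/2, t >= th/2 and s/m <= 1 - th/4. *)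
Lemma powR_midpoint_strict p th : 1 < p -> 0 < th -> th <= 1 -> exists2 c : R, 0 < c &
  forall b, 0 <= b -> b <= 1 - th -> c <= (1 + b `^ p) / 2 - ((1 + b) / 2) `^ p.
Proof.
move=> p1 th0 th1; pose c := 2^-1 `^ (p - 1) * (1 - (1 - th / 4) `^ (p - 1)).
have c0 : 0 < c.
  rewrite mulr_gt0 ?powR_gt0 // subr_gt0 -[ltRHS](congr1 (@^~ (p - 1)) (@powR1 R)).
  by rewrite gt0_ltr_powR ?nnegrE; lra.
exists (p * (th / 4) * c / 2).
  by rewrite divr_gt0 // mulr_gt0 // mulr_gt0 //; lra.
move=> b b0 bth; set m := (1 + b) / 2; pose t := (1 - b) / 2; pose s := m - t / 2.
have m0 : 2^-1 <= m by rewrite /m; lra.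
have m0' : 0 <= m by lra.
have s0 : 0 <= s by rewrite /s /m /t; lra.
have t0 : th / 2 <= t by rewrite /t; lra.
have H1 := powR_tangent p1 m0' ler01.
have H2 := powR_tangent p1 s0 b0.
have H3 := powR_tangent p1 m0' s0.
rewrite powR1 in H1.
have Hs : c <= m `^ (p - 1) - s `^ (p - 1).
  have -> : s = m * (1 - (t / 2) / m) by rewrite /s; field; lra.
  have h : t / 2 <= t / 2 / m.
    rewrite ler_pdivlMr; last by lra.
    rewrite -[leRHS]mulr1 ler_wpM2l //; [by lra|by rewrite /m; lra].
  have h' : t / 2 / m <= 1 by rewrite ler_pdivrMr; [rewrite /m /t; lra|lra].
  rewrite powRM //; last by lra.
  rewrite -[X in X - _]mulr1 -mulrBr /c; apply: ler_pM; rewrite ?powR_ge0 //.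
  - by apply: ltW; rewrite subr_gt0 -[ltRHS](congr1 (@^~ (p - 1)) (@powR1 R)) gt0_ltr_powR ?nnegrE; lra.
  - by apply: ge0_ler_powR; rewrite ?nnegrE; lra.
  - by rewrite lerD2l lerN2; apply: ge0_ler_powR; rewrite ?nnegrE; lra.
have K : p * (th / 4) * c <= p * (t / 2) * (m `^ (p - 1) - s `^ (p - 1)).
  apply: ler_pM => //; [|exact: ltW|].
    by apply: mulr_ge0; lra.
  by rewrite ler_pM2l; lra.
have E1 : p * m `^ (p - 1) * (1 - m) = p * t * m `^ (p - 1) by rewrite /t /m; field.
have E2 : p * s `^ (p - 1) * (b - s) = - (p * (t / 2) * s `^ (p - 1)) by rewrite /s /t /m; field.
have E3 : p * m `^ (p - 1) * (s - m) = - (p * (t / 2) * m `^ (p - 1)) by rewrite /s; field.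
move: K H1 H2 H3; rewrite E1 E2 E3; set X := m `^ (p - 1); set Y := s `^ (p - 1).
have -> : p * t * X = 2 * (p * (t / 2) * X) by field.
rewrite mulrBr; lra.
Qed.

(* [A], [B], [M], [D] stand for |x|, |y|, |(x + y)/2|, |(x - y)/2|, tied by the
   parallelogram identity. *)
Lemma uniform_convexity p eta : 1 < p -> 0 < eta -> exists2 C : R, 0 <= C &
  forall A B M D : R, 0 <= A -> 0 <= B -> 0 <= M -> 0 <= D ->
   M ^+ 2 + D ^+ 2 = (A ^+ 2 + B ^+ 2) / 2 -> M <= (A + B) / 2 ->
   D `^ p <= eta * (A `^ p + B `^ p) + C * ((A `^ p + B `^ p) / 2 - M `^ p).
Proof.
move=> p1 eta0; have p0 : 0 < p by lra.
(* For D up to [dl] the term D^p is at most eta; the cap 1/2 keeps 1 - dl^2 positive. *)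
pose dl := Num.min (eta `^ p^-1) 2^-1.
have dl0 : 0 < dl by rewrite lt_min powR_gt0 //=; lra.
have dl1 : dl <= 2^-1 by rewrite ge_min lexx orbT.
have dle : dl `^ p <= eta.
  rewrite -[leRHS]powRr1 ?(ltW eta0) // -(@mulVf _ p) ?gt_eqF // powRrM.
  by rewrite ge0_ler_powR ?nnegrE ?(ltW dl0) ?(ltW p0) ?powR_ge0 // ge_min lexx.
(* Chosen so that (1 - th)^2 >= 1 - dl^2/2: then B > 1 - th makes B^p at least (1 -
   dl^2/2)^(p/2). *)
pose th := dl ^+ 2 / 4.
have dl2 : dl ^+ 2 <= 2^-1 by rewrite expr2; nra.
have dl20 : 0 < dl ^+ 2 by rewrite exprn_gt0.
have [||c1 c10 H1] := @powR_midpoint_strict p th p1; [by rewrite /th; lra|by rewrite /th; lra|].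
pose c2 := (1 - dl ^+ 2 / 2) `^ (p / 2) - (1 - dl ^+ 2) `^ (p / 2).
have c20 : 0 < c2.
  by rewrite subr_gt0; apply: gt0_ltr_powR; rewrite ?nnegrE; lra.
pose c := Num.min c1 c2; have c0 : 0 < c by rewrite lt_min c10.
(* The case A = 1 >= B. If D <= dl, the eta term suffices. If B <= 1 - th, strict convexity makes
   the gap at least c1. Otherwise the parallelogram identity gives M^2 <= 1 - dl^2 while B is close
   to 1, and the gap is at least c2. *)
have norm1 B M D : 0 <= B -> B <= 1 -> 0 <= M -> 0 <= D ->
   M ^+ 2 + D ^+ 2 = (1 + B ^+ 2) / 2 -> M <= (1 + B) / 2 ->
   D `^ p <= eta + c^-1 * ((1 + B `^ p) / 2 - M `^ p).
  move=> B0 B1 M0 D0 MD Mm.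
  have Mp : M `^ p <= ((1 + B) / 2) `^ p by rewrite ge0_ler_powR ?nnegrE ?(ltW p0) //; lra.
  have g0 : 0 <= (1 + B `^ p) / 2 - M `^ p.
    have := powR_midpoint (ltW p1) ler01 B0; rewrite powR1; lra.
  have cg : 0 <= c^-1 * ((1 + B `^ p) / 2 - M `^ p) by rewrite mulr_ge0 // invr_ge0 ltW.
  have [Ddl|dlD] := leP D dl.
    have : D `^ p <= dl `^ p by rewrite ge0_ler_powR ?nnegrE // ltW.
    lra.
  have B21 : B ^+ 2 <= 1 by rewrite expr_le1.
  have D1 : D `^ p <= 1.
    rewrite -[leRHS](congr1 (@^~ p) (@powR1 R)) ge0_ler_powR ?nnegrE ?(ltW p0) //.
    rewrite -(@expr_le1 _ 2) //; have := sqr_ge0 M; lra.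
  suff : c <= (1 + B `^ p) / 2 - M `^ p.
    move=> h; have : 1 <= c^-1 * ((1 + B `^ p) / 2 - M `^ p) by rewrite ler_pdivlMl // mulr1.
    lra.
  have [Bth|thB] := leP B (1 - th).
    have := H1 B B0 Bth; have : c <= c1 by rewrite ge_min lexx.
    lra.
  have cc2 : c <= c2 by rewrite ge_min lexx orbT.
  have sqp x : 0 <= x -> x `^ p = (x ^+ 2) `^ (p / 2).
    by move=> x0; rewrite -powR_mulrn // -powRrM; congr (_ `^ _); field.
  have D2 : dl ^+ 2 <= D ^+ 2 by rewrite ler_pXn2r ?nnegrE // ltW.
  have MM : M `^ p <= (1 - dl ^+ 2) `^ (p / 2).
    rewrite sqp // ge0_ler_powR ?nnegrE ?sqr_ge0 //; lra.
  have BB : (1 - dl ^+ 2 / 2) `^ (p / 2) <= B `^ p.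
    rewrite sqp // ge0_ler_powR ?nnegrE ?sqr_ge0 //; try lra.
    apply: (@le_trans _ _ ((1 - th) ^+ 2)).
      have -> : (1 - th) ^+ 2 = 1 - 2 * th + th ^+ 2 by ring.
      by have := sqr_ge0 th; rewrite {2}/th; lra.
    have thE : th = dl ^+ 2 / 4 by [].
    by rewrite ler_pXn2r ?nnegrE //; lra.
  have B1p : B `^ p <= 1.
    by rewrite -[leRHS](congr1 (@^~ p) (@powR1 R)) ge0_ler_powR ?nnegrE // ?ltW.
  by rewrite /c2 in cc2; lra.
exists c^-1; first by rewrite invr_ge0 ltW.
move=> A B M D; wlog BA : A B / B <= A.
  move=> W A0 B0 M0 D0 H Hm; case: (leP B A) => [|/ltW] h; first exact: W.
  by rewrite (addrC (A `^ p)); apply: W => //; [rewrite (addrC (B ^+ 2))|rewrite (addrC B)].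
move=> A0 B0 M0 D0 H Hm.
have [A00|An0] := eqVneq A 0.
  have B00 : B = 0 by lra.
  rewrite A00 B00 !expr0n /= addr0 mul0r in H Hm *.
  have M00 : M = 0 by lra.
  have D00 : D = 0.
    by apply/eqP; have := H; rewrite M00 expr0n /= add0r => /eqP; rewrite expf_eq0.
  by rewrite D00 M00 powR0 ?gt_eqF // addr0 mulr0 mul0r subr0 mulr0 addr0.
have Ap : 0 < A by rewrite lt_neqAle eq_sym An0.
(* The inequality is homogeneous of degree p, so division by A reduces it to the case A = 1. *)
have := norm1 (B / A) (M / A) (D / A).
rewrite !divr_ge0 // ler_pdivrMr // mul1r => /(_ isT BA isT isT) h.
have {h} : (D / A) `^ p <= eta + c^-1 * ((1 + (B / A) `^ p) / 2 - (M / A) `^ p).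
  apply: h.
    rewrite !expr_div_n -mulrDl H; field; lra.
  by rewrite ler_pdivrMr //; apply: le_trans Hm _; rewrite le_eqVlt; apply/orP; left; apply/eqP; field.
have dv x : 0 <= x -> (x / A) `^ p = x `^ p / A `^ p.
  by move=> x0; rewrite powRM ?invr_ge0 // -powR_inv1 // powRAC powR_inv1 // powR_ge0.
have App : 0 < A `^ p by rewrite powR_gt0.
rewrite !dv // ler_pdivrMr // => /le_trans; apply.
have -> : (eta + c^-1 * ((1 + B `^ p / A `^ p) / 2 - M `^ p / A `^ p)) * A `^ p =
  eta * A `^ p + c^-1 * ((A `^ p + B `^ p) / 2 - M `^ p) by field; rewrite !gt_eqF.
by rewrite lerD2r ler_pM2l // lerDl powR_ge0.
Qed.
End powR_inequalities.

(** * Almost everywhere convergence and completeness of L^p *)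

Section ae_convergence.
Context d (T : measurableType d) (R : realType) (mu : {measure set T -> \bar R}).

Lemma cvg_EFinT (u : nat -> R) (l : R) : u @ \oo --> l ->
  (fun n => (u n)%:E) @ \oo --> l%:E.
Proof. by move=> ul; apply/fine_cvgP; split => //; exact: nearW. Qed.

(** The series of the 2^n g_n has integral at most the sum of the 2^-n, hence is finite almost
    everywhere; its value at x serves as C, since it bounds each of its terms. *)
Lemma ae_geometric_decay (g : nat -> T -> R) :
  (forall n, measurable_fun [set: T] (g n)) -> (forall n x, 0 <= g n x) ->
  (forall n, \int[mu]_x (g n x)%:E <= ((4^-1) ^+ n)%:E)%E ->
  {ae mu, forall x, exists C : R, forall n, g n x <= C * 2^-1 ^+ n}.
Proof.
move=> mg g0 ig; pose h n x : \bar R := (2 ^+ n * g n x)%:E.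
have mh n : measurable_fun [set: T] (h n) by apply/measurable_EFinP/measurable_funM.
have h0 n x : (0 <= h n x)%E by rewrite lee_fin mulr_ge0 // exprn_ge0.
have hint n : (\int[mu]_x h n x <= (2^-1 ^+ n)%:E)%E.
  rewrite /h; under eq_integral do rewrite EFinM.
  rewrite ge0_integralZl_EFin ?exprn_ge0 //; last 2 first.
  - by move=> x _; rewrite lee_fin.
  - exact/measurable_EFinP.
  apply: (@le_trans _ _ ((2 ^+ n)%:E * ((4^-1) ^+ n)%:E)%E).
    by apply: lee_wpmul2l => //; rewrite lee_fin exprn_ge0.
  by rewrite -EFinM lee_fin -exprMn (_ : 2 * 4^-1 = 2^-1 :> R) //; lra.
have hlt : (\int[mu]_x (\sum_(n <oo) h n x) < +oo)%E.
  rewrite integral_nneseries //.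
  apply: (@le_lt_trans _ _ (\sum_(n <oo) (2^-1 ^+ n)%:E)%E).
    by apply: lee_nneseries => // n _ _; apply: integral_ge0.
  have H : series (geometric 1 2^-1) @ \oo --> (1 / (1 - 2^-1) : R).
    by apply: cvg_geometric_series; rewrite ger0_norm // invf_lt1 // ltr1n.
  suff -> : (\sum_(n <oo) (2^-1 ^+ n)%:E)%E = (1 / (1 - 2^-1) : R)%:E by rewrite ltry.
  apply/cvg_lim => //; apply: cvg_trans (cvg_EFinT H).
  apply: near_eq_cvg; apply: nearW => n /=.
  by rewrite /series /geometric /= sumEFin; congr EFin; apply: eq_bigr => i _; rewrite mul1r.
have ih : mu.-integrable setT (fun x => \sum_(n <oo) h n x)%E.
  apply/integrableP; split; first exact: ge0_emeasurable_sum.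
  by under eq_integral do rewrite gee0_abs ?nneseries_ge0 //.
have := integrable_ae measurableT ih; apply: filterS => x /(_ Logic.I) fx.
exists (fine (\sum_(n <oo) h n x)) => n.
rewrite exprVn ler_pdivlMr ?exprn_gt0 // mulrC -lee_fin fineK //.
have := @nneseries_lim_ge R (h ^~ x) xpredT 0 n.+1 (fun m _ _ => h0 m x); apply: le_trans.
by rewrite big_nat_recr //= leeDr //; apply: sume_ge0 => m _; exact: h0.
Qed.

(** The limit k agrees almost everywhere with the lower limit of h, to which Fatou's lemma
    applies. *)
Lemma fatou_ae (h : nat -> T -> R) (k : T -> R) (c : \bar R) :
  (forall n, measurable_fun [set: T] (h n)) -> measurable_fun [set: T] k ->
  (forall n x, 0 <= h n x) -> (forall x, 0 <= k x) ->
  {ae mu, forall x, (fun n => h n x) @ \oo --> k x} ->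
  (\forall n \near \oo, \int[mu]_x (h n x)%:E <= c)%E ->
  (\int[mu]_x (k x)%:E <= c)%E.
Proof.
move=> mh mk h0 k0 hk hc.
have mhE n : measurable_fun [set: T] (fun x => (h n x)%:E) by apply/measurable_EFinP.
have E : (\int[mu]_x (k x)%:E = \int[mu]_x limn_einf (fun n => (h n x)%:E))%E.
  apply: ae_eq_integral => //; first exact/measurable_EFinP.
    rewrite (_ : (fun x => _) = (fun x => - limn_esup (fun n => - (h n x)%:E))%E).
      apply: (measurableT_comp (@oppe_measurable _ _)) => //.
      by apply: measurable_fun_limn_esup => n; exact: (measurableT_comp (@oppe_measurable _ _)).
    apply/funext => x; rewrite -limn_einfN; congr limn_einf.
    by apply/funext => n /=; rewrite opprK.
  apply: filterS hk => x hx _; by rewrite (cvg_limn_einf_sup (cvg_EFinT hx)).1.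
rewrite E; apply: le_trans (fatou mu measurableT mhE _) _; first by move=> n x _; rewrite lee_fin.
rewrite limn_einf_lim; apply: lime_le; first exact: is_cvg_einfs.
apply: nearW => n; have [M _ HM] := hc.
apply: (@le_trans _ _ (\int[mu]_x (h (maxn n M) x)%:E)%E).
  (* The tail infimum from n on is compared with an index that is also beyond M, where the bound on
     the integrals is available. *)
  by apply: ereal_inf_lbound; exists (maxn n M) => //=; exact: leq_maxl.
by apply: HM; exact: leq_maxr.
Qed.
End ae_convergence.

Section powR_limits.
Variable R : realType.

Lemma limit_le (u : nat -> R) (l c : R) : u @ \oo --> l ->
  (\forall n \near \oo, u n <= c) -> l <= c.
Proof.
by move=> ul uc; rewrite -(cvg_lim _ ul) //; apply: limr_le => //; apply: cvgP ul.
Qed.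

Lemma cvg_powR_norm (u : nat -> R) (l p : R) : 1 <= p -> u @ \oo --> l ->
  (fun n => `|u n| `^ p) @ \oo --> `|l| `^ p.
Proof.
rewrite le_eqVlt => /predU1P[<-|p1] ul.
  rewrite powRr1 //; under eq_fun do rewrite powRr1 //; exact: cvg_norm.
have lb : \forall n \near \oo, `|u n| <= `|l| + 1.
  move/cvgrPdist_lt : ul => /(_ 1 ltr01); apply: filterS => n h.
  by rewrite -[u n](subrK l) (le_trans (ler_normD _ _)) // addrC lerD2l distrC ltW.
pose K := p * (2 * (`|l| + 1) `^ (p - 1)).
have K0 : 0 < K + 1.
  by apply: ltr_wpDl => //; rewrite mulr_ge0 ?mulr_ge0 ?powR_ge0 //; lra.
apply/cvgrPdist_le => e e0; near=> n.
apply: le_trans (powR_dist p1 (normr_ge0 _) (normr_ge0 _)) _.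
have un : `|u n| <= `|l| + 1 by near: n.
apply: (@le_trans _ _ (K * `|l - u n|)).
  rewrite -mulrA (mulrC `|_ - _|) mulrA -mulrA /K -mulrA ler_pM2l; last by lra.
  rewrite ler_pM ?addr_ge0 ?powR_ge0 ?lerB_dist //; last exact: ler_dist_dist.
  have l0 := normr_ge0 l.
  by rewrite mulr2n mulrDl mul1r lerD //; apply: ge0_ler_powR; rewrite ?nnegrE //; lra.
apply: (@le_trans _ _ ((K + 1) * `|l - u n|)); first by rewrite ler_wpM2r // lerDl.
rewrite mulrC -ler_pdivlMr //; near: n.
by move/cvgrPdist_le : ul; apply; rewrite divr_gt0.
Unshelve. all: end_near. Qed.

Lemma cvg_of_geometric (u : nat -> R) (C q : R) : 0 <= q < 1 ->
  (forall n, `|u n.+1 - u n| <= C * q ^+ n) -> exists l : R, u @ \oo --> l.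
Proof.
move=> /andP[q0 q1] H; pose du n := u n.+1 - u n.
have : cvgn (series du).
  apply: normed_cvg; apply: (@series_le_cvg _ _ (geometric C q)) => [n|n|n|] //=.
  - exact: le_trans (normr_ge0 _) (H n).
  - exact: H.
  by apply: is_cvg_geometric_series; rewrite ger0_norm.
move=> /cvg_ex[l Hl]; exists (l + u 0%N).
have E : series du + cst (u 0%N) = u.
  by apply/funext => n; rewrite !fctE /series /= telescope_sumr // subrK.
have : (series du + cst (u 0%N)) @ \oo --> l + u 0%N by apply: cvgD => //; exact: cvg_cst.
by rewrite E.
Qed.
End powR_limits.

Lemma measurable_powR_norm d (T : measurableType d) (R : realType) (g : T -> R) (q : R) :
  measurable_fun [set: T] g -> measurable_fun [set: T] (fun x => `|g x| `^ q).
Proof.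
by move=> mg; apply: (measurableT_comp (measurable_powR q)); exact: measurableT_comp.
Qed.

Section Lp_completeness.
Context d (T : measurableType d) (R : realType) (mu : {measure set T -> \bar R}).
Variables (I : finType) (p : R) (f : I -> nat -> T -> R).
Hypothesis p1 : 1 <= p.
Hypothesis mf : forall i n, measurable_fun [set: T] (f i n).

(** Along a subsequence for which the integrals of the p-th powers of the increments are at most
    4^-n, these powers decay like 2^-n almost everywhere, so the increments decay like a geometric
    sequence of ratio 2^(-1/p). The limit is defined as an upper limit, which makes it measurable.
    One subsequence serves the whole finite family. *)
Lemma Lp_Cauchy_subsequence :
  (forall e : R, 0 < e -> exists M, forall m n i, (M <= m)%N -> (M <= n)%N ->
     (\int[mu]_x (`|f i m x - f i n x| `^ p)%:E <= e%:E)%E) ->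
  exists2 s, subsequence s & exists g : I -> T -> R,
    (forall i, measurable_fun [set: T] (g i)) /\
    forall i, {ae mu, forall x, (fun n => f i (s n) x) @ \oo --> g i x}.
Proof.
move=> fC; have p0 : 0 < p := lt_le_trans ltr01 p1.
have [|s ss Hs] := @extract_subsequence (fun n k => forall m i, (k <= m)%N ->
    (\int[mu]_x (`|f i k x - f i m x| `^ p)%:E <= (4^-1 ^+ n)%:E)%E).
  move=> n m; have [|M HM] := fC (4^-1 ^+ n); first by rewrite exprn_gt0.
  exists (maxn M m.+1); first exact: leq_maxr.
  move=> k i k1; apply: HM; first exact: leq_maxl.
  exact: leq_trans (leq_maxl _ _) k1.
exists s => //; exists (fun i x => fine (limn_esup (fun n => (f i (s n) x)%:E))); split.
  move=> i; apply: (measurableT_comp (fine_measurable measurableT)) => //.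
  by apply: measurable_fun_limn_esup => n; exact/measurable_EFinP.
move=> i; pose g n x := `|f i (s n) x - f i (s n.+1) x| `^ p.
have mg n : measurable_fun [set: T] (g n) by exact/measurable_powR_norm/measurable_funB.
have := ae_geometric_decay mg (fun n x => powR_ge0 _ _) (fun n => Hs n (s n.+1) i (ltnW (ss n))).
apply: filterS => x [C HC].
pose q : R := 2^-1 `^ p^-1.
have q1 : 0 <= q < 1.
  rewrite powR_ge0 /=; rewrite /q -[ltRHS](congr1 (@^~ p^-1) (@powR1 R)).
  by apply: gt0_ltr_powR; rewrite ?invr_gt0 ?nnegrE //; lra.
have C0 : 0 <= C by have := HC 0%N; rewrite expr0 mulr1; apply: le_trans; exact: powR_ge0.
have [|l Hl] := @cvg_of_geometric R (fun n => f i (s n) x) (C `^ p^-1) q q1.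
  move=> n; rewrite distrC.
  have pK (y : R) : 0 <= y -> (y `^ p) `^ p^-1 = y.
    by move=> y0; rewrite -powRrM mulfV ?gt_eqF // powRr1.
  rewrite -[leLHS]pK //.
  apply: (@le_trans _ _ ((C * 2^-1 ^+ n) `^ p^-1)).
    by apply: ge0_ler_powR; rewrite ?invr_ge0 ?nnegrE ?powR_ge0 ?mulr_ge0 ?exprn_ge0 ?(ltW p0) //; exact: HC.
  by rewrite powRM ?exprn_ge0 // -[2^-1 ^+ n]powR_mulrn // powRAC powR_mulrn ?powR_ge0.
by rewrite (cvg_limn_einf_sup (cvg_EFinT Hl)).2.
Qed.
End Lp_completeness.

(** * Integrals under measure-preserving maps *)

Section measure_preserving.
Context d (T : measurableType d) (R : realType) (mu : {measure set T -> \bar R}).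
Variable phi : T -> T.
Hypothesis mphi : measurable_fun [set: T] phi.
Hypothesis phi_preserves : forall A, measurable A -> mu (phi @^-1` A) = mu A.

Let ge0_preserving (f : T -> \bar R) : measurable_fun [set: T] f -> (forall x, 0 <= f x)%E ->
  (\int[mu]_x f (phi x) = \int[mu]_x f x)%E.
Proof.
move=> mf f0; transitivity (\int[pushforward mu phi]_x f x)%E.
  by rewrite ge0_integral_pushforward.
apply: eq_measure_integral.
all: try exact: mphi.
by move=> *; exact: phi_preserves.
Qed.

Lemma measure_preserving_integral (f : T -> \bar R) : measurable_fun [set: T] f ->
  (\int[mu]_x f (phi x) = \int[mu]_x f x)%E.
Proof.
move=> mf; rewrite integralE [RHS]integralE; congr (_ - _)%E.
  transitivity (\int[mu]_x funepos f (phi x))%E; first by apply: eq_integral => x _; rewrite !funeposE.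
  by apply: ge0_preserving => [|x]; [exact: measurable_funepos|exact: funepos_ge0].
transitivity (\int[mu]_x funeneg f (phi x))%E; first by apply: eq_integral => x _; rewrite !funenegE.
by apply: ge0_preserving => [|x]; [exact: measurable_funeneg|exact: funeneg_ge0].
Qed.

Lemma measure_preserving_integrable (f : T -> \bar R) : mu.-integrable [set: T] f ->
  mu.-integrable [set: T] (fun x => f (phi x)).
Proof.
move=> /integrableP[mf intf]; apply/integrableP; split; first exact: measurableT_comp.
by rewrite (ge0_preserving (f := fun x => `|f x|%E)) //; exact: measurableT_comp.
Qed.
End measure_preserving.

(** * Lebesgue measure on R^d: boxes, half-spaces, translations, open sets *)

Section lebesgue_Rd_theory.
Variables (R : realType) (d : nat).
Local Notation V := 'rV[R]_d.
Local Notation lam := (@leb_outer R d).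

Lemma leb_outer_le_content (A : set V) : (lam A <= @box_content R d A)%E.
Proof.
apply: ereal_inf_lbound; exists ((fun k => if k is 0%N then A else set0) : nat -> set (Rd_disc R d)).
  by split => // x Ax; exists 0%N.
rewrite nneseries_recl //; last by move=> k _; exact: box_content_ge0.
rewrite -[X in X = _]/(box_content (A : set (Rd_disc R d)) + _)%E.
rewrite eseries_cond eseries0 ?adde0 // => -[|k] //= _ _.
exact: box_content0.
Qed.

Lemma leb_outer_obox (a b : V) : (lam (obox a b) <= (box_vol a b)%:E)%E.
Proof.
apply: le_trans (leb_outer_le_content _) _; apply: ereal_inf_lbound.
by right; exists a, b.
Qed.

Definition set_coord (a : V) i (c : R) : V := \row_j (if j == i then c else a 0 j).

Lemma set_coordE a i c j : set_coord a i c 0 j = if j == i then c else a 0 j.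
Proof. by rewrite mxE. Qed.

Lemma box_volD1 (a b : V) i : box_vol a b =
  Num.max (b 0 i - a 0 i) 0 * \prod_(j < d | j != i) Num.max (b 0 j - a 0 j) 0.
Proof. by rewrite /box_vol (bigD1 i). Qed.

Lemma box_vol_set_coord (a b : V) i s t : box_vol (set_coord a i s) (set_coord b i t) =
  Num.max (t - s) 0 * \prod_(j < d | j != i) Num.max (b 0 j - a 0 j) 0.
Proof.
rewrite (box_volD1 _ _ i) !set_coordE eqxx; congr (_ * _).
by apply: eq_bigr => j /negbTE ji; rewrite !set_coordE ji.
Qed.

Lemma prod_max_ge0 (a b : V) (P : pred 'I_d) : 0 <= \prod_(j < d | P j) Num.max (b 0 j - a 0 j) 0.
Proof. by apply: prodr_ge0 => j _; rewrite le_max lexx orbT. Qed.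

Lemma split_length (u v c : R) :
  Num.max (v - Num.max u c) 0 + Num.max (Num.min v c - u) 0 <= Num.max (v - u) 0.
Proof. by rewrite /Num.max /Num.min; do ! case: ltP => ?; lra. Qed.

Definition halfspace (i : 'I_d) (c : R) : set V := [set x | c < x 0 i].
Definition hyperplane (i : 'I_d) (c : R) : set V := [set x | x 0 i = c].

(** The upper part of the box is again an open box. The lower part contains a face in the cutting
    hyperplane and is thickened by e' to fit into an open box; with K the volume of the
    cross-section, e' = e/(K+1) keeps the added volume at most e. *)
Lemma obox_split_le (a b : V) i c :
  (lam (obox a b `&` halfspace i c) + lam (obox a b `&` ~` halfspace i c)
    <= (box_vol a b)%:E)%E.
Proof.
set K := \prod_(j < d | j != i) Num.max (b 0 j - a 0 j) 0.
have K0 : 0 <= K by exact: prod_max_ge0.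
pose m := Num.max (a 0 i) c; pose M := Num.min (b 0 i) c.
have h1 : (lam (obox a b `&` halfspace i c) <= (Num.max (b 0 i - m) 0 * K)%:E)%E.
  have := leb_outer_obox (set_coord a i m) (set_coord b i (b 0 i)).
  rewrite box_vol_set_coord; apply: le_trans; apply: le_outer_measure => x [xab /= cx] j.
  rewrite !set_coordE; case: eqVneq => [->|_]; last exact: xab.
  by have /andP[? ?] := xab i; rewrite gt_max cx; apply/andP; split => //; apply/andP.
have h2 : (lam (obox a b `&` ~` halfspace i c) <= (Num.max (M - a 0 i) 0 * K)%:E)%E.
  apply/lee_addgt0Pr => e e0.
  pose e' := e / (K + 1); have K1 : 0 < K + 1 by lra.
  have e'0 : 0 < e' by rewrite divr_gt0.
  have := leb_outer_obox (set_coord a i (a 0 i)) (set_coord b i (M + e')).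
  rewrite box_vol_set_coord => H; apply: (@le_trans _ _ (Num.max (M + e' - a 0 i) 0 * K)%:E).
    apply: le_trans H; apply: le_outer_measure => x [xab /= /negP]; rewrite -leNgt => cx j.
    rewrite !set_coordE; case: eqVneq => [->|_]; last exact: xab.
    have /andP[ax xb] := xab i; rewrite ax /= /M; case: (leP (b 0 i) c) => bc; lra.
  rewrite -EFinD lee_fin; apply: (@le_trans _ _ ((Num.max (M - a 0 i) 0 + e') * K)).
    apply: ler_wpM2r => //; rewrite ge_max; apply/andP; split; last first.
      by rewrite addr_ge0 ?(ltW e'0) // le_max lexx orbT.
    have : M - a 0 i <= Num.max (M - a 0 i) 0 by rewrite le_max lexx.
    lra.
  rewrite mulrDl lerD2l (_ : e' * K = e * (K / (K + 1))); last by rewrite /e'; field; lra.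
  by rewrite ger_pMr // ler_pdivrMr; lra.
apply: le_trans (leeD h1 h2) _; rewrite -EFinD lee_fin -mulrDl (box_volD1 _ _ i) -/K.
by apply: ler_wpM2r => //; exact: split_length.
Qed.

(** Caratheodory's condition is tested on covers: a cover of X by boxes splits into covers of both
    pieces, and by [obox_split_le] cutting a box does not increase the total. *)
Lemma measurable_halfspace i c : measurable (halfspace i c : set (LebT R d)).
Proof.
apply: le_caratheodory_measurable => X.
set H := halfspace i c.
apply: le_ereal_inf_tmp => _ [A [_ XA] <-].
have A1 : (lam (X `&` H) <= \sum_(k <oo) lam (A k `&` H))%E.
  apply: le_trans (outer_measure_sigma_subadditive _ _).
  by apply: le_outer_measure => x [Xx Hx]; have [k _ Ak] := XA x Xx; exists k.
have A2 : (lam (X `&` ~` H) <= \sum_(k <oo) lam (A k `&` ~` H))%E.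
  apply: le_trans (outer_measure_sigma_subadditive _ _).
  by apply: le_outer_measure => x [Xx Hx]; have [k _ Ak] := XA x Xx; exists k.
apply: le_trans (leeD A1 A2) _.
rewrite -nneseriesD; last 2 first.
- by move=> k _ _; exact: outer_measure_ge0.
- by move=> k _ _; exact: outer_measure_ge0.
apply: lee_nneseries => k _; first by move=> _; apply: adde_ge0; exact: outer_measure_ge0.
apply: le_ereal_inf_tmp => v [[-> ->]|[a [b [-> ->]]]]; last exact: obox_split_le.
by rewrite !set0I !outer_measure0 adde0.
Qed.

(** Countably many cubes cover the space, and within each of them the hyperplane lies in slabs of
    arbitrarily small volume. *)
Lemma leb_hyperplane i c : lam (hyperplane i c) = 0%E.
Proof.
apply/eqP; rewrite eq_le outer_measure_ge0 andbT.
pose B n : V := const_mx n%:R.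
apply: (@le_trans _ _ (\sum_(n <oo) lam (obox (- B n) (B n) `&` hyperplane i c))%E).
  apply: le_trans (outer_measure_sigma_subadditive _ _).
  apply: le_outer_measure => /= x xc.
  have [n Hn] : exists n : nat, forall j, `|(x : V) 0 j| < n%:R.
    pose t (j : 'I_d) := (Num.truncn `|(x : V) 0 j|).+1.
    exists (\max_(j < d) t j)%N => j.
    apply: lt_le_trans (Num.Theory.truncnS_gt _) _; rewrite ler_nat.
    exact: (@leq_bigmax _ t).
  exists n => //; split => // j; rewrite /B !mxE.
  by have := Hn j; rewrite ltr_norml.
rewrite eseries0 // => n _ _.
apply/eqP; rewrite eq_le outer_measure_ge0 andbT; apply/lee_addgt0Pr => e e0; rewrite add0e.
set K := \prod_(j < d | j != i) Num.max (B n 0 j - (- B n) 0 j) 0.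
have K0 : 0 <= K by exact: prod_max_ge0.
pose e' := e / (2 * (K + 1)); have e'0 : 0 < e' by rewrite divr_gt0 //; lra.
have := leb_outer_obox (set_coord (- B n) i (c - e')) (set_coord (B n) i (c + e')).
rewrite box_vol_set_coord => H; apply: le_trans (le_trans H _).
  apply: le_outer_measure => x [xB /= xc] j; rewrite !set_coordE.
  case: eqVneq => [->|_]; last exact: xB.
  by rewrite xc; apply/andP; split; lra.
rewrite lee_fin -/K (_ : c + e' - (c - e') = 2 * e'); last by ring.
rewrite max_l; last by lra.
have -> : 2 * e' * K = e * (K / (K + 1)) by rewrite /e'; field; lra.
by rewrite ger_pMr // ler_pdivrMr; lra.
Qed.

Definition translate (h : V) (x : V) : V := x + h.

Lemma translateE h x i : translate h x 0 i = x 0 i + h 0 i.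
Proof. by rewrite mxE. Qed.

Lemma translateK h x : translate h (translate (- h) x) = x.
Proof. by rewrite /translate subrK. Qed.

Lemma preimage_translate_obox h a b : translate h @^-1` obox a b = obox (a - h) (b - h).
Proof.
apply/seteqP; split => x H i; have := H i; rewrite ?translateE !mxE;
by move=> /andP[? ?]; apply/andP; split; lra.
Qed.

Lemma box_vol_translate h (a b : V) : box_vol (a - h) (b - h) = box_vol a b.
Proof. by apply: eq_bigr => i _; rewrite !mxE; congr (Num.max _ _); ring. Qed.

Let leb_outer_translate_le h (A : set V) : (lam (translate h @^-1` A) <= lam A)%E.
Proof.
apply: le_ereal_inf_tmp => _ [F [_ AF] <-].
apply: le_trans (_ : (\sum_(k <oo) lam (translate h @^-1` (F k)) <= _)%E); last first.
  apply: lee_nneseries => k _; first by move=> _; exact: outer_measure_ge0.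
  apply: le_ereal_inf_tmp => v [[-> ->]|[a [b [-> ->]]]].
    by rewrite preimage_set0 outer_measure0.
  by rewrite preimage_translate_obox -(box_vol_translate h); exact: leb_outer_obox.
apply: le_trans (outer_measure_sigma_subadditive _ _).
by rewrite -preimage_bigcup; apply: le_outer_measure => x /= /AF.
Qed.

Lemma leb_outer_translate h (A : set V) : lam (translate h @^-1` A) = lam A.
Proof.
apply/eqP; rewrite eq_le leb_outer_translate_le /=.
have {1}-> : A = translate (- h) @^-1` (translate h @^-1` A).
  by apply/seteqP; split => x /=; rewrite translateK.
exact: leb_outer_translate_le.
Qed.

(** Caratheodory's condition for the preimage of A at X is the condition for A at the translated set
    X', because the outer measure is invariant. *)
Lemma measurable_translate h : measurable_fun [set: LebT R d] (translate h : LebT R d -> LebT R d).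
Proof.
move=> _ A mA; rewrite setTI; apply: le_caratheodory_measurable => X.
have XE : X = translate h @^-1` (translate (- h) @^-1` X).
  by apply/seteqP; split => x /=; rewrite /translate addrK.
change (lam (X `&` translate h @^-1` A) + lam (X `&` ~` (translate h @^-1` A)) <= lam X)%E.
pose X' := translate (- h) @^-1` X.
have E : lam X' = (lam (X' `&` A) + lam (X' `&` ~` A))%E := mA X'.
have XE1 : X `&` translate h @^-1` A = translate h @^-1` (X' `&` A) by rewrite {1}XE.
have XE2 : X `&` ~` (translate h @^-1` A) = translate h @^-1` (X' `&` ~` A) by rewrite {1}XE.
by rewrite XE1 XE2 !leb_outer_translate -E /X' leb_outer_translate lexx.
Qed.

Lemma integral_translate h (f : LebT R d -> \bar R) : measurable_fun [set: LebT R d] f ->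
  (\int[@Leb R d]_x f (translate h x) = \int[@Leb R d]_x f x)%E.
Proof.
apply: (measure_preserving_integral (phi := translate h : LebT R d -> LebT R d)).
  exact: measurable_translate.
by move=> A _; exact: leb_outer_translate.
Qed.

Lemma integrable_translate h (f : LebT R d -> \bar R) :
  (@Leb R d).-integrable [set: LebT R d] f ->
  (@Leb R d).-integrable [set: LebT R d] (fun x => f (translate h x)).
Proof.
apply: (measure_preserving_integrable (phi := translate h : LebT R d -> LebT R d)).
  exact: measurable_translate.
by move=> A _; exact: leb_outer_translate.
Qed.

Lemma measurable_hyperplane i c : measurable (hyperplane i c : set (LebT R d)).
Proof.
apply: le_caratheodory_measurable => X.
change (lam (X `&` hyperplane i c) + lam (X `&` ~` hyperplane i c) <= lam X)%E.
have -> : lam (X `&` hyperplane i c) = 0%E.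
  apply/eqP; rewrite eq_le outer_measure_ge0 andbT -(leb_hyperplane i c).
  by apply: le_outer_measure; exact: subIsetr.
by rewrite add0e; apply: le_outer_measure; exact: subIsetl.
Qed.

Lemma measurable_halfspace_le i c : measurable ([set x : V | c <= x 0 i] : set (LebT R d)).
Proof.
have -> : [set x : V | c <= x 0 i] = halfspace i c `|` hyperplane i c.
  apply/seteqP; split => x; rewrite /halfspace /hyperplane /= le_eqVlt.
    by move=> /predU1P[->|]; [right|left].
  by move=> [->|->]; rewrite ?eqxx ?orbT.
by apply: measurableU; [exact: measurable_halfspace|exact: measurable_hyperplane].
Qed.

Lemma measurable_obox (a b : V) : measurable (obox a b : set (LebT R d)).
Proof.
have -> : obox a b = \bigcap_(i in [set: 'I_d]) (halfspace i (a 0 i) `\` [set x : V | b 0 i <= x 0 i]).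
  apply/seteqP; split => x.
    move=> xab i _; have /andP[h1 h2] := xab i; split => //=.
    by apply/negP; rewrite -ltNge.
  by move=> H i; have [/= h1 /negP] := H i Logic.I; rewrite -ltNge => h2; apply/andP.
apply: fin_bigcap_measurable => [|i _]; first exact: finite_finset.
by apply: measurableD; [exact: measurable_halfspace|exact: measurable_halfspace_le].
Qed.

Lemma open_obox (a b : V) : open (obox a b).
Proof.
rewrite openE => x xab; rewrite /interior.
have H i : \forall y \near x, a 0 i < (y : V) 0 i < b 0 i.
  have /andP[h1 h2] := xab i.
  have cc : (fun y : V => y 0 i) @ x --> x 0 i by exact: coord_continuous.
  near=> y; apply/andP; split; near: y.
    exact: cvgr_gt cc _ h1.
  exact: cvgr_lt cc _ h2.
exact: filter_forall _ H.
Unshelve. all: end_near. Qed.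

Lemma rational_box (U : set V) (x : V) : open U -> U x ->
  exists q r : 'rV[rat]_d, obox (map_mx ratr q) (map_mx ratr r) x /\
    obox (map_mx ratr q) (map_mx ratr r) `<=` U.
Proof.
rewrite openE => /(_ x) oU Ux; have /nbhs_ballP[e /= e0 He] := oU Ux.
have H i : exists qr : rat * rat, x 0 i - e < ratr qr.1 :> R /\ ratr qr.1 < x 0 i :> R /\
    x 0 i < ratr qr.2 :> R /\ ratr qr.2 < x 0 i + e :> R.
  have [|q] := @rat_in_itvoo R (x 0 i - e) (x 0 i); first by lra.
  rewrite in_itv /= => /andP[? ?].
  have [|r] := @rat_in_itvoo R (x 0 i) (x 0 i + e); first by lra.
  by rewrite in_itv /= => /andP[? ?]; exists (q, r).
have [f Hf] := choice H.
exists (\row_i (f i).1), (\row_i (f i).2); split => [i|y Hy].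
  by rewrite !mxE; have [? [? [? ?]]] := Hf i; apply/andP.
apply: He; split => // i j; rewrite (ord1 i); have := Hy j; rewrite !mxE => /andP[? ?].
have [? [? [? ?]]] := Hf j; rewrite /ball /= ltr_distlC; apply/andP; split; lra.
Qed.

Lemma measurable_open (U : set V) : open U -> measurable (U : set (LebT R d)).
Proof.
move=> oU.
(* Pairs of rational corners are enumerated; codes that are invalid or whose box is not inside U
   contribute the empty set. *)
pose F (k : nat) : set V := if unpickle k is Some (q, r) then
  (if pselect (obox (map_mx ratr q) (map_mx ratr r : V) `<=` U) is left _
   then obox (map_mx ratr (q : 'rV[rat]_d)) (map_mx ratr (r : 'rV[rat]_d)) else set0) else set0.
have -> : U = \bigcup_k F k.
  apply/seteqP; split => x.
    move=> Ux; have [q [r [xqr qrU]]] := rational_box oU Ux.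
    by exists (pickle (q, r)) => //; rewrite /F pickleK; case: pselect.
  by move=> [k _]; rewrite /F; case: unpickle => // -[q r]; case: pselect => // h /h.
apply: bigcupT_measurable => k; rewrite /F; case: unpickle => // -[q r].
by case: pselect => // _; exact: measurable_obox.
Qed.

Lemma measurable_continuous (f : V -> R) : continuous f ->
  measurable_fun [set: LebT R d] (f : LebT R d -> R).
Proof.
move=> /continuousP cf; apply: (measurability (@RGenOpens.G R)) => //.
  exact: RGenOpens.measurableE.
move=> _ [_ [a [b ->]] <-]; rewrite setTI.
exact/measurable_open/cf/interval_open.
Qed.

Lemma Leb_obox_lty (a b : V) : (Leb (obox a b) < +oo)%E.
Proof. exact: le_lt_trans (leb_outer_obox a b) (ltry _). Qed.

Lemma open_cover (A : set V) (e : R) : (lam A < +oo)%E -> 0 < e ->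
  exists U : set V, [/\ open U, A `<=` U & (lam U <= lam A + e%:E)%E].
Proof.
move=> Afin e0.
have Af : lam A \is a fin_num by rewrite ge0_fin_numE // outer_measure_ge0.
have [_ [F [_ AF] <-] Fe] := lb_ereal_inf_adherent e0 Af.
exists (\bigcup_k F k); split => //.
  apply: bigcup_open => k _.
  (* The content of a set that is neither empty nor an open box is +oo, so a cover of finite total
     content consists of open sets and its union is open. *)
  have : (box_content (F k) < +oo)%E.
    rewrite ltNge leye_eq; apply/negP => /eqP koo; move: Fe.
    rewrite (eseries_pinfty _ _ koo) // ?ltNge ?leey // => n _.
    by rewrite -ltNye (lt_le_trans _ (box_content_ge0 _)).
  move=> /ereal_inf_lt[_ [[-> _]|[a [b [-> _]]]] _]; [exact: open0|exact: open_obox].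
apply: le_trans (ltW Fe); apply: le_trans (outer_measure_sigma_subadditive _ _) _.
apply: lee_nneseries => k _; first by move=> _; exact: outer_measure_ge0.
exact: leb_outer_le_content.
Qed.

End lebesgue_Rd_theory.

(** * Integrable functions and real-valued integrals *)

Section integral_toolkit.
Context d (T : measurableType d) (R : realType) (mu : {measure set T -> \bar R}).
Implicit Types f g : T -> R.

Definition L1_fun f := mu.-integrable [set: T] (EFin \o f).
(** Allows real arithmetic on integrals. Since [fine] sends infinite values to 0, it is meant for
    functions satisfying [L1_fun]. *)
Definition integralR f : R := fine (\int[mu]_x (f x)%:E)%E.

Local Notation L1 := L1_fun.
Local Notation J := integralR.

Lemma L1_measurable f : L1 f -> measurable_fun [set: T] f.
Proof. by move=> /integrableP[/measurable_EFinP]. Qed.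

Lemma J_EFin f : L1 f -> (\int[mu]_x (f x)%:E)%E = (J f)%:E.
Proof. by move=> Lf; rewrite /integralR fineK // (integrable_fin_num measurableT Lf). Qed.

Lemma L1D f g : L1 f -> L1 g -> L1 (fun x => f x + g x).
Proof. by move=> Lf Lg; have := integrableD measurableT Lf Lg; apply: eq_integrable. Qed.

Lemma L1Z (c : R) f : L1 f -> L1 (fun x => c * f x).
Proof. by move=> Lf; have := integrableZl measurableT c Lf; apply: eq_integrable. Qed.

Lemma L1N f : L1 f -> L1 (fun x => - f x).
Proof. by move=> Lf; have := integrableN Lf; apply: eq_integrable. Qed.

Lemma L1B f g : L1 f -> L1 g -> L1 (fun x => f x - g x).
Proof. by move=> Lf Lg; apply: L1D => //; exact: L1N. Qed.

Lemma L1_norm f : L1 f -> L1 (fun x => `|f x|).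
Proof. exact: integrable_norm. Qed.

Lemma L1_0 : L1 (fun=> 0).
Proof. exact: integrable0. Qed.

Lemma L1_sum (I : Type) (s : seq I) (F : I -> T -> R) : (forall i, L1 (F i)) ->
  L1 (fun x => \sum_(i <- s) F i x).
Proof.
move=> LF; elim: s => [|i s IH].
  by under eq_fun do rewrite big_nil; exact: L1_0.
by under eq_fun do rewrite big_cons; exact: L1D.
Qed.

Lemma L1_le f g : measurable_fun [set: T] f -> L1 g -> (forall x, `|f x| <= g x) -> L1 f.
Proof.
move=> mf Lg fg; apply: (le_integrable measurableT _ _ Lg); first exact/measurable_EFinP.
by move=> x _ /=; rewrite lee_fin (le_trans (fg x)) // ler_norm.
Qed.

Lemma L1M f g (K : R) : L1 f -> measurable_fun [set: T] g -> (forall x, `|g x| <= K) ->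
  L1 (fun x => f x * g x).
Proof.
move=> Lf mg gK; apply: (L1_le _ (L1Z K (L1_norm Lf))).
  by apply: measurable_funM => //; exact: L1_measurable.
by move=> x; rewrite normrM mulrC ler_wpM2r.
Qed.

Lemma JD f g : L1 f -> L1 g -> J (fun x => f x + g x) = J f + J g.
Proof.
move=> Lf Lg; apply: EFin_inj; rewrite EFinD -!J_EFin //; last exact: L1D.
exact: integralD_EFin.
Qed.

Lemma JZ (c : R) f : L1 f -> J (fun x => c * f x) = c * J f.
Proof.
move=> Lf; apply: EFin_inj; rewrite EFinM -!J_EFin //; last exact: L1Z.
by under eq_integral do rewrite EFinM; exact: integralZl.
Qed.

Lemma JN f : L1 f -> J (fun x => - f x) = - J f.
Proof.
by move=> Lf; rewrite -[RHS]mulN1r -JZ //; congr J; apply/funext => x; rewrite mulN1r.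
Qed.

Lemma JB f g : L1 f -> L1 g -> J (fun x => f x - g x) = J f - J g.
Proof. by move=> Lf Lg; rewrite JD //; [rewrite JN|exact: L1N]. Qed.

Lemma J_sum (I : Type) (s : seq I) (F : I -> T -> R) : (forall i, L1 (F i)) ->
  J (fun x => \sum_(i <- s) F i x) = \sum_(i <- s) J (F i).
Proof.
move=> LF; elim: s => [|i s IH].
  by under eq_fun do rewrite big_nil; rewrite big_nil /integralR integral0.
by under eq_fun do rewrite big_cons; rewrite big_cons JD ?IH //; exact: L1_sum.
Qed.

Lemma J_le f g : L1 f -> L1 g -> (forall x, f x <= g x) -> J f <= J g.
Proof.
move=> Lf Lg fg; rewrite -lee_fin -!J_EFin //.
by apply: le_integral => // x _; rewrite lee_fin.
Qed.

Lemma J_ge0 f : (forall x, 0 <= f x) -> 0 <= J f.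
Proof. by move=> f0; apply/fine_ge0/integral_ge0 => x _; rewrite lee_fin. Qed.

Lemma J_norm f : L1 f -> `|J f| <= J (fun x => `|f x|).
Proof.
move=> Lf; have Ln := L1_norm Lf; rewrite ler_norml; apply/andP; split.
  by rewrite -JN //; apply: J_le => //; [exact: L1N|move=> x; rewrite lerNl -normrN ler_norm].
by apply: J_le => // x; exact: ler_norm.
Qed.

Lemma J_ae f g : measurable_fun [set: T] f -> measurable_fun [set: T] g ->
  {ae mu, forall x, f x = g x} -> J f = J g.
Proof.
move=> mf mg fg; congr fine; apply: ae_eq_integral => //; try exact/measurable_EFinP.
by apply: filterS fg => x ->.
Qed.

Lemma J_dominated (F : nat -> T -> R) f g : (forall n, measurable_fun [set: T] (F n)) ->
  measurable_fun [set: T] f -> L1 g -> (forall n x, `|F n x| <= g x) ->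
  {ae mu, forall x, (fun n => F n x) @ \oo --> f x} ->
  L1 f /\ (fun n => J (F n)) @ \oo --> J f.
Proof.
move=> mF mf Lg Fg Ff.
have [Lf _ H] := @dominated_convergence _ _ _ mu _ measurableT (fun n x => (F n x)%:E)
  (fun x => (f x)%:E) (fun x => (g x)%:E) (fun n => (measurable_EFinP _ _).2 (mF n)) ((measurable_EFinP _ _).2 mf)
  (filterS (fun x H _ => cvg_EFinT H) Ff) Lg (nearW _ (fun x n _ => Fg n x)).
split => //; apply: fine_cvg; rewrite fineK; last exact: (integrable_fin_num measurableT Lf).
exact: H.
Qed.

Lemma L1_ae f g : measurable_fun [set: T] g -> L1 f -> {ae mu, forall x, f x = g x} -> L1 g.
Proof.
move=> mg /integrableP[mf fi] fg; apply/integrableP; split; first exact/measurable_EFinP.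
rewrite (ae_eq_integral (fun x => `|(f x)%:E|)%E) //.
- by apply: measurableT_comp => //; exact/measurable_EFinP.
- by apply: measurableT_comp.
- by apply: filterS fg => x ->.
Qed.

(** Dominated convergence with majorant K |w|; where the weight vanishes both sides are 0, so
    convergence of F matters only elsewhere. *)
Lemma J_weighted_cvg (F : nat -> T -> R) f w K : L1 w ->
  (forall n, measurable_fun [set: T] (F n)) -> measurable_fun [set: T] f ->
  (forall n x, `|F n x| <= K) -> {ae mu, forall x, w x != 0 -> (fun n => F n x) @ \oo --> f x} ->
  (fun n => J (fun x => w x * F n x)) @ \oo --> J (fun x => w x * f x).
Proof.
move=> Lw mF mf FK Ff; have mw := L1_measurable Lw.
apply: (J_dominated (g := fun x => K * `|w x|) _ _ _ _ _).2.
- by move=> n; exact: measurable_funM.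
- exact: measurable_funM.
- exact/L1Z/L1_norm.
- by move=> n x; rewrite normrM mulrC ler_wpM2r.
apply: filterS Ff => x H; have [w0|/H Fx] := eqVneq (w x) 0.
  by rewrite w0 mul0r; under eq_fun do rewrite mul0r; exact: cvg_cst.
by apply: cvgM => //; exact: cvg_cst.
Qed.

(** The subsequence serves pointwise convergence only. In L^1 the whole sequence converges: Fatou's
    lemma along s bounds the distance to the limit by the Cauchy modulus. *)
Lemma L1_complete (I : finType) (u : I -> nat -> T -> R) : (forall i k, L1 (u i k)) ->
  (forall e : R, 0 < e -> exists K, forall k l i, (K <= k)%N -> (K <= l)%N ->
    J (fun x => `|u i k x - u i l x|) <= e) ->
  exists2 s, subsequence s & exists v : I -> T -> R, forall i,
    [/\ L1 (v i), (fun k => J (fun x => `|u i k x - v i x|)) @ \oo --> 0 &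
        {ae mu, forall x, (fun k => u i (s k) x) @ \oo --> v i x}].
Proof.
move=> Lu u_cauchy.
have p11 (g : T -> R) : L1 g -> (\int[mu]_x (`|g x| `^ 1)%:E = (J (fun x => `|g x|))%:E)%E.
  by move=> Lg; rewrite -J_EFin; [apply: eq_integral => x _; rewrite powRr1|exact: L1_norm].
have [|s ss [v [mv vae]]] := Lp_Cauchy_subsequence (mu := mu) (lexx 1) (fun i k => L1_measurable (Lu i k)).
  move=> e e0; have [K HK] := u_cauchy e e0; exists K => k l i Kk Kl.
  by rewrite (p11 (fun x => u i k x - u i l x)) ?lee_fin; [exact: HK|exact: L1B].
have vlim (e : R) : 0 < e -> exists K, forall k i, (K <= k)%N ->
    (\int[mu]_x (`|u i k x - v i x|)%:E <= e%:E)%E.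
  move=> e0; have [K HK] := u_cauchy e e0; exists K => k i Kk.
  apply: (@fatou_ae _ _ _ mu (fun l x => `|u i k x - u i (s l) x|)) => //.
  - by move=> n; apply: L1_measurable; apply: L1_norm; exact: L1B.
  - by apply: measurableT_comp => //; apply: measurable_funB => //; exact: L1_measurable.
  - by apply: filterS (vae i) => x ux; apply: cvg_norm; apply: cvgB => //; exact: cvg_cst.
  exists K => // l /= Kl; rewrite J_EFin; last by apply: L1_norm; exact: L1B.
  by rewrite lee_fin; apply: HK => //; exact: leq_trans Kl (subsequence_le _ ss).
have Lv i : L1 (v i).
  have [K HK] := vlim 1 ltr01.
  have Ld : L1 (fun x => u i K x - v i x).
    apply/integrableP; split.
      by apply/measurable_EFinP/measurable_funB => //; exact: L1_measurable.
    by apply: le_lt_trans (HK K i (leqnn K)) _; exact: ltry.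
  by have := L1B (Lu i K) Ld; congr (L1 _); apply/funext => x; rewrite subKr.
exists s => //; exists v => i; split; [exact: Lv| |exact: vae].
apply/cvgrPdistC_le => e e0; have [K HK] := vlim e e0; exists K => // k /= Kk.
rewrite subr0 ger0_norm; last exact: J_ge0.
rewrite -lee_fin -J_EFin; first exact: HK.
by apply: L1_norm; exact: L1B.
Qed.

Lemma L1_indic_set (A : set T) : measurable A -> (mu A < +oo)%E ->
  L1 \1_A /\ J \1_A = fine (mu A).
Proof.
move=> mA Af; split; last by rewrite /integralR integral_indic ?setIT.
apply/integrableP; split; first by apply/measurable_EFinP/measurable_indic.
under eq_integral do rewrite gee0_abs ?lee_fin //.
by rewrite integral_indic ?setIT.
Qed.
End integral_toolkit.

#[global] Instance Leb_ae_filter (R : realType) (d : nat) :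
  Filter (nbhs (almost_everywhere (@Leb R d))).
Proof. exact: (ae_filter_ringOfSetsType (@Leb R d : {measure set _ -> \bar R})). Qed.

(** * Grids *)

Section grids.
Variables (R : realType) (d : nat).
Local Notation V := 'rV[R]_d.
Local Notation T := (LebT R d).
Local Notation mu := (@Leb R d).
Local Notation J := (@integralR _ T R mu).
Local Notation L1 := (@L1_fun _ T R mu).
Implicit Types (f g w : T -> R) (c l x : V).

(** Cells are open, so halving one loses a hyperplane: a grid covers its cube only up to a null
    set. *)
Definition cell l c : set V := obox c (c + l).
Definition axis (i : 'I_d) (t : R) : V := \row_j (if j == i then t else 0).

(* A grid is a list of corners together with the common vector of side lengths. *)
Definition grid := (seq V * V)%type.
Implicit Types G : grid.

(** The second half of a cell is the translate of the first by half a side. All cells stay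
    congruent, so one side vector serves the whole list. *)
Definition refine G i : grid :=
  (G.1 ++ [seq c + axis i (G.2 0 i / 2) | c <- G.1], G.2 - axis i (G.2 0 i / 2)).

Definition refine_all G : grid := foldl refine G (enum 'I_d).

Definition grid_at (a : V) (L : R) n : grid := iter n refine_all ([:: a], const_mx L).

(** The number of cells containing x. That it is at most the indicator of the cube expresses both
    that the cells are disjoint and that they lie in the cube. *)
Definition covering G x : R := \sum_(c <- G.1) \1_(cell G.2 c) x.

Lemma measurable_cell l c : measurable (cell l c : set T).
Proof. exact: measurable_obox. Qed.

Lemma cell_axis l c i t : cell l (c + axis i t) = translate (- axis i t) @^-1` cell l c.
Proof. by rewrite /cell preimage_translate_obox opprK addrAC. Qed.

Lemma cell_split l c i (h := l 0 i / 2) (l' := l - axis i h) x :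
  \1_(cell l' c) x + \1_(cell l' (c + axis i h)) x <= \1_(cell l c) x :> R /\
  (x 0 i <> c 0 i + h ->
   \1_(cell l' c) x + \1_(cell l' (c + axis i h)) x = \1_(cell l c) x :> R).
Proof.
have hE : h = l 0 i / 2 by [].
have left_ : cell l' c x -> cell l c x /\ x 0 i < c 0 i + h.
  move=> H; split; last by have := H i; rewrite !mxE eqxx => /andP[_]; rewrite hE; lra.
  have := H i; rewrite !mxE eqxx => /andP[h1 h2].
  move=> j; have := H j; rewrite !mxE; case: eqVneq => [->|_] /andP[h3 h4].
    by apply/andP; split; lra.
  by apply/andP; split; lra.
have right_ : cell l' (c + axis i h) x -> cell l c x /\ c 0 i + h < x 0 i.
  move=> H; split; last by have := H i; rewrite !mxE eqxx => /andP[].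
  have := H i; rewrite !mxE eqxx => /andP[h1 h2].
  move=> j; have := H j; rewrite !mxE; case: eqVneq => [->|_] /andP[h3 h4].
    by apply/andP; split; lra.
  by apply/andP; split; lra.
have cell_l : cell l c x -> x 0 i < c 0 i + h -> cell l' c x.
  move=> H xh j; have := H j; rewrite !mxE; case: eqVneq => [->|_] /andP[h3 h4];
  by apply/andP; split; lra.
have cell_r : cell l c x -> c 0 i + h < x 0 i -> cell l' (c + axis i h) x.
  move=> H xh j; have := H j; rewrite !mxE; case: eqVneq => [->|_] /andP[h3 h4];
  by apply/andP; split; lra.
have I A : \1_A x = (if pselect (A x) then 1 else 0) :> R.
  by rewrite indicE; case: pselect => /= Ax; [rewrite mem_set|rewrite memNset].
rewrite !I; case: (pselect (cell l' c x)) => [/left_[cx xl]|nl] /=.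
  case: pselect => [/right_[_]|_] /=; first by lra.
  by case: pselect => [_|[]//] /=; split => [|_]; lra.
case: (pselect (cell l' (c + axis i h) x)) => [/right_[cx xr]|nr] /=.
  by case: pselect => [_|[]//] /=; split => [|_]; lra.
case: pselect => [cx|_] /=; split => [|xh]; try lra.
by case: (ltgtP (x 0 i) (c 0 i + h)) => xch //; [case: nl|case: nr]; [exact: cell_l|exact: cell_r].
Qed.

Lemma covering_refine G i x : covering (refine G i) x <= covering G x.
Proof.
rewrite /covering /refine /= big_cat /= big_map -big_split /=.
by apply: ler_sum => c _; exact: (cell_split _ _ _ _).1.
Qed.

Lemma ae_seq (I : eqType) (s : seq I) (P : I -> T -> Prop) :
  (forall i, {ae mu, forall x, P i x}) -> {ae mu, forall x, forall i, i \in s -> P i x}.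
Proof.
move=> H; elim: s => [|i s IH]; first by apply: nearW => x i.
near=> x => j; rewrite inE => /predU1P[->|js]; first by near: x; exact: H.
by move: j js; near: x.
Unshelve. all: end_near. Qed.

Lemma ae_hyperplane i (t : R) : {ae mu, forall x : T, (x : V) 0 i <> t}.
Proof.
exists (hyperplane i t); split; [exact: measurable_hyperplane|exact: leb_hyperplane|].
by move=> x /= /contrapT.
Qed.

Lemma covering_refine_ae G i : {ae mu, forall x, covering (refine G i) x = covering G x}.
Proof.
have := @ae_seq _ G.1 (fun c x => (x : V) 0 i <> c 0 i + G.2 0 i / 2) (fun c => ae_hyperplane _ _).
apply: filterS => x H.
rewrite /covering /refine /= big_cat /= big_map -big_split /= big_seq [RHS]big_seq.
by apply: eq_bigr => c /H; exact: (cell_split _ _ _ _).2.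
Qed.

Lemma foldl_refine_covering G s :
  (forall x, covering (foldl refine G s) x <= covering G x) /\
  {ae mu, forall x, covering (foldl refine G s) x = covering G x}.
Proof.
elim: s G => [|i s IH] G /=; first by split => [x|]; [exact: lexx|exact: nearW].
have [le_ ae_] := IH (refine G i); split => [x|].
  exact: le_trans (le_ x) (covering_refine _ _ _).
by apply: filterS2 ae_ (covering_refine_ae G i) => x -> ->.
Qed.

Lemma grid_at_covering a L n :
  (forall x, covering (grid_at a L n) x <= \1_(cell (const_mx L) a) x) /\
  {ae mu, forall x, covering (grid_at a L n) x = \1_(cell (const_mx L) a) x}.
Proof.
elim: n => [|n [le_ ae_]].
  by split => [x|]; [|apply: nearW => x]; rewrite /covering big_seq1.
have [le1 ae1] := foldl_refine_covering (grid_at a L n) (enum 'I_d); split => [x|].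
  exact: le_trans (le1 x) (le_ x).
by apply: filterS2 ae1 ae_ => x E1 <-; rewrite -E1.
Qed.

Lemma foldl_refine_side G s j :
  (foldl refine G s).2 0 j = G.2 0 j / 2 ^+ count_mem j s.
Proof.
elim: s G => [|i s IH] G /=; first by rewrite expr0 divr1.
rewrite IH /= !mxE eq_sym; case: eqVneq => [->|_] /=; last by rewrite subr0 add0n.
rewrite add1n exprS invfM mulrA; congr (_ * _); lra.
Qed.

Lemma grid_at_side a L n j : (grid_at a L n).2 0 j = L / 2 ^+ n.
Proof.
elim: n => [|n IH]; first by rewrite /= mxE expr0 divr1.
rewrite [grid_at _ _ _]/= /refine_all foldl_refine_side IH count_uniq_mem ?enum_uniq //.
by rewrite mem_enum exprSr invfM mulrA.
Qed.

Definition step G (s : V -> R) (x : T) : R := \sum_(c <- G.1) s c * \1_(cell G.2 c) x.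

Lemma measurable_step G s : measurable_fun [set: T] (step G s).
Proof.
apply: measurable_sum => c; apply: measurable_funM; first exact: measurable_cst.
exact/measurable_indic/measurable_cell.
Qed.

Lemma step_bound a L n s (K : R) x : 0 <= K -> (forall c, `|s c| <= K) ->
  `|step (grid_at a L n) s x| <= K * \1_(cell (const_mx L) a) x.
Proof.
move=> K0 sK; apply: le_trans (ler_norm_sum _ _ _) _.
apply: (@le_trans _ _ (K * covering (grid_at a L n) x)).
  rewrite mulr_sumr; apply: ler_sum => c _; rewrite normrM ler_pM //.
  by rewrite indicE ger0_norm.
by rewrite ler_wpM2l //; exact: (grid_at_covering a L n).1.
Qed.

Lemma grid_at_fine a L (U : set V) x : open U -> U x ->
  \forall n \near \oo, forall c, cell (grid_at a L n).2 c x -> cell (grid_at a L n).2 c `<=` U.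
Proof.
rewrite openE => /(_ x) oU /oU /nbhs_ballP[e /= e0 He].
have := @cvg_geometric R L 2^-1; rewrite ger0_norm // invf_lt1 // ltr1n => /(_ isT).
move/cvgrPdistC_lt => /(_ e e0); apply: filterS => n /=; rewrite subr0 => Le c cx y cy.
apply: He; split => // i j; rewrite (ord1 i) /ball /=.
have := cx j; have := cy j; rewrite !mxE grid_at_side => /andP[h1 h2] /andP[h3 h4].
apply: le_lt_trans Le; apply: le_trans (ler_norm _); rewrite exprVn.
by rewrite ler_norml; apply/andP; split; lra.
Qed.

Lemma step_cvg a L (s : nat -> V -> R) (l : R) x :
  (forall n, covering (grid_at a L n) x = 1) ->
  (\forall n \near \oo, forall c, cell (grid_at a L n).2 c x -> s n c = l) ->
  (fun n => step (grid_at a L n) (s n) x) @ \oo --> l.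
Proof.
move=> cov sl; apply: cvg_near_cst; apply: filterS sl => n sn.
rewrite -[RHS]mulr1 -(cov n) /covering mulr_sumr; apply: eq_bigr => c _.
rewrite indicE; case: (pselect (cell (grid_at a L n).2 c x)) => h.
  by rewrite sn.
by rewrite memNset // !mulr0.
Qed.

(** Outer regularity with excess 4^-k: the indicators of the excess sets are bounded by C 2^-k at
    almost every point and therefore tend to 0 there. *)
Lemma open_approximation (A : set T) : measurable A -> (mu A < +oo)%E ->
  exists2 U : nat -> set V, (forall k, open (U k)) &
    {ae mu, forall x, (fun k => \1_(U k) x : R) @ \oo --> (\1_A x : R)}.
Proof.
move=> mA Afin.
have H k : exists U : set V, [/\ open U, A `<=` U & (mu U <= mu A + (4^-1 ^+ k)%:E)%E].
  by apply: open_cover => //; rewrite exprn_gt0.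
have [U HU] := choice H.
have mU k : measurable (U k : set T) by apply: measurable_open; have [] := HU k.
exists U => [k|]; first by have [] := HU k.
pose g k (x : T) : R := \1_(U k `\` A) x.
have mg k : measurable_fun [set: T] (g k) by apply/measurable_indic/measurableD.
have g0 k x : 0 <= g k x by rewrite /g indicE.
have ig k : (\int[mu]_x (g k x)%:E <= (4^-1 ^+ k)%:E)%E.
  rewrite integral_indic ?setIT; [|exact: measurableT|exact: measurableD].
  have [_ AU Ule] := HU k.
  have Ufin : (mu (U k) < +oo)%E by apply: le_lt_trans Ule _; rewrite lte_add_pinfty // ltry.
  have UA : U k `&` A = A by apply/setIidPr.
  rewrite measureD // UA.
  by rewrite leeBlDl // ge0_fin_numE // measure_ge0.
have := ae_geometric_decay mg g0 ig; apply: filterS => x [C HC].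
have -> : (fun k => \1_(U k) x : R) = (fun k => \1_A x + g k x).
  apply/funext => k; have [_ AU _] := HU k; rewrite /g !indicE.
  case: (pselect (A x)) => Ax.
    by rewrite (mem_set (AU _ Ax)) (mem_set Ax) memNset ?addr0 // => -[].
  rewrite (memNset Ax) add0r; congr (nat_of_bool _)%:R.
  by apply/idP/idP; rewrite !inE; [|case].
rewrite -[X in _ --> X]addr0; apply: cvgD; first exact: cvg_cst.
apply: (@squeeze_cvgr _ _ _ _ (fun=> 0) (fun k => C * 2^-1 ^+ k)).
- by apply: nearW => k; rewrite g0 HC.
- exact: cvg_cst.
by apply: cvg_geometric; rewrite ger0_norm // invf_lt1 // ltr1n.
Qed.

(** The sum counts the integers 1, ..., N that are at most y, so it is the integer part of y. *)
Lemma level_count (N : nat) (y : R) : 0 <= y <= N%:R ->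
  `|(\sum_(j < N) (nat_of_bool (j.+1%:R <= y)%R)%:R) - y| <= 1.
Proof.
elim: N => [|N IH] /andP[y0 yN].
  by rewrite big_ord0 sub0r normrN ger0_norm //; apply: le_trans yN _.
rewrite big_ord_recr /=; case: (leP y N%:R) => yN'.
  rewrite (_ : N.+1%:R <= y = false) ?addr0; first by apply: IH; rewrite y0.
  by apply/negbTE; rewrite -ltNge (le_lt_trans yN') // ltr_nat.
rewrite (eq_bigr (fun=> 1)); last first.
  by move=> j _; rewrite (_ : _ <= y) // (le_trans _ (ltW yN')) // ler_nat ltn_ord.
rewrite sumr_const card_ord; move: yN; rewrite -natr1 => yN.
by case: (_ <= y); rewrite ler_norml; apply/andP; split => /=; lra.
Qed.

(* A property of functions with values in [-K, K] that holds for the step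
   functions of all sufficiently fine grids and is stable under almost everywhere
   convergence holds for all measurable functions: approximate the superlevel sets
   by open sets, and these by unions of cells. *)
Section grid_density.
Variables (a : V) (L K : R) (n0 : nat) (P : (T -> R) -> Prop).
Let Q := cell (const_mx L) a.
Hypothesis K0 : 0 <= K.
Hypothesis P_step : forall n s, (n0 <= n)%N -> (forall c, `|s c| <= K) ->
  P (step (grid_at a L n) s).
Hypothesis P_cvg : forall (F : nat -> T -> R) (f : T -> R),
  (forall n, measurable_fun [set: T] (F n)) -> measurable_fun [set: T] f ->
  (forall n x, `|F n x| <= K) -> (forall x, `|f x| <= K) -> (forall n, P (F n)) ->
  {ae mu, forall x, Q x -> (fun n => F n x) @ \oo --> f x} -> P f.

(** A layer-cake sum: if b j tells whether f reaches the level -K + 2K (j+1)/(N+1), the value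
    differs from f by at most 2K/(N+1). *)
Let layer N (b : 'I_N.+1 -> R) : R := - K + 2 * K / N.+1%:R * \sum_(j < N.+1) b j.

Let layer_bound N (b : 'I_N.+1 -> R) : (forall j, 0 <= b j <= 1) -> `|layer b| <= K.
Proof.
move=> b01; have s0 : 0 <= \sum_j b j by apply: sumr_ge0 => j _; have /andP[] := b01 j.
have s1 : \sum_j b j <= N.+1%:R.
  rewrite -[leRHS]mulr1 -[in leRHS](card_ord N.+1) mulr_natl -sumr_const.
  by apply: ler_sum => j _; have /andP[] := b01 j.
have N0 : 0 < N.+1%:R :> R by [].
have c0 : 0 <= 2 * K / N.+1%:R by rewrite divr_ge0 // mulr_ge0.
have c1 : 2 * K / N.+1%:R * (\sum_j b j) <= 2 * K.
  by rewrite -[leRHS](divfK (lt0r_neq0 N0)) ler_wpM2l.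
have c2 : 0 <= 2 * K / N.+1%:R * (\sum_j b j) by rewrite mulr_ge0.
move: c1 c2; rewrite /layer; set z := _ * (\sum_j _) => c1 c2.
by have := K0; rewrite ler_norml => K0'; apply/andP; split; lra.
Qed.

Let ind01 (A : set T) (x : T) : 0 <= (\1_A x : R) <= 1.
Proof. by rewrite indicE; case: (_ \in _); rewrite /= lexx ler01. Qed.

Let layer_cvg N (b : nat -> 'I_N.+1 -> R) (l : 'I_N.+1 -> R) :
  (forall j, (fun n => b n j) @ \oo --> l j) -> (fun n => layer (b n)) @ \oo --> layer l.
Proof.
move=> bl; apply: cvgD; first exact: cvg_cst.
apply: cvgM; first exact: cvg_cst.
by apply: cvg_big => [|j _]; [exact: add_continuous|exact: bl].
Qed.

Let measurable_layer N (A : 'I_N.+1 -> set T) : (forall j, measurable (A j)) ->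
  measurable_fun [set: T] (fun x => layer (fun j => \1_(A j) x)).
Proof.
move=> mA; apply: measurable_funD; first exact: measurable_cst.
apply: measurable_funM; first exact: measurable_cst.
by apply: measurable_sum => j; exact: measurable_indic.
Qed.

Let P_open N (U : 'I_N.+1 -> set V) : (forall j, open (U j)) ->
  P (fun x => layer (fun j => \1_(U j) x)).
Proof.
move=> oU.
(* On each cell only those U j that contain the whole cell are counted. A point of U j eventually
   lies in such cells, so these step functions converge at almost every point of the cube. *)
pose s n c := layer (fun j => if pselect (cell (grid_at a L n).2 c `<=` U j) then 1 else 0).
have sK n c : `|s n c| <= K.
  by apply: layer_bound => j; case: pselect => _ /=; rewrite ?lexx ?ler01.
apply: (P_cvg (F := fun n => step (grid_at a L (n + n0)) (s (n + n0)%N))).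
- by move=> n; exact: measurable_step.
- by apply: measurable_layer => j; exact: measurable_open.
- move=> n x; apply: le_trans (step_bound _ _ _ _ K0 (sK _)) _.
  by rewrite -[leRHS]mulr1 ler_wpM2l //; have /andP[] := ind01 Q x.
- by move=> x; apply: layer_bound => j; exact: ind01.
- by move=> n; apply: P_step => //; exact: leq_addl.
have := ae_foralln (fun n => (grid_at_covering a L n).2).
apply: filterS => x cov Qx.
apply: (@cvg_comp _ _ _ (fun n => n + n0)%N (fun n => step (grid_at a L n) (s n) x) _ \oo).
  exact: cvg_addnr.
apply: step_cvg => [n|]; first by rewrite cov indicE mem_set.
have : \forall n \near \oo, forall j, U j x -> forall c, cell (grid_at a L n).2 c x ->
    cell (grid_at a L n).2 c `<=` U j.
  apply: filter_forall => j; case: (pselect (U j x)) => Ux.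
    by apply: filterS (grid_at_fine a L (oU j) Ux) => n H _.
  by apply: nearW => n /Ux.
apply: filterS => n Hn c cx; rewrite /s; congr layer; apply/funext => j.
case: pselect => /= [h|h]; rewrite indicE; first by rewrite mem_set //; exact: h.
by rewrite memNset // => Ux; apply: h; exact: Hn.
Qed.

Let P_layer N (A : 'I_N.+1 -> set T) : (forall j, measurable (A j)) ->
  P (fun x => layer (fun j => \1_(A j) x)).
Proof.
move=> mA; have mQ : measurable (Q : set T) by exact: measurable_cell.
(* Intersection with the cube provides the finite measure needed for approximation by open sets and
   changes nothing at the points of the cube. *)
have /choice[U HU] : forall j, exists U : nat -> set V, (forall k, open (U k)) /\
    {ae mu, forall x, (fun k => \1_(U k) x : R) @ \oo --> (\1_(A j `&` Q) x : R)}.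
  move=> j; have [|//|U oU aeU] := @open_approximation (A j `&` Q).
  - exact: measurableI.
  - by apply: le_lt_trans (Leb_obox_lty a (a + const_mx L)); apply: le_outer_measure; exact: subIsetr.
  by exists U.
apply: (P_cvg (F := fun k x => layer (fun j => \1_(U j k) x))).
- by move=> k; apply: measurable_layer => j; apply: measurable_open; exact: (HU j).1.
- exact: measurable_layer.
- by move=> n x; apply: layer_bound => j; exact: ind01.
- by move=> x; apply: layer_bound => j; exact: ind01.
- by move=> k; apply: P_open => j; exact: (HU j).1.
have : {ae mu, forall x, forall j, (fun k => \1_(U j k) x : R) @ \oo --> (\1_(A j `&` Q) x : R)}.
  by apply: filter_forall => j; exact: (HU j).2.
apply: filterS => x H Qx; apply: layer_cvg => j.
suff -> : \1_(A j) x = \1_(A j `&` Q) x :> R by exact: H.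
rewrite !indicE; congr (nat_of_bool _)%:R.
by apply/idP/idP; rewrite !inE => // -[].
Qed.

Lemma grid_density f : measurable_fun [set: T] f -> (forall x, `|f x| <= K) -> P f.
Proof.
move=> mf fK.
(* The rescaling below divides by 2K; for K = 0 the function is the zero step function. *)
have [K00|Kn0] := eqVneq K 0.
  suff -> : f = step (grid_at a L n0) (fun=> 0).
    by apply: P_step => // c; rewrite normr0.
  apply/funext => x; rewrite /step big1 => [|c _]; last by rewrite mul0r.
  by apply/eqP; rewrite -normr_le0 -K00.
have Kp : 0 < K by rewrite lt_neqAle eq_sym Kn0.
(* Maps [-K, K] onto [0, N+1], so that the levels become the integers. *)
pose y N x := (f x + K) * N.+1%:R / (2 * K).
pose A N (j : 'I_N.+1) : set T := [set x | j.+1%:R <= y N x].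
have mA N j : measurable (@A N j).
  have my : measurable_fun [set: T] (y N).
    apply: measurable_funM; last exact: measurable_cst.
    apply: measurable_funM; last exact: measurable_cst.
    by apply: measurable_funD => //; exact: measurable_cst.
  have -> : A N j = [set: T] `&` y N @^-1` `[j.+1%:R, +oo[%classic.
    by rewrite setTI; apply/seteqP; split => x; rewrite /A /= in_itv /= andbT.
  by apply: my => //; exact: measurable_itv.
apply: (P_cvg (F := fun N x => layer (fun j => \1_(@A N j) x))).
- by move=> N; exact: measurable_layer.
- by [].
- by move=> n x; apply: layer_bound => j; exact: ind01.
- by [].
- by move=> N; exact: P_layer.
apply: nearW => x _; apply/cvgrPdistC_le => e e0; near=> N.
have N0 : 0 < N.+1%:R :> R by [].
have y0 : 0 <= y N x <= N.+1%:R.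
  have := fK x; rewrite ler_norml => /andP[h1 h2].
  rewrite /y divr_ge0 ?mulr_ge0 //=; try lra.
  by rewrite ler_pdivrMr ?mulr_gt0 // mulrC ler_wpM2l //; lra.
have fE : f x = - K + 2 * K / N.+1%:R * y N x.
  have E (M z : R) : M != 0 -> z = - K + 2 * K / M * ((z + K) * M / (2 * K)).
    by move=> M0; field; rewrite M0 Kn0.
  exact: E _ _ (lt0r_neq0 N0).
have -> : layer (fun j => \1_(@A N j) x) - f x =
   2 * K / N.+1%:R * ((\sum_(j < N.+1) (nat_of_bool (j.+1%:R <= y N x)%R)%:R) - y N x).
  rewrite fE /layer mulrBr (eq_bigr (fun j : 'I_N.+1 => (nat_of_bool (j.+1%:R <= y N x)%R)%:R)); first by ring.
  by move=> j _; rewrite indicE; congr (nat_of_bool _)%:R; apply/idP/idP; rewrite inE.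
rewrite normrM; apply: (@le_trans _ _ (2 * K / N.+1%:R * 1)).
  by rewrite ger0_norm ?divr_ge0 ?mulr_ge0 // ler_wpM2l ?divr_ge0 ?mulr_ge0 //; exact: level_count.
rewrite mulr1 -ler_pdivlMl ?mulr_gt0 // ltW //; near: N.
by apply: (near_infty_natSinv_lt (PosNum _)); rewrite mulr_gt0 // invr_gt0 mulr_gt0.
Unshelve. all: end_near. Qed.
End grid_density.
End grids.

(** * Compactness in L^1 from translation bounds *)

Section cell_integrals.
Variables (R : realType) (d : nat).
Local Notation V := 'rV[R]_d.
Local Notation T := (LebT R d).
Local Notation mu := (@Leb R d).
Local Notation J := (@integralR _ T R mu).
Local Notation L1 := (@L1_fun _ T R mu).
Implicit Types (f g w : T -> R) (c l x : V) (G : grid R d).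
Variables (a : V) (L : R).
Hypothesis L0 : 0 < L.
Let Q := cell (const_mx L) a.

(** An L^1 modulus of continuity on the cube along the axes, the directions in which halved cells
    are translates of each other. *)
Definition translation_bound w (M : R) := forall i h, 0 < h ->
  J (fun x => `|w (translate (axis i h) x) - w x| * \1_Q x) <= M * h.

(** For a grid of disjoint cells this is the L^1 norm of the function obtained by averaging w over
    each cell. *)
Definition cell_sum G w := \sum_(c <- G.1) `|J (fun x => w x * \1_(cell G.2 c) x)|.

Lemma L1_cell w l c : L1 w -> L1 (fun x => w x * \1_(cell l c) x).
Proof.
move=> Lw; apply: (@L1M _ _ _ mu w (\1_(cell l c)) 1) => //.
  exact/measurable_indic/measurable_cell.
by move=> x; rewrite indicE; case: (_ \in _); rewrite ?normr1 ?normr0.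
Qed.

Lemma L1_translate w h : L1 w -> L1 (fun x => w (translate h x)).
Proof. exact: integrable_translate. Qed.

Lemma J_translate w h : measurable_fun [set: T] w -> J (fun x => w (translate h x)) = J w.
Proof.
move=> mw; congr fine; apply: (integral_translate h (f := fun x => (w x)%:E)).
exact/measurable_EFinP.
Qed.

Lemma norm_split (u v : R) : `|u| + `|v| <= `|u + v| + `|u - v|.
Proof.
have := ler_norm (u + v); have := ler_norm (u - v).
have := ler_norm (- (u + v)); have := ler_norm (- (u - v)); rewrite !normrN.
by case: (ger0P u) => ?; case: (ger0P v) => ?; lra.
Qed.

(* For a halved cell, |a'| + |a''| <= |a' + a''| + |a' - a''|, where a' and a'' are the
   integrals over the halves; the last term is controlled by the translation bound. *)
Lemma cell_sum_refine G i w M : L1 w -> translation_bound w M -> 0 < G.2 0 i ->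
  (forall x, covering G x <= \1_Q x) ->
  cell_sum (refine G i) w <= cell_sum G w + M * (G.2 0 i / 2).
Proof.
move=> Lw tw Gi Gc; set h := G.2 0 i / 2; have h0 : 0 < h by rewrite divr_gt0.
set l' := G.2 - axis i h.
pose D x : R := w (translate (axis i h) x) - w x.
have LD : L1 D by apply: L1B => //; exact: L1_translate.
have LnD : L1 (fun x => `|D x|) by exact: L1_norm.
have jl c : J (fun x => w x * \1_(cell l' (c + axis i h)) x) =
            J (fun x => w (translate (axis i h) x) * \1_(cell l' c) x).
  rewrite -(J_translate (axis i h)); last by apply: L1_measurable; exact: L1_cell.
  congr J; apply/funext => x; rewrite cell_axis; congr (_ * \1_(cell l' c) _).
  by rewrite /translate addrK.
have key c : `|J (fun x => w x * \1_(cell l' c) x)| +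
     `|J (fun x => w x * \1_(cell l' (c + axis i h)) x)| <=
     `|J (fun x => w x * \1_(cell G.2 c) x)| + J (fun x => `|D x| * \1_(cell l' c) x).
  apply: le_trans (norm_split _ _) _; apply: lerD.
    rewrite -JD ?le_eqVlt; try exact: L1_cell.
    apply/orP; left; apply/eqP; congr `|_|; apply: J_ae.
    - by apply: L1_measurable; apply: L1D; exact: L1_cell.
    - by apply: L1_measurable; exact: L1_cell.
    apply: filterS (ae_hyperplane i (c 0 i + h)) => x xh.
    by rewrite -mulrDr (cell_split _ _ _ _).2.
  rewrite distrC jl -JB; try exact: L1_cell; last exact/L1_cell/L1_translate.
  apply: le_trans (J_norm _) _; first by apply: L1B; [exact/L1_cell/L1_translate|exact: L1_cell].
  rewrite le_eqVlt; apply/orP; left; apply/eqP; congr J; apply/funext => x.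
  by rewrite -mulrBl normrM; congr (_ * _); rewrite indicE ger0_norm.
rewrite /cell_sum /refine /= big_cat /= big_map -big_split /=.
apply: le_trans (ler_sum _ (fun c _ => key c)) _.
rewrite big_split /= lerD2l -J_sum => [|c]; last exact: L1_cell.
apply: le_trans (tw i h h0); apply: J_le.
- by apply: L1_sum => c; exact: L1_cell.
- exact: L1_cell.
move=> x; rewrite -mulr_sumr ler_wpM2l //; apply: le_trans (Gc x).
apply: le_trans (covering_refine G i x); rewrite /covering /refine /= big_cat /=.
by rewrite lerDl sumr_ge0 // => c _; rewrite indicE.
Qed.

Lemma cell_sum_foldl G s w M B : L1 w -> translation_bound w M -> 0 <= M ->
  (forall j, 0 < G.2 0 j <= B) -> (forall x, covering G x <= \1_Q x) ->
  cell_sum (foldl (@refine R d) G s) w <= cell_sum G w + (size s)%:R * (M * B).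
Proof.
move=> Lw tw M0; elim: s G => [|i s IH] G GB Gc /=; first by rewrite mul0r addr0.
have GB' j : 0 < (refine G i).2 0 j <= B.
  have := GB j; rewrite /= !mxE; case: eqVneq => [->|_] /andP[? ?]; apply/andP; split; lra.
have Gc' x : covering (refine G i) x <= \1_Q x by exact: le_trans (covering_refine _ _ _) (Gc x).
apply: le_trans (IH _ GB' Gc') _.
have /andP[Gi GiB] := GB i.
have := cell_sum_refine Lw tw Gi Gc.
have : M * (G.2 0 i / 2) <= M * B by rewrite ler_wpM2l //; lra.
have -> : (size s).+1%:R = (size s)%:R + 1 :> R by rewrite natr1.
rewrite mulrDl mul1r; lra.
Qed.

Lemma cell_sum_stage n w M : L1 w -> translation_bound w M -> 0 <= M ->
  cell_sum (grid_at a L n.+1) w <= cell_sum (grid_at a L n) w + d%:R * (M * (L / 2 ^+ n)).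
Proof.
move=> Lw tw M0; have := @cell_sum_foldl (grid_at a L n) (enum 'I_d) w M (L / 2 ^+ n) Lw tw M0.
rewrite size_enum_ord; apply; last exact: (grid_at_covering a L n).1.
by move=> j; rewrite grid_at_side divr_gt0 ?exprn_gt0 //=.
Qed.

(** The errors L/2^m of the stages m = n, ..., n + k - 1 add up to L (2/2^n - 2/2^(n+k)). In this
    telescoped form the induction closes, and the resulting bound is uniform in k. *)
Lemma cell_sum_tail n k w M : L1 w -> translation_bound w M -> 0 <= M ->
  cell_sum (grid_at a L (n + k)) w <=
  cell_sum (grid_at a L n) w + d%:R * (M * L) * (2 / 2 ^+ n - 2 / 2 ^+ (n + k)).
Proof.
move=> Lw tw M0; elim: k => [|k IH]; first by rewrite addn0 subrr mulr0 addr0.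
rewrite addnS; apply: le_trans (cell_sum_stage _ Lw tw M0) _.
set z := 2 ^+ (n + k); have z0 : 0 < z :> R by rewrite exprn_gt0.
rewrite exprS -/z.
have -> : d%:R * (M * (L / z)) = d%:R * (M * L) * (2 / z - 2 / (2 * z)).
  by field; rewrite gt_eqF.
move: IH; rewrite -/z; set A := d%:R * (M * L); rewrite !mulrBr; lra.
Qed.

(** Duality: the L^1 norm is the integral of w against its sign. Against a step function with values
    in [-1, 1] on a finer grid the integral is at most a cell sum, which [cell_sum_tail] controls;
    [grid_density] extends the bound from such step functions to the sign. *)
Lemma L1_norm_le_cell_sum n w M : L1 w -> translation_bound w M -> 0 <= M ->
  J (fun x => `|w x| * \1_Q x) <= cell_sum (grid_at a L n) w + d%:R * (M * L) * (2 / 2 ^+ n).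
Proof.
move=> Lw tw M0; set C := (X in _ <= X).
have mw := L1_measurable Lw.
have mQ : measurable (Q : set T) by exact: measurable_cell.
pose sg x : R := if 0 < w x then 1 else -1.
have msg : measurable_fun [set: T] sg.
  apply: measurable_fun_if => //; first exact: measurable_fun_ltr.
suff : J (fun x => w x * \1_Q x * sg x) <= C.
  apply: le_trans; rewrite le_eqVlt; apply/orP; left; apply/eqP; congr J.
  apply/funext => x; rewrite mulrAC /sg; congr (_ * _).
  by case: ltP => h; [rewrite mulr1 gtr0_norm|rewrite mulrN1 ler0_norm].
have LwQ : L1 (fun x => w x * \1_Q x) by exact: L1_cell.
apply: (@grid_density R d a L 1 n (fun f => J (fun x => w x * \1_Q x * f x) <= C)) => //.
- move=> m s nm s1; have -> : (fun x => w x * \1_Q x * step (grid_at a L m) s x) =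
    (fun x => \sum_(c <- (grid_at a L m).1) s c * (w x * \1_(cell (grid_at a L m).2 c) x)).
    apply/funext => x; rewrite [RHS](eq_bigr (fun c => w x * (s c * \1_(cell (grid_at a L m).2 c) x))); last first.
      by move=> c _; rewrite mulrCA.
    rewrite -mulr_sumr -mulrA; congr (_ * _).
    have := @step_bound R d a L m s 1 x ler01 s1; rewrite mul1r indicE /step.
    case: (_ \in _); first by rewrite mul1r.
    by rewrite mul0r normr_le0 => /eqP->.
  rewrite J_sum => [|c]; last exact/L1Z/L1_cell.
  apply: (@le_trans _ _ (cell_sum (grid_at a L m) w)).
    apply: ler_sum => c _; rewrite JZ; last exact: L1_cell.
    apply: le_trans (ler_norm _) _; rewrite normrM -[leRHS]mul1r.
    by rewrite ler_wpM2r.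
  rewrite -(subnKC nm); apply: le_trans (cell_sum_tail _ _ Lw tw M0) _.
  rewrite lerD2l ler_wpM2l ?mulr_ge0 ?(ltW L0) // lerBlDr lerDl divr_ge0 ?exprn_ge0 //.
- move=> F f mF mf F1 f1 PF Ff.
  have H := @J_weighted_cvg _ _ _ mu F f _ 1 LwQ mF mf F1 _.
  apply: (limit_le (H _)); last exact: nearW.
  apply: filterS Ff => x Fx; rewrite indicE; case: (pselect (Q x)) => Qx; first by move=> _; exact: Fx.
  by rewrite memNset // mulr0 eqxx.
- by move=> x; rewrite /sg; case: ifP; rewrite ?normrN normr1.
Qed.
End cell_integrals.

Section L1_compactness.
Variables (R : realType) (d : nat).
Local Notation V := 'rV[R]_d.
Local Notation T := (LebT R d).
Local Notation mu := (@Leb R d).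
Local Notation J := (@integralR _ T R mu).
Local Notation L1 := (@L1_fun _ T R mu).
Variables (a : V) (L : R).
Hypothesis L0 : 0 < L.
Let Q := cell (const_mx L) a.

Lemma translation_boundB u v M N : L1 u -> L1 v -> translation_bound a L u M ->
  translation_bound a L v N -> translation_bound a L (fun x => u x - v x) (M + N).
Proof.
move=> Lu Lv tu tv i h h0; rewrite mulrDl; apply: le_trans (lerD (tu i h h0) (tv i h h0)).
have Ld w : L1 w -> L1 (fun x => `|w (translate (axis i h) x) - w x| * \1_Q x).
  by move=> Lw; apply: L1_cell; apply: L1_norm; apply: L1B => //; exact: L1_translate.
rewrite -JD; [|exact: Ld..]; apply: J_le.
- by apply: Ld; exact: L1B.
- by apply: L1D; exact: Ld.
move=> x; rewrite -mulrDl ler_wpM2r //.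
have -> : u (translate (axis i h) x) - v (translate (axis i h) x) - (u x - v x) =
  (u (translate (axis i h) x) - u x) - (v (translate (axis i h) x) - v x) by ring.
exact: ler_normB.
Qed.

Theorem L1_compactness (I : finType) (w : I -> nat -> T -> R) (C M : R) : 0 <= M ->
  (forall i k, L1 (w i k)) -> (forall i k, J (fun x => `|w i k x|) <= C) ->
  (forall i k, translation_bound a L (w i k) M) ->
  (forall i k, {ae mu, forall x, ~ Q x -> w i k x = 0}) ->
  exists2 s, subsequence s & exists v : I -> T -> R, forall i,
    [/\ L1 (v i), (fun k => J (fun x => `|w i (s k) x - v i x|)) @ \oo --> 0 &
        {ae mu, forall x, (fun k => w i (s k) x) @ \oo --> v i x}].
Proof.
move=> M0 Lw wC wM wQ.
(* Cells are addressed by stage n and position m. Positions past the end of the list get the corner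
   0, which is harmless because the integrals are bounded over every cell. *)
pose corner n m : V := nth 0 (grid_at a L n).1 m.
pose A i n m k := J (fun x => w i k x * \1_(cell (grid_at a L n).2 (corner n m)) x).
have AC i n m k : `|A i n m k| <= C.
  apply: le_trans (wC i k); apply: le_trans (J_norm _) _; first exact: L1_cell.
  apply: J_le => [||x]; [exact/L1_norm/L1_cell|exact: L1_norm|].
  by rewrite normrM -[leRHS]mulr1 ler_wpM2l // indicE; case: (_ \in _); rewrite ?normr1 ?normr0.
have [s1 ss1 Hs1] : exists2 s, subsequence s &
    forall i n m, exists l : R, (fun k => A i n m (s k)) @ \oo --> l.
  have [|s ss Hs] := @diagonal R (fun j k => if (unpickle j : option (I * nat * nat)) is Some (i, n, m)
     then A i n m k else 0).
    move=> j; case: (unpickle j) => [[[i n] m]|]; first by exists C => k; exact: AC.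
    by exists 0 => k; rewrite normr0.
  exists s => // i n m; have [l] := Hs (pickle (i, n, m)).
  by under eq_fun do rewrite pickleK; exists l.
pose u i k := w i (s1 k).
have Lu i k : L1 (u i k) by exact: Lw.
(* At a fixed stage the cells are finite in number, so convergence of each integral makes the cell
   sums of differences uniformly small. *)
have cs_cauchy n (e : R) : 0 < e -> exists K, forall i k l, (K <= k)%N -> (K <= l)%N ->
    cell_sum (grid_at a L n) (fun x => u i k x - u i l x) <= e.
  move=> e0; have [al Hal] : {al : I * nat -> R & forall im, (fun k => A im.1 n im.2 (s1 k)) @ \oo --> al im}.
    by apply: (choice (P := fun im l => (fun k => A im.1 n im.2 (s1 k)) @ \oo --> (l : R))) => -[i m]; exact: Hs1.
  pose r i k := \sum_(m < size (grid_at a L n).1) `|A i n m (s1 k) - al (i, nat_of_ord m)|.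
  have r0 i : (fun k => r i k) @ \oo --> 0.
    rewrite (_ : 0 = \sum_(m < size (grid_at a L n).1) (0 : R)); last by rewrite big1.
    apply: cvg_big => [|m _]; first exact: add_continuous.
    rewrite -(normr0 R); apply: cvg_norm; rewrite -(subrr (al (i, nat_of_ord m))).
    by apply: cvgB; [exact: (Hal (i, nat_of_ord m))|exact: cvg_cst].
  have : \forall k \near \oo, forall i, r i k <= e / 2.
    apply: filter_forall => i; have /cvgrPdistC_le/(_ (e / 2)) := r0 i.
    rewrite divr_gt0 // => /(_ isT); apply: filterS => k; rewrite subr0.
    by apply: le_trans; exact: ler_norm.
  move=> [K _ HK]; exists K => i k l Kk Kl.
  apply: (@le_trans _ _ (r i k + r i l)); last by have := HK k Kk i; have := HK l Kl i; lra.
  rewrite /cell_sum (big_nth 0) big_mkord -big_split /=; apply: ler_sum => m _.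
  have -> : J (fun x => (u i k x - u i l x) * \1_(cell (grid_at a L n).2 (corner n m)) x) =
      A i n m (s1 k) - A i n m (s1 l).
    rewrite -JB; [|exact: L1_cell..]; congr J; apply/funext => x; exact: mulrBl.
  have -> : A i n m (s1 k) - A i n m (s1 l) = (A i n m (s1 k) - al (i, nat_of_ord m)) -
      (A i n m (s1 l) - al (i, nat_of_ord m)) by ring.
  exact: ler_normB.
have uQ i k l : J (fun x => `|u i k x - u i l x|) = J (fun x => `|u i k x - u i l x| * \1_Q x).
  have Ln : L1 (fun x => `|u i k x - u i l x|) by apply: L1_norm; exact: L1B.
  apply: J_ae; [exact: L1_measurable Ln|exact: L1_measurable (L1_cell _ _ Ln)|].
  apply: filterS2 (wQ i (s1 k)) (wQ i (s1 l)) => x wk wl.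
  rewrite indicE; case: (pselect (Q x)) => Qx; first by rewrite mem_set // mulr1.
  by rewrite memNset // mulr0 /u wk // wl // subrr normr0.
have u_cauchy (e : R) : 0 < e -> exists K, forall k l i, (K <= k)%N -> (K <= l)%N ->
    J (fun x => `|u i k x - u i l x|) <= e.
  move=> e0; pose B := d%:R * ((M + M) * L).
  have : (fun n => B * (2 / 2 ^+ n)) @ \oo --> 0.
    have := @cvg_geometric R (B * 2) 2^-1; rewrite ger0_norm // invf_lt1 // ltr1n => /(_ isT).
    suff -> : geometric (B * 2) 2^-1 = (fun n => B * (2 / 2 ^+ n)) by [].
    by apply/funext => n /=; rewrite exprVn mulrA.
  move=> /cvgrPdistC_le/(_ (e / 2)); rewrite divr_gt0 // => /(_ isT) [n _ /(_ n (leqnn n))].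
  rewrite /= subr0 => Bn.
  (* The stage n comes from the translation bounds and does not depend on k and l; only then is K
     chosen for the cells of that stage. *)
  have [|K HK] := cs_cauchy n (e / 2); first by rewrite divr_gt0.
  exists K => k l i Kk Kl; rewrite uQ.
  have MM : 0 <= M + M by rewrite addr_ge0.
  have tb := translation_boundB (Lu i k) (Lu i l) (wM i (s1 k)) (wM i (s1 l)).
  have := L1_norm_le_cell_sum L0 n (L1B (Lu i k) (Lu i l)) tb MM.
  move=> /le_trans; apply; rewrite [leRHS]splitr; apply: lerD; first exact: HK.
  exact: le_trans (ler_norm _) Bn.
have [s2 ss2 [v Hv]] := L1_complete Lu u_cauchy.
exists (s1 \o s2); first exact: subsequence_comp.
exists v => i; have [Lv uv vae] := Hv i; split => //.
exact: (cvg_subsequence ss2 uv).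
Qed.
End L1_compactness.

(** * Test functions and translation estimates *)

Section parametric_integrals.
Context d (T : measurableType d) (R : realType) (mu : {measure set T -> \bar R}).

(** Mean value theorem for the integral of g t, after differentiation under the integral sign. The
    majorant D justifies the differentiation only; the constant B bounds the integral of the
    derivative, in which cancellation is kept. *)
Lemma parametric_lipschitz (g dg : R -> T -> R) (D : T -> R) (B : R) :
  (forall t, L1_fun mu (g t)) -> (forall (t : R) x, is_derive t (1 : R) (g ^~ x) (dg t x)) ->
  L1_fun mu D -> (forall t x, `|dg t x| <= D x) -> (forall t, `|integralR mu (dg t)| <= B) ->
  forall s t, s <= t -> `|integralR mu (g t) - integralR mu (g s)| <= B * (t - s).
Proof.
move=> Lg dgP LD gD JB s t st; pose F r := integralR mu (g r).
have D0 x : 0 <= D x by exact: le_trans (gD 0 x).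
have dgE r x : partial1of2 g r x = dg r x.
  by rewrite partial1of2E; have [_ ->] := dgP r x.
have dF (r : R) : is_derive r (1 : R) F (integralR mu (dg r)).
  have inr : `]r - 1, r + 1[%classic r by rewrite /= in_itv /=; apply/andP; split; lra.
  have h1 x : `]r - 1, r + 1[%classic x -> mu.-integrable [set: T] (EFin \o g x) by move=> _; exact: Lg.
  have h2 x y : `]r - 1, r + 1[%classic x -> [set: T] y -> derivable (g ^~ y) x 1.
    by move=> _ _; have [] := dgP x y.
  have h3 x y : `]r - 1, r + 1[%classic x -> [set: T] y -> `|partial1of2 g x y| <= D y.
    by move=> _ _; rewrite dgE.
  apply: DeriveDef; first exact: (derivable_under_integral measurableT inr h1 h2 D0 LD h3).
  rewrite -derive1E (differentiation_under_integral measurableT inr h1 h2 D0 LD h3).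
  by apply: eq_Rintegral => y _; rewrite dgE.
have [|c _ ->] := MVT_segment st (fun r _ => dF r).
  by apply: derivable_within_continuous => r _; have [] := dF r.
by rewrite normrM (ger0_norm (_ : 0 <= t - s)) ?subr_ge0 // ler_wpM2r ?subr_ge0.
Qed.
End parametric_integrals.

Section C1c_theory.
Variables (R : realType) (d : nat).
Local Notation V := 'rV[R]_d.
Local Notation T := (LebT R d).
Local Notation mu := (@Leb R d).
Implicit Types (f g : V -> R) (x : V).

Lemma scaleRE (a b : R) : a *: b = a * b. Proof. by []. Qed.

Lemma axis_evec i t : axis i t = t *: evec R i :> V.
Proof.
apply/rowP => j; rewrite !mxE eqxx /=; case: eqVneq => _; by rewrite ?mulr1 ?mulr0.
Qed.

Lemma C1c_derive f i x : C1c f -> is_derive x (evec R i) f (pderiv i f x).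
Proof. by move=> [_ [df _]]; apply: DeriveDef. Qed.

Lemma is_derive_line f i x t (l : R) : is_derive (x + t *: evec R i) (evec R i) f l ->
  is_derive t (1 : R) (fun s : R => f (x + s *: evec R i)) l.
Proof.
move=> [df dfl].
have E : (fun h : R => h^-1 *: (f (h *: evec R i + (x + t *: evec R i)) - f (x + t *: evec R i))) =
    (fun h : R => h^-1 *: (f (x + (h *: 1 + t) *: evec R i) - f (x + t *: evec R i))).
  apply/funext => h; congr (_ *: (f _ - _)).
  by rewrite [h *: 1]mulr1 scalerDl addrCA.
apply: DeriveDef; first by move: df; rewrite /derivable E.
by rewrite -dfl /derive E.
Qed.

Lemma mx_norm_le x (M : R) : 0 <= M -> (forall i, `|x 0 i| <= M) -> `|x| <= M.
Proof.
move=> M0 xM; rewrite -[`|x|]/(mx_norm x) mx_normrE.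
by apply: bigmax_le => // -[i j] _ /=; rewrite (ord1 i).
Qed.

Lemma coord_le_norm x i : `|x 0 i| <= `|x|.
Proof.
rewrite -[`|x|]/(mx_norm x) mx_normrE.
exact: (le_bigmax _ (fun ij : 'I_1 * 'I_d => `|x ij.1 ij.2|) (0, i)).
Qed.

Lemma bounded_support_compact f (M : R) :
  (forall x, f x != 0 -> forall i, `|x 0 i| <= M) -> compact (closure [set x | f x != 0]).
Proof.
move=> fM; apply: bounded_closed_compact; last exact: closed_closure.
pose B : set V := [set x | `|x| <= Num.max M 0].
have cB : closed B.
  apply: (@preimage_closed _ _ (fun x : V => `|x|) [set r | r <= Num.max M 0]).
    by move=> x _; exact: norm_continuous.
  exact: closed_le.
have sB : closure [set x | f x != 0] `<=` B.
  rewrite ((closure_id B).1 cB); apply: closureS => x /= fx.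
  apply: mx_norm_le; first by rewrite le_max lexx orbT.
  by move=> i; rewrite le_max fM.
exists (Num.max M 0); split; first exact: num_real.
by move=> K MK x /sB /= xM; apply: le_trans xM (ltW MK).
Qed.

Lemma C1c_support f : C1c f -> exists M : R, forall x, f x != 0 -> forall i, `|x 0 i| <= M.
Proof.
move=> [_ [_ [_ /compact_bounded[M [_ HM]]]]].
exists (M + 1) => x fx i; apply: le_trans (coord_le_norm _ _) _.
by apply: HM; [rewrite ltrDl|exact: subset_closure].
Qed.

Lemma C1c_pderiv_support f i (M : R) : 
  (forall x, f x != 0 -> forall j, `|x 0 j| <= M) ->
  forall x, pderiv i f x != 0 -> forall j, `|x 0 j| <= M.
Proof.
move=> fM x fx j; rewrite leNgt; apply/negP => Mx; move/negP: fx; apply; apply/eqP.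
have cn : (fun y : V => `|y 0 j|) @ x --> `|x 0 j|.
  have c0 : (fun y : V => y 0 j) @ x --> x 0 j by exact: coord_continuous.
  exact: cvg_norm c0.
have near0 : {near x, f =1 cst 0}.
  near=> y; apply/eqP/negPn/negP => /fM /(_ j); rewrite leNgt => /negP; apply.
  by near: y; exact: cvgr_gt cn _ Mx.
by rewrite /pderiv (near_eq_derive _ near0) ?derive_cst.
Unshelve. all: end_near. Qed.

Lemma bounded_of_support f (M : R) : continuous f ->
  (forall x, f x != 0 -> forall i, `|x 0 i| <= M) -> exists K : R, forall x, `|f x| <= K.
Proof.
move=> cf fM; have cK := bounded_support_compact fM.
have := continuous_compact (continuous_subspaceT cf) cK => /compact_bounded[K [_ HK]].
exists (Num.max (K + 1) 0) => x; rewrite le_max.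
have [->|fx] := eqVneq (f x) 0; first by rewrite normr0 lexx orbT.
apply/orP; left; apply: HK; first by rewrite ltrDl.
by exists x => //; exact: subset_closure.
Qed.

Lemma C1c_bounded f : C1c f -> exists K : R, forall x, `|f x| <= K.
Proof.
move=> Cf; have [M HM] := C1c_support Cf; apply: bounded_of_support HM; exact: Cf.1.
Qed.

Lemma C1c_pderiv_bounded f i : C1c f -> exists K : R, forall x, `|pderiv i f x| <= K.
Proof.
move=> Cf; have [M HM] := C1c_support Cf.
apply: bounded_of_support (C1c_pderiv_support HM); exact: Cf.2.2.1.
Qed.

Lemma C1c_cst0 : C1c (fun _ : V => 0 : R).
Proof.
split; first by move=> x; exact: cst_continuous.
split; first by move=> i x; exact: derivable_cst.
split; last by apply: (@bounded_support_compact _ 0) => x; rewrite eqxx.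
move=> i; rewrite (_ : pderiv i _ = cst 0); first by move=> x; exact: cst_continuous.
by apply/funext => x; rewrite /pderiv derive_cst.
Qed.

Lemma C1cD f g : C1c f -> C1c g -> C1c (fun x => f x + g x).
Proof.
move=> Cf Cg; have [M HM] := C1c_support Cf; have [N HN] := C1c_support Cg.
move: Cf Cg => [cf [df [cdf _]]] [cg [dg [cdg _]]].
split; first by move=> x; exact: (cvgD (cf x) (cg x)).
split; first by move=> i x; exact: derivableD.
split; last first.
  apply: (@bounded_support_compact _ (Num.max M N)) => x fg i; rewrite le_max.
  have [f0|/HM -> //] := eqVneq (f x) 0.
  by move: fg; rewrite f0 add0r => /HN ->; rewrite orbT.
move=> i; rewrite (_ : pderiv i _ = fun x => pderiv i f x + pderiv i g x).
  by move=> x; exact: (cvgD (cdf i x) (cdg i x)).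
by apply/funext => x; rewrite /pderiv -deriveD.
Qed.

Lemma C1cZ (c : R) f : C1c f -> C1c (fun x => c * f x).
Proof.
move=> Cf; have [M HM] := C1c_support Cf; move: Cf => [cf [df [cdf _]]].
split; first by move=> x; exact: (cvgM (cvg_cst c) (cf x)).
split; first by move=> i x; exact: (@derivableZ _ _ _ f c).
split; last first.
  apply: (@bounded_support_compact _ M) => x; rewrite mulf_eq0 => /norP[_ fx]; exact: HM.
move=> i; rewrite (_ : pderiv i _ = fun x => c * pderiv i f x).
  by move=> x; exact: (cvgM (cvg_cst c) (cdf i x)).
by apply/funext => x; rewrite /pderiv; exact: (@deriveZ _ _ _ f c).
Qed.

Lemma C1c_sum (I : Type) (s : seq I) (F : I -> V -> R) : (forall i, C1c (F i)) ->
  C1c (fun x => \sum_(i <- s) F i x).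
Proof.
move=> CF; elim: s => [|i s IH].
  by under eq_fun do rewrite big_nil; exact: C1c_cst0.
by under eq_fun do rewrite big_cons; exact: C1cD.
Qed.

Lemma pderiv_translate f h i x :
  pderiv i (fun y => f (translate h y)) x = pderiv i f (translate h x).
Proof.
rewrite /pderiv /derive.
suff -> : (fun t : R => t^-1 *: (f (translate h (t *: evec R i + x)) - f (translate h x))) =
  (fun t : R => t^-1 *: (f (t *: evec R i + translate h x) - f (translate h x))) by [].
by apply/funext => t; rewrite /translate addrA.
Qed.

Lemma C1c_translate f h : C1c f -> C1c (fun x => f (translate h x)).
Proof.
move=> Cf; have [M HM] := C1c_support Cf; move: Cf => [cf [df [cdf _]]].
have ct : continuous (translate h : V -> V).
  by move=> x; exact: (cvgD cvg_id (cvg_cst h)).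
split; first by move=> x; apply: (continuous_comp (ct x)); exact: cf.
split.
  move=> i x; have := df i (translate h x); rewrite /derivable.
  suff -> : (fun t : R => t^-1 *: (f (translate h (t *: evec R i + x)) - f (translate h x))) =
    (fun t : R => t^-1 *: (f (t *: evec R i + translate h x) - f (translate h x))) by [].
  by apply/funext => t; rewrite /translate addrA.
split.
  move=> i; rewrite (_ : pderiv i _ = pderiv i f \o translate h).
    by move=> x; apply: (continuous_comp (ct x)); exact: cdf.
  by apply/funext => x; rewrite pderiv_translate.
apply: (@bounded_support_compact _ (M + `|h|)) => x fx i.
have := HM _ fx i; rewrite translateE => H.
rewrite -(addrK (h 0 i) (x 0 i)); apply: le_trans (ler_normB _ _) _.
by apply: lerD => //; exact: coord_le_norm.
Qed.

Lemma C1c_measurable f : C1c f -> measurable_fun [set: T] (f : T -> R).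
Proof. by move=> [cf _]; exact: measurable_continuous. Qed.

Lemma C1c_pderiv_measurable f i : C1c f -> measurable_fun [set: T] (pderiv i f : T -> R).
Proof. by move=> [_ [_ [cf _]]]; exact: measurable_continuous. Qed.

Lemma C1cM f g : C1c f -> C1c g -> C1c (fun x => f x * g x).
Proof.
move=> Cf; have [M HM] := C1c_support Cf.
move: Cf => [cf [df [cdf _]]] [cg [dg [cdg _]]].
split; first by move=> x; exact: (cvgM (cf x) (cg x)).
split; first by move=> i x; exact: derivableM.
split; last first.
  by apply: (@bounded_support_compact _ M) => x; rewrite mulf_eq0 => /norP[fx _]; exact: HM.
move=> i; rewrite (_ : pderiv i _ = fun x => f x * pderiv i g x + g x * pderiv i f x).
  by move=> x; exact: (cvgD (cvgM (cf x) (cdg i x)) (cvgM (cg x) (cdf i x))).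
by apply/funext => x; rewrite /pderiv; exact: deriveM.
Qed.

Lemma is_derive_quadratic (f : R -> R) (t l C : R) :
  (forall h, `|f (t + h) - f t - l * h| <= C * h ^+ 2) -> is_derive t (1 : R) f l.
Proof.
move=> H.
have E : (fun h : R => h^-1 *: (f (h *: (1 : R) + t) - f t)) @ 0^' --> l.
  have C0 : 0 <= C by have := H 1; rewrite expr1n [C * 1]mulr1; apply: le_trans; exact: normr_ge0.
  have C1 : 0 < C + 1 by rewrite ltr_wpDl.
  apply/cvgrPdist_le => e e0; near=> h.
  have h0 : h != 0 by near: h; exact: nbhs_dnbhs_neq.
  have -> : l - h^-1 *: (f (h *: (1 : R) + t) - f t) = - (h^-1 * (f (t + h) - f t - l * h)).
    rewrite !scaleRE mulr1 (addrC h t); move: (f (t + h)) (f t) => p q.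
    by rewrite [in RHS]mulrBr [h^-1 * (l * h)]mulrCA mulVf // mulr1 opprB.
  rewrite normrN normrM normfV ler_pdivrMl ?normr_gt0 //; apply: le_trans (H h) _.
  rewrite -(real_normK (num_real h)) expr2 mulrA mulrC ler_wpM2l //.
  apply: (@le_trans _ _ ((C + 1) * `|h|)); first by rewrite ler_wpM2r // lerDl.
  rewrite mulrC -ler_pdivlMr //; near: h.
  by apply: dnbhs0_le; exact: divr_gt0.
apply: DeriveDef; first by apply/cvg_ex; exists l.
exact: cvg_lim E.
Unshelve. all: end_near. Qed.

(** The squared positive part, a C^1 function supported on a half-line, with derivative 2 max(t,
    0). *)
Definition pos_sqr (t : R) : R := Num.max t 0 ^+ 2.

Lemma pos_sqr_quadratic (t h : R) :
  `|pos_sqr (t + h) - pos_sqr t - 2 * Num.max t 0 * h| <= h ^+ 2.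
Proof.
rewrite /pos_sqr; have h2 := sqr_ge0 h; have th2 := sqr_ge0 (t + h); have t2 := sqr_ge0 t.
case: (leP t 0) => t0; case: (leP (t + h) 0) => th0; rewrite ler_norml; apply/andP; split; nra.
Qed.

(* A C^1 function of one variable that is positive exactly on ]u, v[. *)
Definition edge (u v t : R) : R := pos_sqr (t - u) * pos_sqr (v - t).
Definition edge' (u v t : R) : R :=
  2 * Num.max (t - u) 0 * pos_sqr (v - t) - pos_sqr (t - u) * (2 * Num.max (v - t) 0).

Lemma is_derive_edge u v (t : R) : is_derive t (1 : R) (edge u v) (edge' u v t).
Proof.
have d1 : is_derive t (1 : R) (fun s : R => pos_sqr (s - u)) (2 * Num.max (t - u) 0).
  apply: (@is_derive_quadratic _ _ _ 1) => h; rewrite mul1r /pos_sqr.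
  have -> : t + h - u = (t - u) + h by ring.
  exact: pos_sqr_quadratic.
have d2 : is_derive t (1 : R) (fun s : R => pos_sqr (v - s)) (- (2 * Num.max (v - t) 0)).
  apply: (@is_derive_quadratic _ _ _ 1) => h; rewrite mul1r /pos_sqr.
  have -> : v - (t + h) = (v - t) + (- h) by ring.
  by have := pos_sqr_quadratic (v - t) (- h); rewrite sqrrN mulrN mulNr.
have := is_deriveM d1 d2; rewrite /edge'.
rewrite (_ : (fun s : R => pos_sqr (s - u)) * (fun s : R => pos_sqr (v - s)) = edge u v) //.
suff -> : pos_sqr (t - u) *: - (2 * Num.max (v - t) 0) + pos_sqr (v - t) *: (2 * Num.max (t - u) 0) =
  2 * Num.max (t - u) 0 * pos_sqr (v - t) - pos_sqr (t - u) * (2 * Num.max (v - t) 0) by [].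
by rewrite !scaleRE; ring.
Qed.

Lemma continuous_max0 (f : R -> R) : continuous f -> continuous (fun t => Num.max (f t) 0).
Proof.
move=> cf; rewrite (_ : (fun t => _) = fun t => (f t + `|f t|) / 2).
  by move=> t; apply: cvgM; [exact: (cvgD (cf t) (cvg_norm (cf t)))|exact: cvg_cst].
by apply/funext => t; rewrite maxr_absE addr0 subr0.
Qed.

Lemma continuous_subl (u : R) : continuous (fun t : R => t - u).
Proof. by move=> t; exact: (cvgB cvg_id (cvg_cst u)). Qed.

Lemma continuous_subr (u : R) : continuous (fun t : R => u - t).
Proof. by move=> t; exact: (cvgB (cvg_cst u) cvg_id). Qed.

Lemma continuous_edge u v : continuous (edge u v).
Proof.
move=> t; have h1 := @continuous_max0 _ (@continuous_subl u) t; have h2 := @continuous_max0 _ (@continuous_subr v) t.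
exact: (cvgM (cvgM h1 h1) (cvgM h2 h2)).
Qed.

Lemma continuous_edge' u v : continuous (edge' u v).
Proof.
move=> t; have h1 := @continuous_max0 _ (@continuous_subl u) t; have h2 := @continuous_max0 _ (@continuous_subr v) t.
exact: (cvgB (cvgM (cvgM (cvg_cst (2 : R)) h1) (cvgM h2 h2)) (cvgM (cvgM h1 h1) (cvgM (cvg_cst (2 : R)) h2))).
Qed.

Lemma pos_sqr_gt0 t : (0 < pos_sqr t) = (0 < t).
Proof.
rewrite /pos_sqr expr2; have [t0|t0] := leP t 0; first by rewrite mulr0 ltxx.
by rewrite mulr_gt0.
Qed.

Lemma edge_gt0 u v t : (0 < edge u v t) = (u < t < v).
Proof.
rewrite /edge -(subr_gt0 u) -(subr_gt0 t) -(pos_sqr_gt0 (t - u)) -(pos_sqr_gt0 (v - t)).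
have h1 := sqr_ge0 (Num.max (t - u) 0); have h2 := sqr_ge0 (Num.max (v - t) 0).
apply/idP/andP => [H|[? ?]]; last exact: mulr_gt0.
rewrite !lt_neqAle h1 h2 !andbT ![0 == _]eq_sym; apply/andP; rewrite -negb_or -mulf_eq0.
by rewrite gt_eqF.
Qed.

Lemma edge_ge0 u v t : 0 <= edge u v t.
Proof. by rewrite mulr_ge0 ?sqr_ge0. Qed.

Definition box_bump (a b : V) x : R := \prod_(j < d) edge (a 0 j) (b 0 j) (x 0 j).

Lemma continuous_coord i : continuous (fun x : V => x 0 i).
Proof. by move=> x; exact: coord_continuous. Qed.

Lemma continuous_prod (I : Type) (s : seq I) (P : pred I) (F : I -> V -> R) :
  (forall i, continuous (F i)) -> continuous (fun x => \prod_(i <- s | P i) F i x).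
Proof.
move=> cF; elim: s => [|i s IH] x.
  by under eq_fun do rewrite big_nil; exact: cst_continuous.
under eq_fun do rewrite big_cons; case: ifP => _; last exact: IH.
exact: (cvgM (cF i x) (IH x)).
Qed.

Lemma C1c_box_bump (a b : V) : C1c (box_bump a b).
Proof.
(* In direction i only the i-th factor varies; the product K of the other factors is a constant of
   the difference quotient. *)
have dbump i x : is_derive x (evec R i) (box_bump a b)
    (edge' (a 0 i) (b 0 i) (x 0 i) * \prod_(j < d | j != i) edge (a 0 j) (b 0 j) (x 0 j)).
  set K := \prod_(j < d | j != i) _.
  have [de dle] := is_derive_edge (a 0 i) (b 0 i) (x 0 i).
  have E : (fun h : R => h^-1 *: (box_bump a b (h *: evec R i + x) - box_bump a b x)) =
     (fun h : R => K *: (h^-1 *: (edge (a 0 i) (b 0 i) (h *: (1 : R) + x 0 i) -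
          edge (a 0 i) (b 0 i) (x 0 i)))).
    apply/funext => h; rewrite /box_bump (bigD1 i) //= [in X in _ - X](bigD1 i) //=.
    rewrite (eq_bigr (fun j => edge (a 0 j) (b 0 j) (x 0 j))); last first.
      by move=> j /negbTE ji; rewrite !mxE ji mulr0 add0r.
    rewrite -/K !mxE !eqxx /= mulr1 -mulrBl.
    by rewrite !scaleRE mulr1; ring.
  have H : (fun h : R => K *: (h^-1 *: (edge (a 0 i) (b 0 i) (h *: (1 : R) + x 0 i) -
          edge (a 0 i) (b 0 i) (x 0 i)))) @ 0^' --> K *: edge' (a 0 i) (b 0 i) (x 0 i).
    by apply: cvgZr; rewrite -dle; exact: de.
  apply: DeriveDef; first by apply/cvg_ex; exists (K *: edge' (a 0 i) (b 0 i) (x 0 i)); rewrite E.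
  by rewrite /derive E mulrC; apply/cvg_lim.
have ce j : continuous (fun x : V => edge (a 0 j) (b 0 j) (x 0 j)).
  by move=> x; apply: (continuous_comp (@continuous_coord j x)); exact: continuous_edge.
split; first exact: continuous_prod.
split; first by move=> i x; have [] := dbump i x.
split.
  move=> i; rewrite (_ : pderiv i _ = fun x => edge' (a 0 i) (b 0 i) (x 0 i) *
      \prod_(j < d | j != i) edge (a 0 j) (b 0 j) (x 0 j)).
    have c1 : continuous (fun x : V => edge' (a 0 i) (b 0 i) (x 0 i)).
      by move=> x; apply: (continuous_comp (@continuous_coord i x)); exact: continuous_edge'.
    have c2 : continuous (fun x : V => \prod_(j < d | j != i) edge (a 0 j) (b 0 j) (x 0 j)).
      exact: continuous_prod.
    by move=> x; exact: (cvgM (c1 x) (c2 x)).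
  by apply/funext => x; have [] := dbump i x.
apply: (@bounded_support_compact _ (`|a| + `|b|)) => x bx i.
have : 0 < edge (a 0 i) (b 0 i) (x 0 i).
  rewrite lt_neqAle edge_ge0 andbT eq_sym; apply: contra bx => /eqP ei.
  by rewrite /box_bump (bigD1 i) //= ei mul0r.
rewrite edge_gt0 => /andP[ax xb].
have := coord_le_norm a i; have := coord_le_norm b i.
have := ler_norm (- a 0 i); have := ler_norm (b 0 i); rewrite normrN.
have := normr_ge0 a; have := normr_ge0 b.
move=> *; rewrite ler_norml; apply/andP; split; lra.
Qed.

Lemma box_bump_gt0 a b x : (0 < box_bump a b x) <-> obox a b x.
Proof.
split => [H i|H].
  rewrite -edge_gt0 lt_neqAle edge_ge0 andbT eq_sym; apply: contraTN H => /eqP ei.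
  by rewrite /box_bump (bigD1 i) //= ei mul0r ltxx.
by apply: prodr_gt0 => i _; rewrite edge_gt0; exact: H.
Qed.

(** With s a multiple of the bump having values in [0, 1], F n = 1 - (1 - s)^n tends to 1 where s >
    0 and is 0 elsewhere. The recursion F (n+1) = F n + s - s F n keeps it C^1 with compact
    support. *)
Lemma C1c_indicator_approximation (a b : V) : exists2 F : nat -> V -> R,
  forall n, C1c (F n) & forall x, (forall n, 0 <= F n x <= \1_(obox a b) x) /\
    (fun n => F n x) @ \oo --> (\1_(obox a b) x : R).
Proof.
have Cr := C1c_box_bump a b; have [K HK] := C1c_bounded Cr.
have K0 : 0 < K + 1 by have := HK 0; have := normr_ge0 (box_bump a b 0); lra.
pose s x := (K + 1)^-1 * box_bump a b x.
have s01 x : 0 <= s x <= 1.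
  rewrite mulr_ge0 ?invr_ge0 ?(ltW K0) //=; last by apply: prodr_ge0 => i _; exact: edge_ge0.
  rewrite ler_pdivrMl // mulr1; apply: le_trans (ler_norm _) _; apply: le_trans (HK x) _; lra.
pose F n x := 1 - (1 - s x) ^+ n.
exists F => [n|x].
  elim: n => [|n IH].
    rewrite (_ : F 0%N = fun=> 0); first exact: C1c_cst0.
    by apply/funext => x; rewrite /F expr0 subrr.
  have Cs : C1c s by exact: C1cZ.
  have := C1cD (C1cD IH Cs) (C1cZ (-1) (C1cM Cs IH)); congr (C1c _).
  by apply/funext => x; rewrite /F exprS; ring.
have /andP[s0 s1] := s01 x.
have q01 n : 0 <= (1 - s x) ^+ n <= 1.
  by rewrite exprn_ge0 ?subr_ge0 //= exprn_ile1 ?subr_ge0 // gerBl.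
case: (pselect (obox a b x)) => xab.
  have sp : 0 < s x by rewrite mulr_gt0 ?invr_gt0 //; exact/box_bump_gt0.
  rewrite indicE mem_set //=; split => [n|].
    by have /andP[? ?] := q01 n; rewrite /F; apply/andP; split; lra.
  rewrite -[X in _ --> X]subr0; apply: cvgB; first exact: cvg_cst.
  have := @cvg_geometric R 1 (1 - s x); rewrite /geometric /=.
  under eq_fun do rewrite mul1r; apply.
  by rewrite ger0_norm ?subr_ge0 // gtrBl.
have sz : s x = 0.
  apply/eqP; rewrite mulf_eq0; apply/orP; right; apply/negPn/negP => bn; apply: xab.
  apply/box_bump_gt0; rewrite lt_neqAle eq_sym bn /=.
  by apply: prodr_ge0 => i _; exact: edge_ge0.
rewrite indicE memNset //=; have Fz n : F n x = 0 by rewrite /F sz subr0 expr1n subrr.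
split => [n|]; first by rewrite Fz lexx.
by under eq_fun do rewrite Fz; exact: cvg_cst.
Qed.
End C1c_theory.

Section translation_estimate.
Variables (R : realType) (d : nat).
Local Notation V := 'rV[R]_d.
Local Notation T := (LebT R d).
Local Notation mu := (@Leb R d).
Local Notation J := (@integralR _ T R mu).
Local Notation L1 := (@L1_fun _ T R mu).
Implicit Types (f g w : T -> R).

Lemma L1_indic_cell (l c : V) : L1 (\1_(cell l c)).
Proof. exact: (L1_indic_set (measurable_cell l c) (Leb_obox_lty c (c + l))).1. Qed.

Variables (a : V) (L : R) (u : T -> R) (i : 'I_d) (K B c q : R).
Hypotheses (Lu : L1 u) (K0 : 0 <= K) (c0 : 0 <= c) (q1 : 1 <= q).
(** A common form for both energies: c = 0 for the total variation; c = 1 with q the conjugate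
    exponent for weak gradients, where Young's inequality separates the gradient from the test
    function. *)
Hypothesis weak_bound : forall psi : V -> R, C1c psi -> (forall x, `|psi x| <= K) ->
  `|J (fun x => u x * pderiv i psi x)| <= B + c * J (fun x => `|psi x| `^ q).
Let Q := cell (const_mx L) a.

(* t |-> int u(x) psi(x + t e_i) dx has derivative int u(x) (d_i psi)(x + t e_i) dx,
   and [weak_bound] applies to the translates of [psi]. *)
Lemma translation_C1c (psi : V -> R) h : 0 < h -> C1c psi -> (forall x, `|psi x| <= K) ->
  `|J (fun x => (u (translate (axis i h) x) - u x) * psi x)| <=
  h * (B + c * J (fun x => `|psi x| `^ q)).
Proof.
move=> h0 Cpsi psiK; have mpsi := C1c_measurable Cpsi.
have [K1 HK1] := C1c_pderiv_bounded i Cpsi.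
pose g (t : R) (x : T) : R := u x * psi (translate (axis i t) x).
pose dg (t : R) (x : T) : R := u x * pderiv i psi (translate (axis i t) x).
have Lg t : L1 (g t).
  have mt := C1c_measurable (C1c_translate (axis i t) Cpsi).
  exact: (@L1M _ _ _ mu u (fun x => psi (translate (axis i t) x)) K Lu mt (fun x => psiK _)).
have dgP (t : R) (x : T) : is_derive t (1 : R) (g ^~ x) (dg t x).
  have h1 : is_derive t (1 : R) (fun s : R => psi ((x : V) + s *: evec R i))
      (pderiv i psi ((x : V) + t *: evec R i)) by apply: is_derive_line; exact: C1c_derive.
  have h2 := is_deriveZ (u x) h1.
  move: h2; rewrite /dg /translate axis_evec.
  rewrite (_ : u x \*: (fun s : R => psi ((x : V) + s *: evec R i)) = g ^~ x) //.
  by apply/funext => s; rewrite /g /translate axis_evec.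
have dgB t : `|J (dg t)| <= B + c * J (fun x => `|psi x| `^ q).
  have := weak_bound (C1c_translate (axis i t) Cpsi) (fun x => psiK _).
  rewrite (J_translate (axis i t) (w := fun x => `|psi x| `^ q)).
    by under eq_fun do rewrite pderiv_translate.
  exact: measurable_powR_norm.
have dgD t x : `|dg t x| <= K1 * `|u x| by rewrite normrM mulrC ler_wpM2r.
(* The Lipschitz bound is used between -h and 0: by invariance, the integral of u(x) psi(x - h e_i)
   is that of u(x + h e_i) psi(x), which moves the increment onto u. *)
have h1 : - h <= 0 by rewrite oppr_le0 ltW.
have := parametric_lipschitz Lg dgP (L1Z K1 (L1_norm Lu)) dgD dgB h1.
rewrite sub0r opprK [leRHS]mulrC; apply: le_trans.
rewrite le_eqVlt -normrN; apply/orP; left; apply/eqP; congr `|_|.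
rewrite -(J_translate (axis i h) (w := g (- h))); last exact: L1_measurable.
have LS : L1 (fun x => g (- h) (translate (axis i h) x)) by exact: (L1_translate (axis i h) (Lg (- h))).
apply: oppr_inj; rewrite opprK opprB -JB //; congr J; apply/funext => x; rewrite /g mulrBl.
congr (u _ * psi _ - u _ * psi _).
  by rewrite /translate -addrA; apply/rowP => j; rewrite !mxE; case: eqP; rewrite ?subrr ?addr0 //.
by apply/rowP => j; rewrite !mxE; case: eqP; rewrite ?addr0.
Qed.

(** The inequality is stable under bounded almost everywhere convergence in the cube. It therefore
    passes from C^1 test functions to step functions of grids, whose cells are approximated by
    bumps, and from these to f by [grid_density]. *)
Lemma translation_estimate h f : 0 < h -> measurable_fun [set: T] f -> (forall x, `|f x| <= K) ->
  J (fun x => (u (translate (axis i h) x) - u x) * \1_Q x * f x) <=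
  h * (B + c * J (fun x => \1_Q x * (`|f x| `^ q))).
Proof.
move=> h0; pose w x := u (translate (axis i h) x) - u x.
have Lw : L1 w by apply: L1B => //; exact: L1_translate.
have LwQ : L1 (fun x => w x * \1_Q x) by exact: L1_cell.
have LQ : L1 (\1_Q) by exact: L1_indic_cell.
have Kq0 : 0 <= K `^ q by exact: powR_ge0.
have mpow (g : T -> R) : measurable_fun [set: T] g -> measurable_fun [set: T] (fun x => `|g x| `^ q).
  exact: measurable_powR_norm.
have Kpow (g : T -> R) x : `|g x| <= K -> `| `|g x| `^ q| <= K `^ q.
  by move=> gK; rewrite ger0_norm ?powR_ge0 // ge0_ler_powR ?nnegrE // ?(le_trans _ q1).
pose P f := J (fun x => w x * \1_Q x * f x) <= h * (B + c * J (fun x => \1_Q x * (`|f x| `^ q))).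
have closed_P (F : nat -> T -> R) (f0 : T -> R) : (forall n, measurable_fun [set: T] (F n)) ->
    measurable_fun [set: T] f0 -> (forall n x, `|F n x| <= K) -> (forall n, P (F n)) ->
    {ae mu, forall x, Q x -> (fun n => F n x) @ \oo --> f0 x} -> P f0.
  move=> mF mf FK PF Ff.
  have W (v : T -> R) : (forall x, ~ Q x -> v x = 0) -> {ae mu, forall x, v x != 0 -> (fun n => F n x) @ \oo --> f0 x}.
    move=> wQ; apply: filterS Ff => x Fx wx; apply: Fx; apply: contrapT => /wQ wx0.
    by rewrite wx0 eqxx in wx.
  have Q0 (x : T) : ~ Q x -> \1_Q x = 0 :> R by move=> Qx; rewrite indicE memNset.
  have H1 := @J_weighted_cvg _ _ _ mu F f0 _ K LwQ mF mf FK (W _ _).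
  have {}H1 := H1 (fun x Qx => etrans (congr1 _ (Q0 x Qx)) (mulr0 _)).
  have H2 := @J_weighted_cvg _ _ _ mu (fun n x => `|F n x| `^ q) (fun x => `|f0 x| `^ q) _ (K `^ q) LQ
     (fun n => mpow _ (mF n)) (mpow _ mf) (fun n x => Kpow _ _ (FK n x)).
  have {}H2 := H2 (filterS (fun x H Hx => cvg_powR_norm q1 (H Hx)) (W _ Q0)).
  have {}H2 := H2 (Leb_ae_filter R d).
  have H3 : (fun n => J (fun x => w x * \1_Q x * F n x) -
       h * (B + c * J (fun x => \1_Q x * (`|F n x| `^ q)))) @ \oo --> 
      J (fun x => w x * \1_Q x * f0 x) - h * (B + c * J (fun x => \1_Q x * (`|f0 x| `^ q))).
    exact: (cvgB H1 (cvgM (cvg_cst h) (cvgD (cvg_cst B) (cvgM (cvg_cst c) H2)))).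
  rewrite /P -subr_le0; apply: (limit_le H3); apply: nearW => n.
  by rewrite subr_le0; exact: PF.
move=> mf fK; apply: (@grid_density R d a L K 0 P) => //; last first.
  by move=> F f' mF mf' FK _ PF Ff; exact: (closed_P F f').
move=> n s _ sK; set G := grid_at a L n.
have /choice[F FP] : forall k, exists F : nat -> V -> R, (forall m, C1c (F m)) /\
    forall x, (forall m, 0 <= F m x <= \1_(cell G.2 k) x) /\
    (fun m => F m x) @ \oo --> (\1_(cell G.2 k) x : R).
  by move=> k; have [F0 ? ?] := C1c_indicator_approximation k (k + G.2); exists F0.
pose psi m x := \sum_(k <- G.1) s k * F k m x.
have Cpsi m : C1c (psi m) by apply: C1c_sum => k; apply: C1cZ; exact: (FP k).1.
(* The bumps stay below the indicators of the cells, so [psi] vanishes off the cube and the factor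
   \1_Q can be inserted in both integrals. *)
have psiQ m x : `|psi m x| <= K * \1_Q x.
  apply: le_trans (ler_norm_sum _ _ _) _.
  apply: (@le_trans _ _ (K * covering G x)).
    rewrite mulr_sumr; apply: ler_sum => k _; rewrite normrM ler_pM //.
    by have /andP[F1 F2] := ((FP k).2 x).1 m; rewrite ger0_norm.
  by rewrite ler_wpM2l //; exact: (grid_at_covering a L n).1.
have psiK m x : `|psi m x| <= K.
  apply: le_trans (psiQ m x) _; rewrite -[leRHS]mulr1 ler_wpM2l //.
apply: (closed_P psi) => //.
- by move=> m; exact: C1c_measurable.
- exact: measurable_step.
- move=> m; rewrite /P.
  have psi0 x : \1_Q x = 0 :> R -> psi m x = 0.
    by move=> Qx; apply/eqP; rewrite -normr_le0; have := psiQ m x; rewrite Qx mulr0.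
  have Q01 (x : T) : \1_Q x = 1 :> R \/ \1_Q x = 0 :> R.
    by rewrite indicE; case: (_ \in _); [left|right].
  rewrite (_ : (fun x => w x * \1_Q x * psi m x) = (fun x => w x * psi m x)); last first.
    by apply/funext => x; have [->|Qx] := Q01 x; [rewrite mulr1|rewrite psi0 ?mulr0].
  rewrite (_ : (fun x => \1_Q x * (`|psi m x| `^ q)) = (fun x => `|psi m x| `^ q)); last first.
    apply/funext => x; have [->|Qx] := Q01 x; first by rewrite mul1r.
    by rewrite psi0 // normr0 powR0 ?mulr0 // gt_eqF // (lt_le_trans _ q1).
  apply: le_trans (ler_norm _) _; exact: (translation_C1c h0 (Cpsi m)).
- apply: nearW => x _; apply: cvg_big => [|k _]; first exact: add_continuous.
  by apply: cvgM; [exact: cvg_cst|exact: ((FP k).2 x).2].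
Qed.
End translation_estimate.

(** * Translation bounds for u and |u|^p by truncated test functions *)

Section truncated_ratio.
Context d (T : measurableType d) (R : realType).

Lemma measurable_inv_norm (g : T -> R) : measurable_fun [set: T] g ->
  measurable_fun [set: T] (fun x => `|g x|^-1).
Proof.
by move=> /measurable_powR_norm -/(_ (-1)); under eq_fun do rewrite powR_inv1 //.
Qed.

(* The test function is the ratio D / w truncated at level K: testing an increment
   w of u against it measures the increment D of another function of u. *)
Lemma truncated_ratio (w D F : T -> R) (K : R) : measurable_fun [set: T] w ->
  measurable_fun [set: T] D -> 0 <= K -> (forall x, 0 <= F x) ->
  (forall x, `|D x| <= `|w x| * F x) ->
  exists2 f : T -> R, measurable_fun [set: T] f &
    forall x, [/\ `|f x| <= K, `|f x| <= F x & w x * f x = Num.min `|D x| (K * `|w x|)].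
Proof.
move=> mw mD K0 F0 DF; pose sg x : R := if 0 < w x then 1 else -1.
have msg : measurable_fun [set: T] sg.
  by apply: measurable_fun_if => //; exact: measurable_fun_ltr.
pose r x := Num.min (`|D x| * `|w x|^-1) K.
exists (fun x => sg x * r x).
  apply: measurable_funM => //; apply: measurable_minr; last exact: measurable_cst.
  by apply: measurable_funM; [exact: measurableT_comp|exact: measurable_inv_norm].
move=> x; have sg1 : `|sg x| = 1 by rewrite /sg; case: ifP; rewrite ?normrN normr1.
have q0 : 0 <= `|D x| * `|w x|^-1 by rewrite mulr_ge0 // invr_ge0.
have r0 : 0 <= r x by rewrite le_min q0.
have sw : w x * sg x = `|w x|.
  by rewrite /sg; case: ltP => h; [rewrite mulr1 gtr0_norm|rewrite mulrN1 ler0_norm].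
rewrite normrM sg1 mul1r ger0_norm //; split; first by rewrite ge_min lexx orbT.
  rewrite ge_min; have [w0|w0] := eqVneq (w x) 0; first by rewrite w0 normr0 invr0 mulr0 F0.
  by rewrite ler_pdivrMr ?normr_gt0 // mulrC DF.
rewrite mulrA sw /r; have [w0|w0] := eqVneq (w x) 0.
  by have := DF x; rewrite w0 normr0 !mul0r normr_le0 => /eqP ->; rewrite normr0 mulr0 minxx.
by rewrite minr_pMr // mulrCA divff ?normr_eq0 // mulr1 (mulrC K).
Qed.

Lemma measurable_powR_fun (g : T -> R) (q : R) : measurable_fun [set: T] g ->
  measurable_fun [set: T] (fun x => g x `^ q).
Proof. by move=> mg; exact: (measurableT_comp (measurable_powR q) mg). Qed.

(** At each point min(|D|, n |w|) equals |D| from some n on, since D vanishes where w does; |D| is a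
    majorant. *)
Lemma truncation_cvg (mu : {measure set T -> \bar R}) (D w g : T -> R) : L1_fun mu D -> L1_fun mu w ->
  measurable_fun [set: T] g -> (forall x, 0 <= g x <= 1) -> (forall x, w x = 0 -> D x = 0) ->
  (fun n => integralR mu (fun x => Num.min `|D x| (n%:R * `|w x|) * g x)) @ \oo -->
  integralR mu (fun x => `|D x| * g x).
Proof.
move=> LD Lw mg g01 wD; have mnD := L1_measurable (L1_norm LD).
have mnw := L1_measurable (L1_norm Lw).
apply: (J_dominated (g := fun x => `|D x|) _ _ _ _ _).2.
- move=> n; apply: measurable_funM => //; apply: measurable_minr => //.
  by apply: measurable_funM => //; exact: measurable_cst.
- exact: measurable_funM.
- exact: L1_norm.
- move=> n x; have m0 : 0 <= Num.min `|D x| (n%:R * `|w x|) by rewrite le_min normr_ge0 mulr_ge0.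
  have /andP[g0 g1] := g01 x.
  rewrite ger0_norm ?mulr_ge0 //; apply: (@le_trans _ _ (Num.min `|D x| (n%:R * `|w x|))).
    by rewrite -[leRHS]mulr1 ler_wpM2l.
  by rewrite ge_min lexx.
apply: nearW => x; apply: cvgM; last exact: cvg_cst.
apply: cvg_near_cst; have [w0|w0] := eqVneq (w x) 0.
  by apply: nearW => n; rewrite w0 wD // normr0 mulr0 minxx.
near=> n; rewrite min_l // -ler_pdivrMr ?normr_gt0 //.
by near: n; exact: nbhs_infty_ger.
Unshelve. all: end_near. Qed.
End truncated_ratio.

Section translation_bounds.
Variables (R : realType) (d : nat).
Local Notation V := 'rV[R]_d.
Local Notation T := (LebT R d).
Local Notation mu := (@Leb R d).
Local Notation J := (@integralR _ T R mu).
Local Notation L1 := (@L1_fun _ T R mu).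
Implicit Types (u v F : T -> R).
Variables (a : V) (L : R).
Let Q := cell (const_mx L) a.

(** The increment of u is tested against the truncated quotient of the increments of v and u. As F
    bounds this quotient, the price of the test function is at most the integral of F^q over the
    cube. *)
Lemma truncated_translation u v F (i : 'I_d) (K B c q M h : R) :
  L1 u -> L1 v -> 0 <= K -> 0 <= c -> 1 <= q ->
  (forall psi : V -> R, C1c psi -> (forall x, `|psi x| <= K) ->
    `|J (fun x => u x * pderiv i psi x)| <= B + c * J (fun x => `|psi x| `^ q)) ->
  0 < h -> (forall x, 0 <= F x) ->
  (forall x, `|v (translate (axis i h) x) - v x| <= `|u (translate (axis i h) x) - u x| * F x) ->
  L1 (fun x => \1_Q x * (F x `^ q)) -> J (fun x => \1_Q x * (F x `^ q)) <= M ->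
  J (fun x => Num.min `|v (translate (axis i h) x) - v x| (K * `|u (translate (axis i h) x) - u x|)
    * \1_Q x) <= h * (B + c * M).
Proof.
move=> Lu Lv K0 c0 q1 Hu h0 F0 vF LF FM.
have Lw : L1 (fun x => u (translate (axis i h) x) - u x) by apply: L1B => //; exact: L1_translate.
have LD : L1 (fun x => v (translate (axis i h) x) - v x) by apply: L1B => //; exact: L1_translate.
have [f mf Hf] := truncated_ratio (L1_measurable Lw) (L1_measurable LD) K0 F0 vF.
have fK x : `|f x| <= K by have [] := Hf x.
have := translation_estimate a L Lu K0 q1 Hu h0 mf fK.
rewrite (_ : (fun x => _ * _ * _) = (fun x => Num.min `|v (translate (axis i h) x) - v x|
    (K * `|u (translate (axis i h) x) - u x|) * \1_Q x)); last first.
  by apply/funext => x; have [_ _ <-] := Hf x; rewrite mulrAC.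
move=> /le_trans; apply; rewrite ler_pM2l // lerD2l ler_wpM2l //; apply: le_trans FM.
have fF x : \1_Q x * (`|f x| `^ q) <= \1_Q x * (F x `^ q).
  rewrite ler_wpM2l // ge0_ler_powR ?nnegrE //; first exact: le_trans q1.
  by have [] := Hf x.
apply: J_le => //; apply: (L1_le _ LF).
  apply: measurable_funM; last exact: measurable_powR_norm.
  by apply: measurable_indic; exact: measurable_cell.
by move=> x; rewrite ger0_norm // mulr_ge0 // powR_ge0.
Qed.

(** The case v = u with F = 1 and truncation level 1, at which the minimum is the increment
    itself. *)
Lemma translation_bound_self u (B c q : R) : 0 <= c -> 1 <= q -> L1 u ->
  (forall i (psi : V -> R), C1c psi -> (forall x, `|psi x| <= 1) ->
    `|J (fun x => u x * pderiv i psi x)| <= B + c * J (fun x => `|psi x| `^ q)) ->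
  translation_bound a L u (B + c * J (\1_Q)).
Proof.
move=> c0 q1 Lu HB i h h0.
have := @truncated_translation u u (fun=> 1) i 1 B c q (J (fun x => \1_Q x * (1 `^ q))) h Lu Lu
  ler01 c0 q1.
have -> : (fun x => \1_Q x * (1 `^ q)) = \1_Q :> (V -> R).
  by apply/funext => x; rewrite powR1 mulr1.
rewrite mulrC => H; apply: (le_trans _ (H _ h0 _ _ _ (lexx _))).
- rewrite le_eqVlt; apply/orP; left; apply/eqP; congr J; apply/funext => x.
  by rewrite mul1r minxx.
- by move=> psi Cpsi p1; exact: HB.
- by move=> x.
- by move=> x; rewrite mulr1.
exact: L1_indic_cell.
Qed.

Variables (p q : R).
Hypotheses (p1 : 1 < p) (pq : p^-1 + q^-1 = 1).

Lemma conjugate_gt1 : 1 < q.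
Proof.
have p0 : 0 < p by exact: lt_trans p1.
have qV : 0 < q^-1.
  have : p^-1 < 1 by rewrite invf_lt1.
  by rewrite -pq; set x := p^-1; set y := q^-1; lra.
have q0 : 0 < q by rewrite -invr_gt0.
rewrite -invf_lt1 //; have : 0 < p^-1 by rewrite invr_gt0.
by move: pq; set x := p^-1; set y := q^-1 => <- ?; lra.
Qed.

Lemma conjugate_mul : (p - 1) * q = p.
Proof.
have q0 : q != 0 by rewrite gt_eqF // (lt_trans ltr01) ?conjugate_gt1.
have p0 : p != 0 by rewrite gt_eqF // (lt_trans ltr01).
have : p * q * (p^-1 + q^-1) = p * q by rewrite pq mulr1.
rewrite mulrDr mulrAC divff // mul1r -mulrA divff // mulr1 => E.
by rewrite mulrBl mul1r -E addrAC subrr add0r.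
Qed.

(** If s <= t, the left side is at most (2p t^(p-1))^q, and (p - 1) q = p. *)
Lemma powR_sum_conjugate (s t : R) : 0 <= s -> 0 <= t ->
  (p * (s `^ (p - 1) + t `^ (p - 1))) `^ q <= (2 * p) `^ q * (s `^ p + t `^ p).
Proof.
wlog st : s t / s <= t => [H s0 t0|s0 t0].
  have [|/ltW] := leP s t => st; first exact: H.
  by rewrite [s `^ (p - 1) + _]addrC [s `^ p + _]addrC; exact: H.
have p0 : 0 <= p by exact/ltW/(lt_trans ltr01 p1).
have q0 : 0 <= q by exact/ltW/(lt_trans ltr01 conjugate_gt1).
apply: (@le_trans _ _ ((2 * p * t `^ (p - 1)) `^ q)).
  rewrite ge0_ler_powR ?nnegrE ?mulr_ge0 ?addr_ge0 ?powR_ge0 //.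
  rewrite [2 * p]mulrC -mulrA ler_wpM2l // [2 * _]mulr_natl mulr2n lerD2r.
  by rewrite ge0_ler_powR ?nnegrE // subr_ge0 ltW.
rewrite powRM ?powR_ge0 ?mulr_ge0 // -powRrM conjugate_mul.
by rewrite ler_wpM2l ?powR_ge0 // lerDr powR_ge0.
Qed.

Lemma young_abs (x y : R) : `|x * y| <= `|x| `^ p + `|y| `^ q.
Proof.
have p0 : 0 < p by exact: lt_trans p1.
have q0 : 0 < q := lt_trans ltr01 conjugate_gt1.
rewrite normrM; apply: le_trans (conjugate_powR (normr_ge0 x) (normr_ge0 y) p0 q0 pq) _.
by apply: lerD; rewrite ler_pdivrMr // ler_peMr ?powR_ge0 // ltW // conjugate_gt1.
Qed.

Lemma C1c_Lp (psi : V -> R) (r : R) : 0 < r -> C1c psi -> L1 (fun x => `|psi x| `^ r).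
Proof.
move=> r0 Cpsi; have [K HK] := C1c_bounded Cpsi; have [N HN] := C1c_support Cpsi.
have LK := L1Z (K `^ r) (L1_indic_cell (const_mx (2 * N + 2)) (const_mx (- N - 1) : V)).
apply: (L1_le _ LK); first by apply: measurable_powR_norm; exact: C1c_measurable.
move=> x; rewrite ger0_norm ?powR_ge0 //.
have [px|px] := eqVneq (psi x) 0; first by rewrite px normr0 powR0 ?gt_eqF // mulr_ge0 // powR_ge0.
rewrite indicE mem_set ?mulr1.
  by rewrite ge0_ler_powR ?nnegrE ?(ltW r0) // (le_trans _ (HK x)).
move=> i; rewrite !mxE; have := HN x px i; rewrite ler_norml => /andP[? ?].
by apply/andP; split; lra.
Qed.

Lemma weak_gradient_bound u (g psi : T -> R) (i : 'I_d) : measurable_fun [set: T] g ->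
  L1 (fun x => `|g x| `^ p) -> C1c psi ->
  J (fun x => u x * pderiv i psi x) = - J (fun x => g x * psi x) ->
  `|J (fun x => u x * pderiv i psi x)| <=
    J (fun x => `|g x| `^ p) + 1 * J (fun x => `|psi x| `^ q).
Proof.
move=> mg Lg Cpsi ->; rewrite normrN mul1r.
have Lp := C1c_Lp (lt_trans ltr01 conjugate_gt1) Cpsi.
have Lgp : L1 (fun x => g x * psi x).
  apply: (L1_le _ (L1D Lg Lp)) => [|x]; last exact: young_abs.
  by apply: measurable_funM => //; exact: C1c_measurable.
apply: le_trans (J_norm Lgp) _; rewrite -JD //; apply: J_le => [||x]; last exact: young_abs.
- exact: L1_norm.
- exact: L1D.
Qed.

(** The second bound is an integrated chain rule: the increment of |u|^p is at most that of u times
    F = p (|u(x+h)|^(p-1) + |u(x)|^(p-1)), and F^q is integrable because (p - 1) q = p. Since test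
    functions are bounded, the quotient is truncated at level n and n is sent to infinity. *)
Lemma translation_bound_Lp u (B : R) : L1 u -> L1 (fun x => `|u x| `^ p) ->
  (forall i (psi : V -> R), C1c psi ->
    `|J (fun x => u x * pderiv i psi x)| <= B + 1 * J (fun x => `|psi x| `^ q)) ->
  translation_bound a L u (B + J (\1_Q)) /\
  translation_bound a L (fun x => `|u x| `^ p)
    (B + (2 * p) `^ q * (2 * J (fun x => `|u x| `^ p))).
Proof.
move=> Lu Lup HB; have q1 := conjugate_gt1; split.
  rewrite -[J (\1_Q)]mul1r; apply: (translation_bound_self ler01 (ltW q1) Lu) => i psi Cpsi _.
  exact: HB.
move=> i h h0; pose v x := `|u x| `^ p; pose w x := u (translate (axis i h) x) - u x.
pose Dv x := v (translate (axis i h) x) - v x.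
pose F x := p * (`|u (translate (axis i h) x)| `^ (p - 1) + `|u x| `^ (p - 1)).
have p0 : 0 < p by exact: lt_trans p1.
have F0 x : 0 <= F x by rewrite mulr_ge0 ?(ltW p0) // addr_ge0 ?powR_ge0.
have LD : L1 Dv by apply: L1B => //; exact: (L1_translate (axis i h) Lup).
have Lw : L1 w by apply: L1B => //; exact: L1_translate.
have DF x : `|Dv x| <= `|w x| * F x.
  apply: le_trans (powR_dist p1 (normr_ge0 _) (normr_ge0 _)) _.
  rewrite /F mulrCA mulrA ler_wpM2r ?addr_ge0 ?powR_ge0 // ler_wpM2l ?(ltW p0) //.
  exact: ler_dist_dist.
have Fq x : F x `^ q <= (2 * p) `^ q * (v (translate (axis i h) x) + v x).
  exact: powR_sum_conjugate.
have LFb : L1 (fun x => (2 * p) `^ q * (v (translate (axis i h) x) + v x)).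
  by apply: L1Z; apply: L1D => //; exact: (L1_translate (axis i h) Lup).
have mF : measurable_fun [set: T] F.
  have m1 := measurable_powR_norm (p - 1) (L1_measurable Lu).
  have m2 := measurable_powR_norm (p - 1) (L1_measurable (L1_translate (axis i h) Lu)).
  exact: (measurable_funM (measurable_cst p) (measurable_funD m2 m1)).
have QF x : `|\1_Q x * (F x `^ q)| <= (2 * p) `^ q * (v (translate (axis i h) x) + v x).
  apply: le_trans (Fq x); rewrite ger0_norm; last by rewrite mulr_ge0 // powR_ge0.
  by rewrite -[leRHS]mul1r ler_wpM2r ?powR_ge0 // indicE; case: (_ \in _).
have mQ : measurable_fun [set: T] (\1_Q : T -> R).
  by apply: measurable_indic; exact: measurable_cell.
have LF : L1 (fun x => \1_Q x * (F x `^ q)).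
  exact: (L1_le (measurable_funM mQ (measurable_powR_fun q mF)) LFb QF).
have FM : J (fun x => \1_Q x * (F x `^ q)) <= (2 * p) `^ q * (2 * J v).
  apply: (@le_trans _ _ (J (fun x => (2 * p) `^ q * (v (translate (axis i h) x) + v x)))).
    by apply: J_le => // x; apply: le_trans (ler_norm _) (QF x).
  rewrite JZ; last by apply: L1D => //; exact: (L1_translate (axis i h) Lup).
  rewrite JD //; last exact: (L1_translate (axis i h) Lup).
  have -> : J (fun x => v (translate (axis i h) x)) = J v := J_translate _ (L1_measurable Lup).
  by rewrite [2 * J v]mulr_natl mulr2n.
have H n := @truncated_translation u v F i n%:R B 1 q _ h Lu Lup (ler0n R n) ler01 (ltW q1)
  (fun psi C _ => HB i psi C) h0 F0 DF LF FM.
have wD x : w x = 0 -> Dv x = 0.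
  by move=> w0; have := DF x; rewrite w0 normr0 mul0r normr_le0 => /eqP.
have Q01 (x : T) : 0 <= (\1_Q x : R) <= 1 by rewrite indicE; case: (_ \in _); rewrite /= lexx ler01.
have C := truncation_cvg LD Lw mQ Q01 wD.
rewrite mulrC -[X in _ * (_ + X)]mul1r; apply: (limit_le C); apply: nearW => n; exact: H.
Qed.
End translation_bounds.

(** * Functions of bounded variation *)

Section total_variation_theory.
Variables (R : realType) (d : nat).
Local Notation V := 'rV[R]_d.
Local Notation T := (LebT R d).
Local Notation mu := (@Leb R d).
Local Notation J := (@integralR _ T R mu).
Local Notation L1 := (@L1_fun _ T R mu).
Local Notation TV := (@Defs.total_variation R d).
Implicit Types (u v : T -> R).

Definition component (i : 'I_d) (psi : V -> R) (j : 'I_d) : V -> R :=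
  if j == i then psi else fun=> 0.

Lemma divergence_component i psi : divergence (component i psi) = pderiv i psi.
Proof.
apply/funext => x; rewrite /divergence (bigD1 i) //= big1 ?addr0 => [|j ji].
  by rewrite /component eqxx.
by rewrite /component (negbTE ji) /pderiv derive_cst.
Qed.

Lemma test_field_component i psi : C1c psi -> (forall x, `|psi x| <= 1) ->
  test_field (component i psi).
Proof.
move=> Cpsi psi1; split => [j|x].
  by rewrite /component; case: ifP => // _; exact: C1c_cst0.
rewrite (bigD1 i) //= big1 ?addr0 => [|j ji].
  by rewrite /component eqxx -real_normK ?num_real // exprn_ile1.
by rewrite /component (negbTE ji) expr0n.
Qed.

Lemma divergence_measurable phi : test_field phi ->
  measurable_fun [set: T] (divergence phi : T -> R).
Proof.
move=> [Cphi _]; apply: measurable_sum => j; exact: C1c_pderiv_measurable.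
Qed.

Lemma divergence_bounded phi : test_field phi ->
  exists K : R, forall x : V, `|divergence phi x| <= K.
Proof.
move=> [Cphi _].
have /choice[K HK] : forall j, exists K : R, forall x, `|pderiv j (phi j) x| <= K.
  by move=> j; exact: C1c_pderiv_bounded.
exists (\sum_j K j) => x; apply: le_trans (ler_norm_sum _ _ _) _.
by apply: ler_sum => j _; exact: HK.
Qed.

Lemma L1_divergence u phi : L1 u -> test_field phi -> L1 (fun x => u x * divergence phi x).
Proof.
move=> Lu tphi; have [K HK] := divergence_bounded tphi.
exact: (L1M Lu (divergence_measurable tphi) HK).
Qed.

Lemma total_variation_leP u (e : R) : L1 u -> (TV u <= e%:E)%E <->
  (forall phi, test_field phi -> J (fun x => u x * divergence phi x) <= e).
Proof.
move=> Lu; split => [ue phi tphi|H].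
  rewrite -lee_fin -J_EFin; last exact: L1_divergence.
  by apply: le_trans ue; apply: ereal_sup_ubound; exists phi.
apply: ge_ereal_sup => _ [phi tphi <-].
have := J_EFin (L1_divergence Lu tphi) => ->.
by rewrite lee_fin; exact: H.
Qed.

Lemma total_variation_ge0 u : (0 <= TV u)%E.
Proof.
apply: ereal_sup_ubound; exists (fun=> fun=> 0) => [|].
  split => [j|x]; first exact: C1c_cst0.
  by rewrite big1 // => j _; rewrite expr0n.
rewrite (_ : (fun x => _) = cst 0%E) ?integral0 //; apply/funext => x; congr EFin.
rewrite /divergence big1 ?mulr0 // => j _; by rewrite /pderiv derive_cst.
Qed.

Lemma total_variation_translation_bound a L u (e : R) : L1 u -> (TV u <= e%:E)%E ->
  translation_bound a L u e.
Proof.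
move=> Lu /(total_variation_leP e Lu) ue; have := @translation_bound_self R d a L u e 0 1 (lexx 0) (lexx 1) Lu.
rewrite mul0r addr0; apply => i psi Cpsi psi1; rewrite mul0r addr0.
(* The one-sided bound gives the bound on the absolute value because the class of test functions
   contains -psi with psi. *)
have key (f : V -> R) : C1c f -> (forall x, `|f x| <= 1) -> J (fun x => u x * pderiv i f x) <= e.
  by move=> Cf f1; have := ue _ (test_field_component i Cf f1); rewrite divergence_component.
have Lp : L1 (fun x => u x * pderiv i psi x).
  have := L1_divergence Lu (test_field_component i Cpsi psi1).
  by rewrite divergence_component.
rewrite ler_norml key // andbT lerNl -JN //.
have := key _ (C1cZ (-1) Cpsi) (fun x => _); rewrite (_ : pderiv i _ = fun x => - pderiv i psi x).
  under eq_fun do rewrite mulrN; apply => x; by rewrite mulN1r normrN.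
apply/funext => x; rewrite /pderiv; have := @deriveZ _ _ _ psi (-1) x (evec R i) (Cpsi.2.1 i x).
by rewrite scaleN1r.
Qed.

Lemma total_variation_lsc (u : nat -> T -> R) v (e : nat -> R) (l : R) :
  (forall k, L1 (u k)) -> L1 v -> (fun k => J (fun x => `|u k x - v x|)) @ \oo --> 0 ->
  (forall k, (TV (u k) <= (e k)%:E)%E) -> e @ \oo --> l ->
  (TV v <= l%:E)%E.
Proof.
move=> Lu Lv uv ue el; apply/(total_variation_leP l Lv) => phi tphi.
have [K HK] := divergence_bounded tphi.
have H k : J (fun x => v x * divergence phi x) <= e k + K * J (fun x => `|u k x - v x|).
  have Ld : L1 (fun x => `|u k x - v x|) by apply: L1_norm; exact: L1B.
  have L2 := L1_divergence (Lu k) tphi; have L3 := L1Z K Ld.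
  apply: (@le_trans _ _ (J (fun x => u k x * divergence phi x + K * `|u k x - v x|))).
    apply: J_le; [exact: L1_divergence|exact: L1D|move=> x].
    rewrite -lerBlDl -mulrBl; apply: le_trans (ler_norm _) _.
    by rewrite normrM distrC mulrC ler_wpM2r.
  rewrite JD // JZ // lerD2r.
  by have /(total_variation_leP (e k) (Lu k)) := ue k; apply.
have C : (fun k => J (fun x => v x * divergence phi x) - (e k + K * J (fun x => `|u k x - v x|)))
    @ \oo --> J (fun x => v x * divergence phi x) - (l + K * 0).
  exact: (cvgB (cvg_cst _) (cvgD el (cvgM (cvg_cst K) uv))).
rewrite mulr0 addr0 in C; rewrite -subr_le0; apply: (limit_le C); apply: nearW => k.
by rewrite subr_le0.
Qed.
End total_variation_theory.

(** * Lower semicontinuity of gradient energies *)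

Section euclidean_norm.
Variables (R : realType) (I : finType).
Implicit Types a b : I -> R.

Definition euclid a : R := Num.sqrt (\sum_i a i ^+ 2).

Lemma euclid_ge0 a : 0 <= euclid a.
Proof. exact: sqrtr_ge0. Qed.

Lemma euclid_sqr a : euclid a ^+ 2 = \sum_i a i ^+ 2.
Proof. by rewrite sqr_sqrtr // sumr_ge0 // => i _; exact: sqr_ge0. Qed.

Lemma coord_le_euclid a i : `|a i| <= euclid a.
Proof.
rewrite -sqrtr_sqr ler_sqrt; last by apply: sumr_ge0 => j _; exact: sqr_ge0.
by rewrite (bigD1 i) //= lerDl sumr_ge0 // => j _; exact: sqr_ge0.
Qed.

Lemma euclid_le_sum a : euclid a <= \sum_i `|a i|.
Proof.
have S0 : 0 <= \sum_i `|a i| by exact: sumr_ge0.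
rewrite -[leRHS]ger0_norm // -sqrtr_sqr ler_sqrt ?sqr_ge0 //.
elim: (index_enum I) => [|i s IH]; first by rewrite !big_nil expr0n.
rewrite !big_cons -(real_normK (num_real (a i))).
have s0 : 0 <= \sum_(j <- s) `|a j| by exact: sumr_ge0.
have i0 := normr_ge0 (a i); move: IH s0 i0; set y := \sum_(j <- s) `|a j|; set x := `|a i|.
by move=> IH y0 x0; have := mulr_ge0 x0 y0; rewrite sqrrD; lra.
Qed.

(** Expand the squares of a_i |b| - b_i |a|, sum over i and divide by 2 |a| |b|, the case of a zero
    factor being trivial. *)
Lemma cauchy_schwarz a b : \sum_i a i * b i <= euclid a * euclid b.
Proof.
have [A0|A0] := eqVneq (euclid a) 0.
  rewrite A0 mul0r big1 // => i _.
  by have := coord_le_euclid a i; rewrite A0 normr_le0 => /eqP ->; rewrite mul0r.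
have [B0|B0] := eqVneq (euclid b) 0.
  rewrite B0 mulr0 big1 // => i _.
  by have := coord_le_euclid b i; rewrite B0 normr_le0 => /eqP ->; rewrite mulr0.
have AB : 0 < euclid a * euclid b by rewrite mulr_gt0 // lt_neqAle eq_sym ?A0 ?B0 euclid_ge0.
have AB2 : 0 < 2 * (euclid a * euclid b) by rewrite mulr_gt0.
rewrite -(ler_pM2l AB2).
have -> : 2 * (euclid a * euclid b) * (euclid a * euclid b) =
    \sum_i (a i ^+ 2 * euclid b ^+ 2 + b i ^+ 2 * euclid a ^+ 2).
  by rewrite big_split /= -!mulr_suml -!euclid_sqr; ring.
rewrite mulr_sumr; apply: ler_sum => i _.
have := sqr_ge0 (a i * euclid b - b i * euclid a).
move: (a i) (b i) (euclid a) (euclid b) => s t u v.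
have -> : (s * v - t * u) ^+ 2 = s ^+ 2 * v ^+ 2 + t ^+ 2 * u ^+ 2 - 2 * (u * v) * (s * t) by ring.
by rewrite subr_ge0.
Qed.

Lemma euclid_parallelogram a b :
  euclid (fun i => (a i + b i) / 2) ^+ 2 + euclid (fun i => (a i - b i) / 2) ^+ 2 =
  (euclid a ^+ 2 + euclid b ^+ 2) / 2.
Proof.
rewrite !euclid_sqr -!big_split /= mulr_suml; by apply: eq_bigr => i _; field.
Qed.

Lemma euclid_midpoint a b : euclid (fun i => (a i + b i) / 2) <= (euclid a + euclid b) / 2.
Proof.
have r0 : 0 <= (euclid a + euclid b) / 2 by rewrite divr_ge0 ?addr_ge0 ?euclid_ge0.
rewrite -(ler_pXn2r (_ : 0 < 2)%N) ?nnegrE ?euclid_ge0 //.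
rewrite euclid_sqr.
have -> : ((euclid a + euclid b) / 2) ^+ 2 =
    (euclid a ^+ 2 + euclid b ^+ 2 + 2 * (euclid a * euclid b)) / 4 by field.
have -> : \sum_i ((a i + b i) / 2) ^+ 2 =
    (\sum_i a i ^+ 2 + \sum_i b i ^+ 2 + 2 * \sum_i a i * b i) / 4.
  by rewrite mulr_sumr -!big_split /= mulr_suml; apply: eq_bigr => i _; field.
rewrite -!euclid_sqr ler_pM2r ?invr_gt0 // lerD2l ler_pM2l //; exact: cauchy_schwarz.
Qed.

Lemma cvg_euclid (a : nat -> I -> R) b : (forall i, (fun n => a n i) @ \oo --> b i) ->
  (fun n => euclid (a n)) @ \oo --> euclid b.
Proof.
move=> ab; have H : (fun n => \sum_i a n i ^+ 2) @ \oo --> \sum_i b i ^+ 2.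
  apply: cvg_big => [|i _]; first exact: add_continuous.
  exact: (cvgM (ab i) (ab i)).
exact: (continuous_cvg _ (@sqrt_continuous R _) H).
Qed.
End euclidean_norm.

(** The linear arithmetic of near-minimisers: m0 is the infimum at one stage, m1 the limit of the
    infima, r the slack, c the energy of a midpoint. *)
Lemma gap_arithmetic (R : realFieldType) (a b c m0 m1 r l : R) : a <= m1 + r -> b <= m1 + r ->
  m1 <= l -> r <= 1 -> m0 <= c -> a + b <= 2 * (l + 1) /\ (a + b) / 2 - c <= m1 + r - m0.
Proof. by move=> *; split; lra. Qed.

Section Lp_fields.
Context d (T : measurableType d) (R : realType) (mu : {measure set T -> \bar R}).
Local Notation J := (integralR mu).
Local Notation L1 := (L1_fun mu).
Variables (I : finType) (p : R).
Hypothesis p1 : 1 < p.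
Implicit Types g h : I -> T -> R.

Let p0 : 0 < p. Proof. exact: lt_trans p1. Qed.

Definition Lp_fun (f : T -> R) := measurable_fun [set: T] f /\ L1 (fun x => `|f x| `^ p).
Definition Lp_field g := forall i, Lp_fun (g i).
Definition field_energy g := J (fun x => euclid (g ^~ x) `^ p).

Lemma J_fatou (F : nat -> T -> R) (f : T -> R) (c : R) : (forall n, L1 (F n)) ->
  measurable_fun [set: T] f -> (forall n x, 0 <= F n x) -> (forall x, 0 <= f x) ->
  {ae mu, forall x, (fun n => F n x) @ \oo --> f x} ->
  (\forall n \near \oo, J (F n) <= c) -> L1 f /\ J f <= c.
Proof.
move=> LF mf F0 f0 Ff Fc.
have fc : (\int[mu]_x (f x)%:E <= c%:E)%E.
  apply: (fatou_ae (fun n => L1_measurable (LF n)) mf F0 f0 Ff).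
  by apply: filterS Fc => n; rewrite J_EFin.
have Lf : L1 f.
  apply/integrableP; split; first exact/measurable_EFinP.
  under eq_integral do rewrite gee0_abs ?lee_fin //.
  exact: le_lt_trans fc (ltry c).
by split => //; rewrite -lee_fin -J_EFin.
Qed.

Lemma powR_add_le (s t : R) : 0 <= s -> 0 <= t -> (s + t) `^ p <= 2 `^ p * (s `^ p + t `^ p).
Proof.
wlog st : s t / s <= t => [H s0 t0|s0 t0].
  have [|/ltW] := leP s t => st; first exact: H.
  by rewrite [s + t]addrC [s `^ p + _]addrC; exact: H.
apply: (@le_trans _ _ ((2 * t) `^ p)).
  by rewrite ge0_ler_powR ?nnegrE ?(ltW p0) ?addr_ge0 ?mulr_ge0 //; lra.
by rewrite powRM // ler_wpM2l ?powR_ge0 // lerDr powR_ge0.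
Qed.

Lemma Lp_funD (f g : T -> R) : Lp_fun f -> Lp_fun g -> Lp_fun (fun x => f x + g x).
Proof.
move=> [mf Lf] [mg Lg]; split; first exact: measurable_funD.
apply: (L1_le _ (L1Z (2 `^ p) (L1D Lf Lg))).
  by apply: measurable_powR_norm; exact: measurable_funD.
move=> x; rewrite ger0_norm ?powR_ge0 //; apply: le_trans (powR_add_le _ _) => //.
by rewrite ge0_ler_powR ?nnegrE ?(ltW p0) ?addr_ge0 // ler_normD.
Qed.

Lemma Lp_funZ (c : R) (f : T -> R) : Lp_fun f -> Lp_fun (fun x => c * f x).
Proof.
move=> [mf Lf]; split; first by apply: measurable_funM => //; exact: measurable_cst.
have := L1Z (`|c| `^ p) Lf; congr L1; apply/funext => x; by rewrite normrM powRM.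
Qed.

Lemma Lp_fun_norm (f : T -> R) : Lp_fun f -> Lp_fun (fun x => `|f x|).
Proof.
move=> [mf Lf]; split; first exact: measurableT_comp.
by have := Lf; congr L1; apply/funext => x; rewrite normr_id.
Qed.

Lemma Lp_fun0 : Lp_fun (fun=> 0).
Proof.
split; first exact: measurable_cst.
have := L1_0 mu; congr L1; apply/funext => x; by rewrite normr0 powR0 // gt_eqF.
Qed.

Lemma Lp_fun_sum (s : seq I) (F : I -> T -> R) : (forall i, Lp_fun (F i)) ->
  Lp_fun (fun x => \sum_(i <- s) F i x).
Proof.
move=> LF; elim: s => [|i s IH].
  by under eq_fun do rewrite big_nil; exact: Lp_fun0.
by under eq_fun do rewrite big_cons; exact: Lp_funD.
Qed.

Lemma measurable_euclid g : (forall i, measurable_fun [set: T] (g i)) ->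
  measurable_fun [set: T] (fun x => euclid (g ^~ x)).
Proof.
move=> mg; rewrite (_ : (fun x => _) = fun x => (\sum_i g i x ^+ 2) `^ 2^-1).
  apply: measurable_powR_fun; apply: measurable_sum => i.
  exact: (measurable_funM (mg i) (mg i)).
by apply/funext => x; rewrite /euclid powR12_sqrt // sumr_ge0 // => i _; exact: sqr_ge0.
Qed.

Lemma L1_euclid g : Lp_field g -> L1 (fun x => euclid (g ^~ x) `^ p).
Proof.
move=> Lg; have [_] := Lp_fun_sum (index_enum I) (fun i => Lp_fun_norm (Lg i)).
move=> LS; apply: (L1_le _ LS).
  by apply: measurable_powR_fun; apply: measurable_euclid => i; exact: (Lg i).1.
move=> x; rewrite ger0_norm ?powR_ge0 // ge0_ler_powR ?nnegrE ?euclid_ge0 ?(ltW p0) //.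
by apply: le_trans (euclid_le_sum _) _; exact: ler_norm.
Qed.

Definition midpoint g h i x := (g i x + h i x) / 2.

Lemma Lp_midpoint g h : Lp_field g -> Lp_field h -> Lp_field (midpoint g h).
Proof.
move=> Lg Lh i; have := Lp_funZ 2^-1 (Lp_funD (Lg i) (Lh i)).
by congr Lp_fun; apply/funext => x; rewrite mulrC.
Qed.

(** The pointwise inequality integrated, with C independent of the fields. The factor 2^p turns half
    the difference into the difference. *)
Lemma energy_convexity eta : 0 < eta -> exists2 C : R, 0 <= C & forall g h i,
  Lp_field g -> Lp_field h ->
  J (fun x => `|g i x - h i x| `^ p) <= 2 `^ p * (eta * (field_energy g + field_energy h) +
    C * ((field_energy g + field_energy h) / 2 - field_energy (midpoint g h))).
Proof.
move=> eta0; have [C C0 HC] := uniform_convexity p1 eta0; exists C => // g h i Lg Lh.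
have Lm := L1_euclid (Lp_midpoint Lg Lh); have Lg' := L1_euclid Lg; have Lh' := L1_euclid Lh.
have [_ Ld] : Lp_fun (fun x => g i x - h i x).
  have := Lp_funD (Lg i) (Lp_funZ (-1) (Lh i)).
  by congr Lp_fun; apply/funext => x; rewrite mulN1r.
have LS := L1D Lg' Lh'.
have LR : L1 (fun x => 2 `^ p * (eta * (euclid (g ^~ x) `^ p + euclid (h ^~ x) `^ p) +
    C * (2^-1 * (euclid (g ^~ x) `^ p + euclid (h ^~ x) `^ p) - euclid (midpoint g h ^~ x) `^ p))).
  by apply: L1Z; apply: L1D; apply: L1Z => //; apply: L1B => //; exact: L1Z.
apply: (le_trans (J_le Ld LR _)) => [x|].
  have : `|g i x - h i x| `^ p <= 2 `^ p * euclid (fun j => (g j x - h j x) / 2) `^ p.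
    rewrite -powRM ?euclid_ge0 // ge0_ler_powR ?nnegrE ?(ltW p0) ?mulr_ge0 ?euclid_ge0 //.
    have := coord_le_euclid (fun j => (g j x - h j x) / 2) i.
    by rewrite normrM (gtr0_norm (_ : 0 < 2^-1)) ?invr_gt0 // ler_pdivrMr // mulrC.
  move=> /le_trans; apply; rewrite ler_wpM2l ?powR_ge0 // [2^-1 * _]mulrC.
  by apply: HC; rewrite ?euclid_ge0 //; [exact: euclid_parallelogram|exact: euclid_midpoint].
pose S x := euclid (g ^~ x) `^ p + euclid (h ^~ x) `^ p.
pose E x := euclid (midpoint g h ^~ x) `^ p.
have LS2 : L1 (fun x => 2^-1 * S x) by exact: L1Z.
have LD : L1 (fun x => 2^-1 * S x - E x) by exact: L1B.
rewrite le_eqVlt; apply/orP; left; apply/eqP.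
rewrite (JZ (2 `^ p) (L1D (L1Z eta LS) (L1Z C LD))) (JD (L1Z eta LS) (L1Z C LD)).
rewrite (JZ eta LS) (JZ C LD) (JB LS2 Lm) (JZ 2^-1 LS) (JD Lg' Lh') [2^-1 * _]mulrC //.
Qed.

Variables (A : nat -> (I -> T -> R) -> Prop) (l : R).
Hypothesis A_field : forall n g, A n g -> Lp_field g.
Hypothesis A_mono : forall n m g, (n <= m)%N -> A m g -> A n g.
Hypothesis A_midpoint : forall n g h, A n g -> A n h -> A n (midpoint g h).
Hypothesis A_energy : forall n (e : R), 0 < e -> exists2 g, A n g & field_energy g <= l + e.

Lemma field_energy_ge0 g : 0 <= field_energy g.
Proof. by apply: J_ge0 => x; exact: powR_ge0. Qed.

(* Midpoint convexity of the nested classes [A n] makes near-minimisers Cauchy: the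
   midpoint of two of them cannot have much less energy than they have. *)
Theorem energy_minimization : exists h : nat -> I -> T -> R, (forall n, A n (h n)) /\
  exists g, [/\ Lp_field g, field_energy g <= l &
    forall i, (fun n => J (fun x => `|h n i x - g i x| `^ p)) @ \oo --> 0].
Proof.
pose E n := [set field_energy g | g in A n].
(* The infima increase as the classes shrink and stay below l, so they converge to [ms]: the
   midpoint of two near-minimisers beyond stage M saves at most ms + 1/(M+1) - m M. *)
pose m n := inf (E n).
have hE n : has_inf (E n).
  split; first by have [g Ag _] := A_energy n ltr01; exists (field_energy g), g.
  by exists 0 => _ [g _ <-]; exact: field_energy_ge0.
have mE n g : A n g -> m n <= field_energy g.
  by move=> Ag; apply: ge_inf; [exact: (hE n).2|exists g].
have ml n : m n <= l.
  apply/ler_addgt0Pr => e e0; have [g Ag gl] := A_energy n e0.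
  exact: le_trans (mE n g Ag) gl.
have l0 : 0 <= l.
  apply: le_trans (ml 0%N); apply: lb_le_inf; first exact: (hE 0%N).1.
  by move=> _ [g _ <-]; exact: field_energy_ge0.
have m_mono : nondecreasing_seq m.
  move=> n k nk; apply: lb_le_inf; first exact: (hE k).1.
  by move=> _ [g Ag <-]; apply: mE; exact: A_mono Ag.
have m_cvg : cvgn m.
  by apply: nondecreasing_is_cvgn => //; exists l => _ [n _ <-].
pose ms := limn m.
have m_ms n : m n <= ms by exact: nondecreasing_cvgn_le.
have msl : ms <= l by apply: limr_le => //; exact: nearW.
have /choice[h Hh] : forall n, exists g, A n g /\ field_energy g <= m n + n.+1%:R^-1.
  move=> n; have n0 : 0 < n.+1%:R^-1 :> R by rewrite invr_gt0.
  by have [_ [g Ag <-] /ltW gm] := inf_adherent n0 (hE n); exists g.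
exists h; split => [n|]; first exact: (Hh n).1.
have Lh n : Lp_field (h n) by exact: A_field (Hh n).1.
have inv_cvg : (fun n => n.+1%:R^-1 : R) @ \oo --> 0 by exact: cvg_harmonic.
have hs M n : (M <= n)%N -> field_energy (h n) <= ms + M.+1%:R^-1.
  move=> Mn; apply: le_trans (Hh n).2 _; apply: lerD => //.
  by rewrite lef_pV2 ?posrE // ler_nat ltnS.
have h_cauchy (e : R) : 0 < e -> exists M, forall n k i, (M <= n)%N -> (M <= k)%N ->
    J (fun x => `|h n i x - h k i x| `^ p) <= e.
  (* Beyond stage M both energies are at most l + 1, so the eta term contributes at most 2^p eta 2
     (l + 1) = e/2. *)
  move=> e0; pose eta := e / (2 `^ p * (4 * (l + 1))).
  have tp : 0 < 2 `^ p :> R by rewrite powR_gt0.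
  have l1 : 0 < l + 1 by rewrite ltr_wpDl.
  have eta0 : 0 < eta by rewrite divr_gt0 // !mulr_gt0.
  have [C C0 HC] := energy_convexity eta0.
  have gap0 : (fun M => 2 `^ p * (C * (ms + M.+1%:R^-1 - m M))) @ \oo --> 2 `^ p * (C * (ms + 0 - ms)).
    exact: (cvgM (cvg_cst _) (cvgM (cvg_cst _) (cvgB (cvgD (cvg_cst _) inv_cvg) m_cvg))).
  rewrite addr0 subrr !mulr0 in gap0.
  have /cvgrPdistC_le/(_ (e / 2)) := gap0; rewrite divr_gt0 // => /(_ isT) [M _ HM].
  exists M => n k i Mn Mk; apply: le_trans (HC _ _ i (Lh n) (Lh k)) _.
  have := HM M (leqnn M); rewrite /= subr0 => /(le_trans (ler_norm _)) gapM.
  have en := hs M n Mn; have ek := hs M k Mk.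
  have mid := mE M _ (A_midpoint (A_mono Mn (Hh n).1) (A_mono Mk (Hh k).1)).
  have M1 : M.+1%:R^-1 <= 1 :> R by rewrite invf_le1 // ler1n.
  have [b1 b2] := gap_arithmetic en ek msl M1 mid.
  apply: (@le_trans _ _ (2 `^ p * (eta * (2 * (l + 1)) + C * (ms + M.+1%:R^-1 - m M)))).
    by rewrite (ler_pM2l tp); apply: lerD; [rewrite ler_pM2l|rewrite ler_wpM2l].
  rewrite mulrDr [leRHS]splitr; apply: lerD gapM; rewrite le_eqVlt; apply/orP; left; apply/eqP.
  by rewrite /eta; field; rewrite !gt_eqF.
have mh i n : measurable_fun [set: T] (h n i) by exact: (Lh n i).1.
have Lhd n k i : Lp_fun (fun x => h n i x - h k i x).
  have := Lp_funD (Lh n i) (Lp_funZ (-1) (Lh k i)).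
  by congr Lp_fun; apply/funext => x; rewrite mulN1r.
have [|s ss [g [mg gae]]] := @Lp_Cauchy_subsequence _ _ _ mu I p (fun i n => h n i) (ltW p1) mh.
  move=> e e0; have [M HM] := h_cauchy e e0; exists M => n k i Mn Mk.
  by have [_ Ld] := Lhd n k i; rewrite (J_EFin Ld) lee_fin; exact: HM.
have hg (e : R) : 0 < e -> exists M, forall n i, (M <= n)%N ->
    L1 (fun x => `|h n i x - g i x| `^ p) /\ J (fun x => `|h n i x - g i x| `^ p) <= e.
  move=> e0; have [M HM] := h_cauchy e e0; exists M => n i Mn.
  apply: (@J_fatou (fun k x => `|h n i x - h (s k) i x| `^ p)).
  - by move=> k; have [_] := Lhd n (s k) i.
  - exact/measurable_powR_norm/measurable_funB.
  - by move=> k x; exact: powR_ge0.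
  - by move=> x; exact: powR_ge0.
  - apply: filterS (gae i) => x hx; apply: cvg_powR_norm; first exact: ltW.
    exact: (cvgB (cvg_cst _) hx).
  exists M => // k /= Mk; apply: HM => //; exact: leq_trans Mk (subsequence_le _ ss).
have Lg : Lp_field g.
  move=> i; have [M HM] := hg 1 ltr01; have [Ld _] := HM M i (leqnn M).
  have Lf : Lp_fun (fun x => h M i x - g i x) by split => //; exact: measurable_funB.
  have := Lp_funD (Lh M i) (Lp_funZ (-1) Lf).
  by congr Lp_fun; apply/funext => x; ring.
exists g; split => // [|i].
  apply/ler_addgt0Pr => e e0.
  apply: (@J_fatou (fun k x => euclid (h (s k) ^~ x) `^ p) _ (l + e) _ _ _ _ _ _).2.
  - by move=> k; exact: L1_euclid.
  - by apply: measurable_powR_fun; exact: measurable_euclid.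
  - by move=> k x; exact: powR_ge0.
  - by move=> x; exact: powR_ge0.
  - have : {ae mu, forall x, forall i, (fun n => h (s n) i x) @ \oo --> g i x}.
      by apply: filter_forall => i; exact: gae.
    apply: filterS => x hx; have := cvg_powR_norm (ltW p1) (cvg_euclid hx).
    by rewrite ger0_norm ?euclid_ge0 //; under eq_fun do rewrite ger0_norm ?euclid_ge0 //.
  have /cvgrPdistC_le/(_ e e0) [M _ HM] := inv_cvg; exists M => // k /= Mk.
  apply: le_trans (hs M _ (leq_trans Mk (subsequence_le _ ss))) _; apply: lerD => //.
  by have := HM M (leqnn M); rewrite /= subr0 => /(le_trans (ler_norm _)).
apply/cvgrPdistC_le => e e0; have [M HM] := hg e e0; exists M => // n /= Mn.
by rewrite subr0 ger0_norm ?(HM n i Mn).2 //; apply: J_ge0 => x; exact: powR_ge0.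
Qed.
End Lp_fields.

Section Lp_duality.
Context d (T : measurableType d) (R : realType) (mu : {measure set T -> \bar R}).
Local Notation J := (integralR mu).
Local Notation L1 := (L1_fun mu).
Variable p : R.
Hypothesis p1 : 1 < p.

(** Either x <= t, or x = x^p / x^(p-1) <= x^p / t^(p-1). Below it takes the place of Hoelder's
    inequality. *)
Lemma truncation_le_powR (x t : R) : 0 <= x -> 0 < t -> x <= t + (t `^ (p - 1))^-1 * x `^ p.
Proof.
move=> x0 t0; have tp : 0 < t `^ (p - 1) by rewrite powR_gt0.
have r0 : 0 <= (t `^ (p - 1))^-1 * x `^ p by rewrite mulr_ge0 ?powR_ge0 // invr_ge0 ltW.
have [xt|tx] := leP x t; first by rewrite (le_trans xt) // lerDl.
apply: (@le_trans _ _ ((t `^ (p - 1))^-1 * x `^ p)); last by rewrite lerDr ltW.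
rewrite ler_pdivlMl //; have xp : x `^ p = x `^ (p - 1) * x.
  by rewrite -[X in _ * X]powRr1 // -powRD ?subrK // (gt_eqF (lt_trans t0 tx)) implybT.
by rewrite xp ler_wpM2r // ge0_ler_powR ?nnegrE ?subr_ge0 // ltW.
Qed.

Lemma L1_Lp_weight (f psi : T -> R) (K : R) : Lp_fun mu p f -> L1 psi ->
  (forall x, `|psi x| <= K) -> L1 (fun x => f x * psi x).
Proof.
move=> [mf Lf] Lpsi pK; apply: (L1_le _ (L1D (L1_norm Lpsi) (L1Z K Lf))).
  exact: (measurable_funM mf (L1_measurable Lpsi)).
move=> x; have := truncation_le_powR (normr_ge0 (f x)) ltr01.
rewrite powR1 invr1 mul1r => H; rewrite normrM.
apply: (@le_trans _ _ ((1 + `|f x| `^ p) * `|psi x|)); first by rewrite ler_wpM2r.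
by rewrite mulrDl mul1r lerD2l mulrC ler_wpM2r // powR_ge0.
Qed.

(** The difference f n - g is split at height t. The low part costs t times the integral of |psi|,
    small by the choice of t; the high part costs a multiple of the integral of |f n - g|^p, small
    for large n. *)
Lemma Lp_weak_cvg (f : nat -> T -> R) (g psi : T -> R) (K : R) : (forall n, Lp_fun mu p (f n)) ->
  Lp_fun mu p g -> L1 psi -> (forall x, `|psi x| <= K) ->
  (fun n => J (fun x => `|f n x - g x| `^ p)) @ \oo --> 0 ->
  (fun n => J (fun x => f n x * psi x)) @ \oo --> J (fun x => g x * psi x).
Proof.
move=> Lf Lg Lpsi pK fg; apply/cvgrPdistC_le => e e0.
have Lnpsi := L1_norm Lpsi.
have P0 : 0 <= J (fun x => `|psi x|) by exact: J_ge0.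
pose t := e / (2 * (J (fun x => `|psi x|) + 1)).
have t0 : 0 < t by rewrite divr_gt0 // mulr_gt0 // ltr_wpDl.
have tP : t * J (fun x => `|psi x|) <= e / 2.
  have P1 : 0 < J (fun x => `|psi x|) + 1 by rewrite ltr_wpDl.
  rewrite /t invfM mulrA -[leRHS]mulr1 -mulrA ler_wpM2l ?divr_ge0 ?(ltW e0) //.
  by rewrite ler_pdivrMl // mulr1 lerDl.
pose C := K * (t `^ (p - 1))^-1.
have CJ : (fun n => C * J (fun x => `|f n x - g x| `^ p)) @ \oo --> C * 0.
  exact: (cvgM (cvg_cst _) fg).
rewrite mulr0 in CJ; have /cvgrPdistC_le/(_ (e / 2)) := CJ; rewrite divr_gt0 // => /(_ isT).
apply: filterS => n; rewrite subr0 => /(le_trans (ler_norm _)) Hn.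
have Lfg : Lp_fun mu p (fun x => f n x - g x).
  have := Lp_funD p1 (Lf n) (Lp_funZ (-1) Lg).
  by congr Lp_fun; apply/funext => x; rewrite mulN1r.
have L2 := L1_Lp_weight Lfg Lpsi pK.
rewrite -(JB (L1_Lp_weight (Lf n) Lpsi pK) (L1_Lp_weight Lg Lpsi pK)).
rewrite (_ : (fun x => _ - _) = fun x => (f n x - g x) * psi x); last first.
  by apply/funext => x; rewrite mulrBl.
apply: le_trans (J_norm L2) _; rewrite [e]splitr.
apply: (@le_trans _ _ (t * J (fun x => `|psi x|) + C * J (fun x => `|f n x - g x| `^ p))).
  rewrite -(JZ t Lnpsi) -(JZ C Lfg.2) -(JD (L1Z t Lnpsi) (L1Z C Lfg.2)).
  apply: J_le (L1_norm L2) (L1D (L1Z t Lnpsi) (L1Z C Lfg.2)) _ => x.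
  rewrite normrM; have H := truncation_le_powR (normr_ge0 (f n x - g x)) t0.
  apply: (@le_trans _ _ ((t + (t `^ (p - 1))^-1 * `|f n x - g x| `^ p) * `|psi x|)).
    by rewrite ler_wpM2r.
  rewrite mulrDl lerD2l /C -mulrA [leRHS]mulrC ler_wpM2l // mulr_ge0 ?powR_ge0 //.
  by rewrite invr_ge0 powR_ge0.
exact: lerD.
Qed.
End Lp_duality.

Section weak_gradients.
Variables (R : realType) (d : nat).
Local Notation V := 'rV[R]_d.
Local Notation T := (LebT R d).
Local Notation mu := (@Leb R d).
Local Notation J := (@integralR _ T R mu).
Local Notation L1 := (@L1_fun _ T R mu).
Variable p : R.
Hypothesis p1 : 1 < p.
Local Notation Lp_fun := (@Lp_fun _ T R mu p).
Local Notation Lp_field := (@Lp_field _ T R mu 'I_d p).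
Local Notation energy := (@field_energy _ T R mu 'I_d p).
Implicit Types (u v : T -> R) (g : 'I_d -> T -> R).

Definition weak_derivatives u g := forall psi : V -> R, C1c psi -> forall i,
  J (fun x => u x * pderiv i psi x) = - J (fun x => g i x * psi x).

Lemma C1c_L1 (psi : V -> R) : C1c psi -> L1 (psi : T -> R).
Proof.
move=> Cpsi; apply: (L1_le (C1c_measurable Cpsi) (C1c_Lp ltr01 Cpsi)) => x.
by rewrite powRr1.
Qed.

Lemma L1_pderiv u (psi : V -> R) i : L1 u -> C1c psi -> L1 (fun x => u x * pderiv i psi x).
Proof.
move=> Lu Cpsi; have [K HK] := C1c_pderiv_bounded i Cpsi.
exact: (L1M Lu (C1c_pderiv_measurable i Cpsi) HK).
Qed.

Lemma L1_field_weight g (psi : V -> R) i : Lp_field g -> C1c psi -> L1 (fun x => g i x * psi x).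
Proof.
move=> Lg Cpsi; have [K HK] := C1c_bounded Cpsi.
exact: (L1_Lp_weight p1 (Lg i) (C1c_L1 Cpsi) HK).
Qed.

Lemma weak_gradientP u g : L1 u -> Lp_field g -> weak_gradient u g <-> weak_derivatives u g.
Proof.
move=> Lu Lg; split => H psi Cpsi i; have := H psi Cpsi i.
  by move=> /(congr1 fine); rewrite fineN.
by rewrite (J_EFin (L1_pderiv i Lu Cpsi)) (J_EFin (L1_field_weight i Lg Cpsi)) => ->.
Qed.

Lemma in_LpP u : in_Lp p u <-> Lp_fun u.
Proof.
split => -[mu_ H]; split => //.
  apply/integrableP; split.
    by apply/measurable_EFinP; exact: measurable_powR_norm.
  by under eq_integral do rewrite gee0_abs ?lee_fin ?powR_ge0 //.
by rewrite /Lp_pow (J_EFin H) ltry.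
Qed.

Lemma grad_powE g : Lp_field g -> grad_pow p g = (energy g)%:E.
Proof. by move=> Lg; rewrite /field_energy -(J_EFin (L1_euclid p1 Lg)). Qed.

Lemma weak_derivatives_midpoint u v g h : L1 u -> L1 v -> Lp_field g -> Lp_field h ->
  weak_derivatives u g -> weak_derivatives v h -> weak_derivatives (fun x => 2^-1 * (u x + v x)) (midpoint g h).
Proof.
move=> Lu Lv Lg Lh ug vh psi Cpsi i.
have L1u := L1_pderiv i Lu Cpsi; have L1v := L1_pderiv i Lv Cpsi.
have L1g := L1_field_weight i Lg Cpsi; have L1h := L1_field_weight i Lh Cpsi.
rewrite (_ : (fun x => 2^-1 * (u x + v x) * pderiv i psi x) =
   (fun x => 2^-1 * (u x * pderiv i psi x + v x * pderiv i psi x))); last first.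
  by apply/funext => x; rewrite -mulrDl mulrA.
rewrite (_ : (fun x => midpoint g h i x * psi x) =
   (fun x => 2^-1 * (g i x * psi x + h i x * psi x))); last first.
  by apply/funext => x; rewrite -mulrDl mulrA /midpoint [_ / 2]mulrC.
rewrite (JZ _ (L1D L1u L1v)) (JZ _ (L1D L1g L1h)) (JD L1u L1v) (JD L1g L1h) ug // vh //.
by rewrite -opprD mulrN.
Qed.

(** [A n] consists of the weak gradients of functions within 1/(n+1) of v in L^1. These classes
    shrink with n, are stable under midpoints and contain g k for large k. The strong limit given by
    [energy_minimization] is a weak gradient of v because both sides of the integration by parts
    converge. *)
Theorem weak_gradient_lsc (u : nat -> T -> R) v (g : nat -> 'I_d -> T -> R) (e : nat -> R) (l : R) :
  (forall k, L1 (u k)) -> L1 v -> (fun k => J (fun x => `|u k x - v x|)) @ \oo --> 0 ->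
  (forall k, Lp_field (g k)) -> (forall k, weak_derivatives (u k) (g k)) ->
  (forall k, energy (g k) <= e k) -> e @ \oo --> l ->
  exists h, [/\ Lp_field h, weak_derivatives v h & energy h <= l].
Proof.
move=> Lu Lv uv Lg ug ge el.
pose A n h := Lp_field h /\ exists U, [/\ L1 U, J (fun x => `|U x - v x|) <= n.+1%:R^-1 & weak_derivatives U h].
have A_mono n m h : (n <= m)%N -> A m h -> A n h.
  move=> nm [Lh [U [LU Um Uh]]]; split => //; exists U; split => //.
  by apply: le_trans Um _; rewrite lef_pV2 ?posrE // ler_nat ltnS.
have A_mid n h1 h2 : A n h1 -> A n h2 -> A n (midpoint h1 h2).
  move=> [Lh1 [U1 [LU1 b1 w1]]] [Lh2 [U2 [LU2 b2 w2]]]; split; first exact: Lp_midpoint.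
  exists (fun x => 2^-1 * (U1 x + U2 x)); split; last exact: weak_derivatives_midpoint.
    exact: (L1Z 2^-1 (L1D LU1 LU2)).
  have Ln1 := L1_norm (L1B LU1 Lv); have Ln2 := L1_norm (L1B LU2 Lv).
  have LM := L1_norm (L1B (L1Z 2^-1 (L1D LU1 LU2)) Lv).
  apply: (@le_trans _ _ (2^-1 * (J (fun x => `|U1 x - v x|) + J (fun x => `|U2 x - v x|)))).
    rewrite -(JD Ln1 Ln2) -(JZ 2^-1 (L1D Ln1 Ln2)); apply: J_le LM (L1Z 2^-1 (L1D Ln1 Ln2)) _ => x.
    have -> : 2^-1 * (U1 x + U2 x) - v x = 2^-1 * ((U1 x - v x) + (U2 x - v x)) by field.
    by rewrite normrM (gtr0_norm (_ : 0 < 2^-1)) ?invr_gt0 // ler_wpM2l ?invr_ge0 // ler_normD.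
  by rewrite ler_pdivrMl // mulr_natl mulr2n; exact: lerD.
have A_en n (r : R) : 0 < r -> exists2 h, A n h & energy h <= l + r.
  move=> r0; have n0 : 0 < n.+1%:R^-1 :> R by rewrite invr_gt0.
  have /cvgrPdistC_le/(_ r r0) elr := el.
  have /cvgrPdistC_le/(_ _ n0) uvn := uv.
  have [k [k1 k2]] : exists k, `|e k - l| <= r /\ `|J (fun x => `|u k x - v x|) - 0| <= n.+1%:R^-1.
    by have [K _ HK] := filterI elr uvn; exists K; have [] := HK K (leqnn K).
  exists (g k).
    split => //; exists (u k); split => //.
    by rewrite subr0 in k2; exact: le_trans (ler_norm _) k2.
  apply: le_trans (ge k) _; rewrite -lerBlDl; exact: le_trans (ler_norm _) k1.
have A_fd n h : A n h -> Lp_field h by case.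
have [h [Ah [h0 [Lh0 Eh0 hh0]]]] := energy_minimization p1 A_fd A_mono A_mid A_en.
exists h0; split => // psi Cpsi i.
have /choice[U HU] := fun n => (Ah n).2.
have [K HK] := C1c_bounded Cpsi; have [K' HK'] := C1c_pderiv_bounded i Cpsi.
have c1 : (fun n => J (fun x => h n i x * psi x)) @ \oo --> J (fun x => h0 i x * psi x).
  exact: (Lp_weak_cvg p1 (fun n => (Ah n).1 i) (Lh0 i) (C1c_L1 Cpsi) HK (hh0 i)).
have inv_cvg : (fun n => K' * n.+1%:R^-1 : R) @ \oo --> K' * 0.
  exact: (cvgM (cvg_cst _) (@cvg_harmonic R)).
have c2 : (fun n => J (fun x => U n x * pderiv i psi x)) @ \oo --> J (fun x => v x * pderiv i psi x).
  rewrite mulr0 in inv_cvg; apply/cvgrPdistC_le => r r0.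
  have /cvgrPdistC_le/(_ r r0) := inv_cvg; apply: filterS => n.
  rewrite subr0 => /(le_trans (ler_norm _)); apply: le_trans.
  have [LU Un _] := HU n; have Lp1 := L1_pderiv i LU Cpsi; have Lp2 := L1_pderiv i Lv Cpsi.
  have K0 : 0 <= K' by apply: le_trans (HK' 0).
  apply: (@le_trans _ _ (K' * J (fun x => `|U n x - v x|))); last by rewrite ler_wpM2l.
  have Ln := L1_norm (L1B LU Lv).
  rewrite -(JB Lp1 Lp2) -(JZ K' Ln); apply: le_trans (J_norm (L1B Lp1 Lp2)) _.
  apply: J_le (L1_norm (L1B Lp1 Lp2)) (L1Z K' Ln) _ => x.
  by rewrite -mulrBl normrM mulrC ler_wpM2r.
have c3 : (fun n => J (fun x => U n x * pderiv i psi x)) @ \oo --> - J (fun x => h0 i x * psi x).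
  rewrite (_ : (fun n => _) = (fun n => - J (fun x => h n i x * psi x))); last first.
    by apply/funext => n; have [_ _ w] := HU n; exact: w.
  exact: cvgN.
by rewrite -(cvg_lim _ c2) // -(cvg_lim _ c3).
Qed.
End weak_gradients.

(** * Compactness of functions with bounded energy *)

Section energy_compactness.
Variables (R : realType) (d : nat).
Local Notation V := 'rV[R]_d.
Local Notation T := (LebT R d).
Local Notation mu := (@Leb R d).
Local Notation J := (@integralR _ T R mu).
Local Notation L1 := (@L1_fun _ T R mu).
Local Notation TV := (@Defs.total_variation R d).
Implicit Types (F : set V) (u v : T -> R).

Lemma bounded_set_cell F : bounded_set F ->
  exists a (L : R), 0 < L /\ F `<=` cell (const_mx L) a.
Proof.
move=> [M [_ HM]]; pose K := `|M| + 1; have K0 : 0 < K by rewrite ltr_wpDl.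
exists (const_mx (- K - 1)), (2 * (K + 1)); split => [|x Fx i]; first by rewrite mulr_gt0 // addr_gt0.
have MK : M < K by rewrite (le_lt_trans (ler_norm M)) // ltrDl.
have := le_trans (coord_le_norm x i) (HM K MK x Fx).
by rewrite !mxE ler_norml => /andP[? ?]; apply/andP; split; lra.
Qed.

Lemma translation_bound_le a L u (M N : R) : M <= N -> translation_bound a L u M ->
  translation_bound a L u N.
Proof.
by move=> MN uM i h h0; apply: le_trans (uM i h h0) _; rewrite ler_wpM2r // ltW.
Qed.

Lemma J_norm_cvg (u : nat -> T -> R) v : (forall k, L1 (u k)) -> L1 v ->
  (fun k => J (fun x => `|u k x - v x|)) @ \oo --> 0 ->
  (fun k => J (fun x => `|u k x|)) @ \oo --> J (fun x => `|v x|).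
Proof.
move=> Lu Lv uv; apply/cvgrPdistC_le => e e0.
have /cvgrPdistC_le/(_ e e0) := uv; apply: filterS => k; rewrite subr0 => /(le_trans (ler_norm _)).
apply: le_trans; have Ln := L1_norm (Lu k); have Lnv := L1_norm Lv.
have Ld := L1_norm (L1B (Lu k) Lv).
rewrite -(JB Ln Lnv); apply: le_trans (J_norm (L1B Ln Lnv)) _.
by apply: J_le (L1_norm (L1B Ln Lnv)) Ld _ => x; exact: ler_dist_dist.
Qed.

Lemma bounded_energies (I : finType) (e : I -> nat -> R) (E : I -> R) :
  (forall i, e i @ \oo --> E i) -> exists2 M, 0 <= M & forall i k, e i k <= M.
Proof.
move=> eE; have /choice[M HM] : forall i, exists M : R, forall k, `|e i k| <= M.
  move=> i; have [M [_ HM]] := cvg_seq_bounded (cvgP _ (eE i)); exists (M + 1) => k.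
  by apply: HM => //; rewrite ltrDl.
have M0 i : 0 <= M i by apply: le_trans (HM i 0%N).
exists (\sum_i M i) => [|i k]; first exact: sumr_ge0.
rewrite (bigD1 i) //=; apply: le_trans (ler_norm _) _; apply: le_trans (HM i k) _.
by rewrite lerDl sumr_ge0.
Qed.

Lemma vanishes_limit F (u : nat -> T -> R) v : (forall k, vanishes_outside F (u k)) ->
  {ae mu, forall x, (fun k => u k x) @ \oo --> v x} -> vanishes_outside F v.
Proof.
move=> uF; apply: filterS2 (ae_foralln uF) => x ux uv Fx.
rewrite -(cvg_lim _ uv) //; apply: cvg_lim => //.
by under eq_fun do rewrite ux //; exact: cvg_cst.
Qed.

(** A bound on the energy rather than its value, since bounds are what passes to limits; the norm is
    fixed at 1. The two branches mirror those of [lambda1]. *)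
Definition energy_le (p : R) F u (e : R) : Prop :=
  if p == 1 then [/\ BV0 F u, (\int[mu]_x (`|u x|)%:E = 1)%E & (TV u <= e%:E)%E]
  else exists g, [/\ W1p0 p F u g, (Lp_pow p u = 1)%E & (grad_pow p g <= e%:E)%E].

(** A finite family shares one subsequence, because the disjointness conditions relate different
    components at the same index. *)
Definition compact_energies p F := forall (I : finType) (u : I -> nat -> T -> R)
    (e : I -> nat -> R) (E : I -> R),
  (forall i k, energy_le p F (u i k) (e i k)) -> (forall i, e i @ \oo --> E i) ->
  exists2 s, subsequence s & exists v : I -> T -> R, forall i, energy_le p F (v i) (E i) /\
    {ae mu, forall x, (fun k => u i (s k) x) @ \oo --> v i x}.

Lemma energy_compactness1 F : bounded_set F -> compact_energies 1 F.
Proof.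
move=> /bounded_set_cell[a [L [L0 FQ]]] I u e E ue eE.
have [M M0 HM] := bounded_energies eE.
have {}ue i k : [/\ BV0 F (u i k), (\int[mu]_x (`|u i k x|)%:E = 1)%E & (TV (u i k) <= (e i k)%:E)%E].
  by have := ue i k; rewrite /energy_le eqxx.
have Lu i k : L1 (u i k) by have [[]] := ue i k.
have uF i k : vanishes_outside F (u i k) by have [[_ []]] := ue i k.
have u1 i k : J (fun x => `|u i k x|) = 1 by have [_ h _] := ue i k; rewrite /integralR h.
have tu i k : translation_bound a L (u i k) M.
  apply: (translation_bound_le (HM i k)); apply: total_variation_translation_bound => //.
  by have [] := ue i k.
have [||s ss [v Hv]] := @L1_compactness R d a L L0 I u 1 M M0 Lu _ tu.
- by move=> i k; rewrite u1.
- by move=> i k; apply: filterS (uF i k) => x H Qx; apply: H => /FQ.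
exists s => //; exists v => i; have [Lv uv vae] := Hv i; split => //.
have TVE := total_variation_lsc (fun k => Lu i (s k)) Lv uv
  (fun k => let: And3 _ _ h := ue i (s k) in h) (cvg_subsequence ss (eE i)).
rewrite /energy_le eqxx; split => //.
  split => //; split; first exact: le_lt_trans TVE (ltry _).
  exact: (vanishes_limit (fun k => uF i (s k)) vae).
have := J_norm_cvg (fun k => Lu i (s k)) Lv uv; under eq_fun do rewrite u1.
move=> /(cvg_lim (@Rhausdorff R)); rewrite lim_cst => [J1|]; last exact: Rhausdorff.
by rewrite (J_EFin (L1_norm Lv)) -J1.
Qed.

(** On the cell, which has finite measure, |u| <= 1 + |u|^p. *)
Lemma L1_of_Lp a L u p : 1 < p -> Lp_fun mu p u -> vanishes_outside (cell (const_mx L) a) u ->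
  L1 u /\ J (fun x => `|u x|) <= J (\1_(cell (const_mx L) a)) + J (fun x => `|u x| `^ p).
Proof.
move=> p1 [mu_ Lu] uQ; set Q := cell _ _ in uQ *.
have LQ : L1 (\1_Q) by exact: L1_indic_cell.
have mQ : measurable_fun [set: T] (\1_Q : T -> R) := L1_measurable LQ.
have LS := L1D LQ Lu.
have uE : {ae mu, forall x, u x * \1_Q x = u x}.
  apply: filterS uQ => x H; rewrite indicE; case: (pselect (Q x)) => Qx.
    by rewrite mem_set // mulr1.
  by rewrite memNset // H // mulr0.
have bnd x : `|u x * \1_Q x| <= \1_Q x + `|u x| `^ p.
  rewrite normrM indicE; case: (_ \in _) => /=; last by rewrite normr0 mulr0 add0r powR_ge0.
  have := truncation_le_powR p1 (normr_ge0 (u x)) ltr01.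
  by rewrite powR1 invr1 mul1r normr1 mulr1.
have LuQ : L1 (fun x => u x * \1_Q x) := L1_le (measurable_funM mu_ mQ) LS bnd.
have L1u : L1 u := L1_ae mu_ LuQ uE.
split => //; rewrite -(JD LQ Lu).
have -> : J (fun x => `|u x|) = J (fun x => `|u x * \1_Q x|).
  apply: (J_ae (L1_measurable (L1_norm L1u)) (L1_measurable (L1_norm LuQ))).
  by apply: filterS uE => x ->.
exact: J_le (L1_norm LuQ) LS bnd.
Qed.

Lemma field_energy_coord p (g : 'I_d -> T -> R) i : 1 < p -> Lp_field mu p g ->
  J (fun x => `|g i x| `^ p) <= field_energy mu p g.
Proof.
move=> p1 Lg; apply: J_le (Lg i).2 (L1_euclid p1 Lg) _ => x.
rewrite ge0_ler_powR ?nnegrE ?euclid_ge0 //; first exact/ltW/(lt_trans ltr01).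
exact: (coord_le_euclid (g ^~ x)).
Qed.

Lemma energy_compactnessp p F : 1 < p -> bounded_set F -> compact_energies p F.
Proof.
move=> p1 /bounded_set_cell[a [L [L0 FQ]]] I u e E ue eE; set Q := cell (const_mx L) a in FQ.
have [M M0 HM] := bounded_energies eE.
have /choice[g Hg] : forall ik, exists g, [/\ W1p0 p F (u ik.1 ik.2) g,
    (Lp_pow p (u ik.1 ik.2) = 1)%E & (grad_pow p g <= (e ik.1 ik.2)%:E)%E].
  by move=> [i k]; have := ue i k; rewrite /energy_le (gt_eqF p1).
have Lpu i k : Lp_fun mu p (u i k) by have [[/in_LpP]] := Hg (i, k).
have Lg i k : Lp_field mu p (g (i, k)).
  by move=> j; have [[_ [gL _]] _ _] := Hg (i, k); apply/in_LpP; exact: gL.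
have uF i k : vanishes_outside F (u i k) by have [[_ [_ [_ ?]]] _ _] := Hg (i, k).
have uQ i k : vanishes_outside Q (u i k).
  by apply: filterS (uF i k) => x H Qx; apply: H => /FQ.
have Lu i k : L1 (u i k) by have [] := L1_of_Lp p1 (Lpu i k) (uQ i k).
have ug i k : weak_derivatives (u i k) (g (i, k)).
  by have [[_ [_ [w _]]] _ _] := Hg (i, k); apply/(weak_gradientP p1 (Lu i k) (Lg i k)).
have u1 i k : J (fun x => `|u i k x| `^ p) = 1 by have [_ h _] := Hg (i, k); rewrite /integralR -[RHS]/(fine 1%E) -h.
have ge i k : field_energy mu p (g (i, k)) <= e i k.
  by have [_ _] := Hg (i, k); rewrite (grad_powE p1 (Lg i k)) lee_fin.
have uC i k : J (fun x => `|u i k x|) <= J (\1_Q) + 1.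
  by have [_] := L1_of_Lp p1 (Lpu i k) (uQ i k); rewrite u1.
pose q := (1 - p^-1)^-1.
have pq : p^-1 + q^-1 = 1 by rewrite /q invrK addrC subrK.
have tb i k := @translation_bound_Lp R d a L p q p1 pq (u i k) M (Lu i k) (Lpu i k).2.
have Q0 : 0 <= J (\1_Q) by apply: J_ge0 => x; rewrite indicE.
have C0 : 0 <= (2 * p) `^ q * (2 * 1) by rewrite mulr_ge0 ?powR_ge0.
(* The functions and their p-th powers form one family and share a subsequence. Pointwise
   convergence then identifies the limit of |u|^p with |v|^p, and its L^1 convergence preserves the
   unit norm. *)
pose w (ib : I * bool) k := if ib.2 then (fun x => `|u ib.1 k x| `^ p) else u ib.1 k.
pose C := M + J (\1_Q) + (2 * p) `^ q * (2 * 1).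
have tw ib k : translation_bound a L (w ib k) C.
  case: ib => i b; have [|t1 t2] := tb i k.
    move=> j psi Cpsi; have wj := ug i k psi Cpsi j.
    apply: le_trans (weak_gradient_bound p1 pq (Lg i k j).1 (Lg i k j).2 Cpsi wj) _.
    rewrite lerD2r; apply: le_trans (field_energy_coord j p1 (Lg i k)) _.
    exact: le_trans (ge i k) (HM i k).
  rewrite u1 in t2; rewrite /w /C; case: b => /=.
    by apply: translation_bound_le t2; rewrite lerD2r lerDl.
  by apply: translation_bound_le t1; rewrite lerDl.
have Lw ib k : L1 (w ib k) by case: ib => i [] /=; [exact: (Lpu i k).2|exact: Lu].
have wC ib k : J (fun x => `|w ib k x|) <= J (\1_Q) + 1.
  case: ib => i [] /=; rewrite /w /=; last exact: uC.
  rewrite (_ : (fun x => _) = (fun x => `|u i k x| `^ p)); first by rewrite u1 lerDr.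
  by apply/funext => x; rewrite ger0_norm ?powR_ge0.
have wQ ib k : {ae mu, forall x, ~ Q x -> w ib k x = 0}.
  case: ib => i [] /=; rewrite /w /=; last exact: uQ.
  apply: filterS (uQ i k) => x H Qx; rewrite H // normr0 powR0 // gt_eqF //.
  exact: lt_trans p1.
have C1 : 0 <= C by rewrite /C !addr_ge0.
have [s ss [v Hv]] := @L1_compactness R d a L L0 _ w _ C C1 Lw wC tw wQ.
exists s => //; exists (fun i => v (i, false)) => i.
have [Lv uv vae] := Hv (i, false); have [LW uW Wae] := Hv (i, true).
split => //; rewrite /energy_le (gt_eqF p1).
have mv := L1_measurable Lv.
have WE : {ae mu, forall x, v (i, true) x = `|v (i, false) x| `^ p}.
  apply: filterS2 vae Wae => x h1 h2.
  have h3 := cvg_powR_norm (ltW p1) h1.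
  by rewrite -(cvg_lim _ h2) // -(cvg_lim _ h3).
have LpU : L1 (fun x => `|v (i, false) x| `^ p) := L1_ae (measurable_powR_norm p mv) LW WE.
have [h [Lh wh Eh]] := weak_gradient_lsc p1 (fun k => Lu i (s k)) Lv uv (fun k => Lg i (s k))
  (fun k => ug i (s k)) (fun k => ge i (s k)) (cvg_subsequence ss (eE i)).
exists h; split.
- split; first exact/in_LpP.
  split; first by move=> j; exact/in_LpP.
  split; first exact/(weak_gradientP p1 Lv Lh).
  exact: (vanishes_limit (fun k => uF i (s k)) vae).
- rewrite /Lp_pow (J_EFin LpU); congr EFin.
  have JW := J_norm_cvg (fun k => Lw (i, true) (s k)) LW uW.
  rewrite (_ : (fun k => _) = (fun=> 1)) in JW; last first.
    apply/funext => k; rewrite -(u1 i (s k)); congr J; apply/funext => x.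
    by rewrite ger0_norm ?powR_ge0.
  have := cvg_lim (@Rhausdorff R) JW; rewrite lim_cst; last exact: Rhausdorff.
  move=> ->; apply: (J_ae (measurable_powR_norm p mv) (L1_measurable (L1_norm LW))).
  by apply: filterS WE => x ->; rewrite [RHS]ger0_norm ?powR_ge0.
by rewrite (grad_powE p1 Lh) lee_fin.
Qed.

Theorem energy_compactness p F : 1 <= p -> bounded_set F -> compact_energies p F.
Proof.
rewrite le_eqVlt => /predU1P[<-|]; first exact: energy_compactness1.
exact: energy_compactnessp.
Qed.
End energy_compactness.

(** * Closedness of the sets of achievable vectors *)

Section null_sets.
Context d (T : measurableType d) (R : realType) (mu : {measure set T -> \bar R}).

Lemma ae_notin (A : set T) : measurable A -> mu A = 0%E <-> {ae mu, forall x, ~ A x}.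
Proof.
move=> mA; split => [A0|].
  by exists A; split => // x /= /contrapT.
move=> H; apply: (measure_negligible mA).
move: H; rewrite /almost_everywhere /=; congr (mu.-negligible _).
by apply/seteqP; split => x /=; [move=> /contrapT|move=> Ax; apply].
Qed.

Lemma measurable_nonzero (f : T -> R) : measurable_fun [set: T] f ->
  measurable [set x | f x != 0].
Proof.
move=> mf; rewrite (_ : [set x | _] = [set: T] `&` f @^-1` [set~ 0]).
  by apply: mf => //; exact: measurableC.
by apply/seteqP; split => x /=; [move=> /eqP|move=> [_ /eqP]].
Qed.

Lemma nonzero_measure_gt0 (f : T -> R) : measurable_fun [set: T] f ->
  ~ {ae mu, forall x, f x = 0} -> (0 < mu [set x | f x != 0%R])%E.
Proof.
move=> mf f0; rewrite lt_neqAle measure_ge0 andbT eq_sym; apply/eqP.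
move=> /(ae_notin (measurable_nonzero mf)) H; apply: f0.
by apply: filterS H => x /= /negP /negPn /eqP.
Qed.
End null_sets.

Lemma cvg_row_coord (R : realType) (N : nat) (v : nat -> 'rV[R]_N) (w : 'rV[R]_N) i :
  v @ \oo --> w -> (fun k => v k 0 i) @ \oo --> w 0 i.
Proof.
move=> /cvgrPdist_le vw; apply/cvgrPdist_le => e e0; apply: filterS (vw e e0) => k.
by apply: le_trans; have := coord_le_norm (w - v k) i; rewrite !mxE.
Qed.

Section infima_of_images.
Variables (R : realType) (N : nat) (X : Type) (A : set X) (r : X -> 'rV[R]_N).
Variables (Phik : nat -> 'rV[R]_N -> R) (Phi : 'rV[R]_N -> R).

(** Transfers the convergence from infima over sets of vectors to infima over clusters, functions or
    partitions, through the map r that assigns the vector of energies. *)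
Lemma inf_image_cvg : (forall x, A x -> nonneg_vec (r x)) ->
  (forall (x : nat -> X) (v : 'rV[R]_N), (forall k, A (x k)) -> (fun k => r (x k)) @ \oo --> v ->
     exists2 y, A y & forall i, r y 0 i <= v 0 i) ->
  (forall v, nonneg_vec v -> 0 <= Phi v) -> equicoercive Phik ->
  (forall v, nonneg_vec v -> (fun k => Phik k v) @ \oo --> Phi v) ->
  Gamma_limit Phik Phi -> monotone_Phi Phi ->
  (fun k => ereal_inf [set (Phik k (r x))%:E | x in A]) @ \oo -->
  ereal_inf [set (Phi (r x))%:E | x in A].
Proof.
move=> r0 Acl Phi0 Phi_co Phi_cvg Phi_G Phi_mono.
have E (F : 'rV[R]_N -> R) : [set (F (r x))%:E | x in A] = [set (F v)%:E | v in r @` A].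
  by rewrite image_comp.
rewrite E; under eq_fun do rewrite E.
apply: inf_of_cvg => //.
  by move=> v [x Ax <-]; exact: r0.
move=> vk v Hvk vkv.
have /choice[x Hx] : forall k, exists x, A x /\ r x = vk k.
  by move=> k; have [x Ax xv] := Hvk k; exists x.
have [|y Ay yv] := Acl x v (fun k => (Hx k).1).
  by rewrite (_ : (fun k => _) = vk) //; apply/funext => k; exact: (Hx k).2.
by exists (r y) => //; exists y.
Qed.
End infima_of_images.

Section closedness.
Variables (R : realType) (d N : nat).
Local Notation V := 'rV[R]_d.
Local Notation T := (LebT R d).
Local Notation mu := (@Leb R d).
Local Notation J := (@integralR _ T R mu).
Local Notation L1 := (@L1_fun _ T R mu).
Local Notation TV := (@Defs.total_variation R d).
Implicit Types (F : set V) (u v : T -> R).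

Lemma BV0_total_variation F u : BV0 F u -> TV u = (fine (TV u))%:E.
Proof.
by move=> [_ [uF _]]; rewrite fineK // ge0_fin_numE // total_variation_ge0.
Qed.

Lemma W1p0_grad_pow p F u g : 1 < p -> W1p0 p F u g -> grad_pow p g = (fine (grad_pow p g))%:E.
Proof.
move=> p1 [_ [Lg _]]; rewrite (@grad_powE R d p p1 g) // => i.
by apply/in_LpP; exact: Lg.
Qed.

Lemma grad_pow_ge0 p (g : 'I_d -> V -> R) : (0 <= grad_pow p g)%E.
Proof. by apply: integral_ge0 => x _; rewrite lee_fin powR_ge0. Qed.

Lemma lambda1_ge0 p F : (0 <= lambda1 p F)%E.
Proof.
rewrite /lambda1; case: ifP => _; apply: le_ereal_inf_tmp => _ [u _ <-].
  exact: total_variation_ge0.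
exact: grad_pow_ge0.
Qed.

Lemma lambda1_le p F u (e : R) : energy_le p F u e -> (lambda1 p F <= e%:E)%E.
Proof.
rewrite /energy_le /lambda1; case: ifP => _.
  by move=> [uF u1 ue]; apply: le_trans ue; apply: ereal_inf_lbound; exists u.
by move=> [g [ug u1 ge]]; apply: le_trans ge; apply: ereal_inf_lbound; exists (u, g).
Qed.

Lemma lambda1_approx p F (e : R) : (lambda1 p F < +oo)%E -> 0 < e ->
  exists u, energy_le p F u (fine (lambda1 p F) + e).
Proof.
move=> lF e0; have lfin : lambda1 p F \is a fin_num by rewrite ge0_fin_numE // lambda1_ge0.
have lle : (lambda1 p F < (fine (lambda1 p F) + e)%:E)%E.
  by rewrite EFinD fineK // lteDl // lte_fin.
move: lle; rewrite {1}/lambda1 /energy_le; case: ifP => _ /ereal_inf_lt[_ [u Hu <-]] /ltW ue.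
  by exists u; have [? ?] := Hu; split.
by exists u.1, u.2; have [? ?] := Hu; split.
Qed.

Lemma energy_le_ae_nonzero p F u (e : R) : 1 <= p -> energy_le p F u e ->
  ~ {ae mu, forall x, u x = 0}.
Proof.
move=> p1 ue u0.
have [q [q1 mu_ uq]] : exists q : R, [/\ 0 < q, measurable_fun [set: T] u &
    (\int[mu]_x (`|u x| `^ q)%:E = 1)%E].
  move: ue; rewrite /energy_le; case: ifP => _.
    move=> [[Lu _] u1 _]; exists 1; split => //; first exact: L1_measurable Lu.
    by rewrite -u1; apply: eq_integral => x _; rewrite powRr1.
  by move=> [g [[[mu_ _] _] u1 _]]; exists p; split => //; exact: lt_le_trans p1.
have : (\int[mu]_x (`|u x| `^ q)%:E = \int[mu]_x (0%:E))%E.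
  apply: ae_eq_integral => //.
    by apply/measurable_EFinP; exact: measurable_powR_norm.
  by apply: filterS u0 => x -> _; rewrite normr0 powR0 // gt_eqF.
by rewrite uq integral0 => /eqP; rewrite onee_eq0.
Qed.

Lemma energy_le_sub p F G u (e : R) : mu (F `\` G) = 0%E -> measurable (F `\` G : set T) ->
  energy_le p F u e -> energy_le p G u e.
Proof.
move=> FG0 mFG.
have vF w : vanishes_outside F w -> vanishes_outside G w.
  apply: filterS2 ((ae_notin _ mFG).1 FG0) => x nx H Gx; apply: H => Fx; exact: nx.
rewrite /energy_le; case: ifP => _.
  by move=> [[L1u [tu uF]] u1 ue]; split => //; split => //; split => //; exact: vF.
by move=> [g [[a [b [c uF]]] u1 ge]]; exists g; split => //; split => //; split => //; split => //; exact: vF.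
Qed.

Lemma ae_limit_ge0 (u : nat -> T -> R) v : (forall k, {ae mu, forall x, 0 <= u k x}) ->
  {ae mu, forall x, (fun k => u k x) @ \oo --> v x} -> {ae mu, forall x, 0 <= v x}.
Proof.
move=> u0; apply: filterS2 (ae_foralln u0) => x u0x uv.
rewrite -oppr_le0; apply: (limit_le (cvgN uv)); apply: nearW => k; by rewrite oppr_le0.
Qed.

Lemma ae_limit_disjoint (u1 u2 : nat -> T -> R) v1 v2 :
  (forall k, {ae mu, forall x, u1 k x * u2 k x = 0}) ->
  {ae mu, forall x, (fun k => u1 k x) @ \oo --> v1 x} ->
  {ae mu, forall x, (fun k => u2 k x) @ \oo --> v2 x} -> {ae mu, forall x, v1 x * v2 x = 0}.
Proof.
move=> u0 u1v u2v; near=> x.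
have h0 : forall k, u1 k x * u2 k x = 0 by near: x; exact: ae_foralln u0.
have h1 : (fun k => u1 k x) @ \oo --> v1 x by near: x.
have h2 : (fun k => u2 k x) @ \oo --> v2 x by near: x.
have h3 : (fun k => u1 k x * u2 k x) @ \oo --> v1 x * v2 x by exact: cvgM.
rewrite -(cvg_lim (@Rhausdorff R) h3); under eq_fun do rewrite h0.
by rewrite lim_cst //; exact: Rhausdorff.
Unshelve. all: end_near. Qed.

Variable Omega : set V.
Hypothesis bOmega : bounded_set Omega.

Lemma one_N_closed (u : nat -> 'I_N -> V -> R) (w : 'rV[R]_N) :
  (forall k, one_N_function Omega (u k)) ->
  (fun k => \row_i fine (TV (u k i))) @ \oo --> w ->
  exists2 v : 'I_N -> V -> R, one_N_function Omega v &
    forall i, (\row_i fine (TV (v i)) : 'rV[R]_N) 0 i <= w 0 i.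
Proof.
move=> Hu /cvg_row_coord uw.
have [||s ss [v Hv]] := @energy_compactness R d 1 Omega (lexx 1) bOmega 'I_N (fun i k => u k i)
    (fun i k => fine (TV (u k i))) (fun i => w 0 i).
- move=> i k; rewrite /energy_le eqxx; have [uB [_ [u1 _]]] := Hu k; split => //.
  by rewrite -(BV0_total_variation (uB i)).
- by move=> i; have := uw i; under eq_fun do rewrite mxE.
have {}Hv i := Hv i; have vae i := (Hv i).2.
have ve i : [/\ BV0 Omega (v i), (\int[mu]_x (`|v i x|)%:E = 1)%E & (TV (v i) <= (w 0 i)%:E)%E].
  by have := (Hv i).1; rewrite /energy_le eqxx.
exists v => [|i]; last first.
  have [vB _] := ve i; rewrite mxE -lee_fin -(BV0_total_variation vB).
  by have [_ _] := ve i.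
split; first by move=> i; have [] := ve i.
split; first by move=> i; apply: ae_limit_ge0 (vae i) => k; have [_ [u0 _]] := Hu (s k); exact: u0.
split; first by move=> i; have [] := ve i.
move=> i j ij; apply: ae_limit_disjoint (vae i) (vae j) => k.
by have [_ [_ [_ u0]]] := Hu (s k); exact: u0.
Qed.

Lemma p_N_closed p (ug : nat -> ('I_N -> V -> R) * ('I_N -> 'I_d -> V -> R)) (w : 'rV[R]_N) :
  1 < p -> (forall k, p_N_function p Omega (ug k).1 (ug k).2) ->
  (fun k => \row_i fine (grad_pow p ((ug k).2 i))) @ \oo --> w ->
  exists2 vg : ('I_N -> V -> R) * ('I_N -> 'I_d -> V -> R), p_N_function p Omega vg.1 vg.2 &
    forall i, (\row_i fine (grad_pow p (vg.2 i)) : 'rV[R]_N) 0 i <= w 0 i.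
Proof.
move=> p1 Hu /cvg_row_coord uw.
have [||s ss [v Hv]] := @energy_compactness R d p Omega (ltW p1) bOmega 'I_N (fun i k => (ug k).1 i)
    (fun i k => fine (grad_pow p ((ug k).2 i))) (fun i => w 0 i).
- move=> i k; rewrite /energy_le (gt_eqF p1); have [uB [_ [u1 _]]] := Hu k.
  by exists ((ug k).2 i); split => //; rewrite -(W1p0_grad_pow p1 (uB i)).
- by move=> i; have := uw i; under eq_fun do rewrite mxE.
have {}Hv i := Hv i; have vae i := (Hv i).2.
have /choice[g Hg] : forall i, exists g, [/\ W1p0 p Omega (v i) g,
    (Lp_pow p (v i) = 1)%E & (grad_pow p g <= (w 0%R i)%:E)%E].
  by move=> i; have := (Hv i).1; rewrite /energy_le (gt_eqF p1).
exists (v, g) => [|i]; last first.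
  have [vB _ vE] := Hg i; by rewrite mxE -lee_fin -(W1p0_grad_pow p1 vB).
split; first by move=> i; have [] := Hg i.
split; first by move=> i; apply: ae_limit_ge0 (vae i) => k; have [_ [u0 _]] := Hu (s k); exact: u0.
split; first by move=> i; have [] := Hg i.
move=> i j ij; apply: ae_limit_disjoint (vae i) (vae j) => k.
by have [_ [_ [_ u0]]] := Hu (s k); exact: u0.
Qed.

Hypothesis oOmega : open Omega.

Lemma measurable_setD_Omega (E : set T) : measurable E -> measurable (E `\` Omega : set T).
Proof. by move=> mE; apply: measurableD => //; exact: measurable_open. Qed.

Lemma nset_vanishes p (E : 'I_N -> set V) i u (e : R) : nset Omega E ->
  energy_le p (E i) u e -> energy_le p Omega u e.
Proof.
move=> [mE [EO _]]; apply: energy_le_sub (EO i) _.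
exact: measurable_setD_Omega (mE i).
Qed.

Lemma energy_le_measurable p F u (e : R) : energy_le p F u e ->
  measurable_fun [set: T] u /\ vanishes_outside F u.
Proof.
rewrite /energy_le; case: ifP => _.
  by move=> [[Lu [_ uF]] _ _]; split => //; exact: L1_measurable Lu.
by move=> [g [[[mu_ _] [_ [_ uF]]] _ _]].
Qed.

(** The set enters only through the condition of vanishing outside it, and u vanishes outside its
    own nonzero set. *)
Lemma energy_le_nonzero p F u (e : R) : energy_le p F u e ->
  energy_le p [set x | u x != 0] u e.
Proof.
have vF : vanishes_outside [set x | u x != 0] u.
  by apply: nearW => x /= /negP /negPn /eqP.
rewrite /energy_le; case: ifP => _.
  by move=> [[Lu [tu _]] u1 ue]; split => //; split.
by move=> [g [[a [b [c _]]] u1 ge]]; exists g.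
Qed.

(** Positive measure comes from the unit norms, disjointness from the vanishing products, inclusion
    from vanishing outside [Omega]. *)
Lemma nset_nonzero p (v : 'I_N -> T -> R) (e : 'I_N -> R) : 1 <= p ->
  (forall i, energy_le p Omega (v i) (e i)) ->
  (forall i j, i != j -> {ae mu, forall x, v i x * v j x = 0}) ->
  nset Omega (fun i => [set x | v i x != 0]).
Proof.
move=> p1 ve vv; have mv i := (energy_le_measurable (ve i)).1.
have mE i : measurable ([set x | v i x != 0] : set T) by exact: measurable_nonzero.
split => //; split => [i|].
  apply/(ae_notin _ (measurable_setD_Omega (mE i))).
  apply: filterS (energy_le_measurable (ve i)).2 => x H [/= vx Ox].
  by rewrite H // eqxx in vx.
split => [i|i j ij].
  by apply: nonzero_measure_gt0 => //; exact: energy_le_ae_nonzero (ve i).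
apply/(ae_notin _ (measurableI _ _ (mE i) (mE j))).
apply: filterS (vv i j ij) => x vx [/= vi vj].
by have := mulf_neq0 vi vj; rewrite vx eqxx.
Qed.

Lemma LPhi_closed p (E : nat -> 'I_N -> set V) (w : 'rV[R]_N) : 1 <= p ->
  (forall k, nset Omega (E k) /\ (forall i, (lambda1 p (E k i) < +oo)%E)) ->
  (fun k => \row_i fine (lambda1 p (E k i))) @ \oo --> w ->
  exists2 G : 'I_N -> set V, nset Omega G /\ (forall i, (lambda1 p (G i) < +oo)%E) &
    forall i, (\row_i fine (lambda1 p (G i)) : 'rV[R]_N) 0 i <= w 0 i.
Proof.
move=> p1 HE /cvg_row_coord Ew.
(* Competitors only approach the infimum defining [lambda1]; the slack 1/(k+1) disappears in the
   limit. *)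
pose e i k := fine (lambda1 p (E k i)) + k.+1%:R^-1.
have /choice[u Hu] : forall ik, exists u, energy_le p (E ik.2 ik.1) u (e ik.1 ik.2).
  by move=> [i k]; apply: lambda1_approx; [exact: (HE k).2|rewrite invr_gt0].
have uO i k : energy_le p Omega (u (i, k)) (e i k).
  by apply: (nset_vanishes (i := i) (HE k).1); exact: (Hu (i, k)).
have ew i : e i @ \oo --> w 0 i.
  rewrite -[w 0 i]addr0; apply: cvgD; last exact: cvg_harmonic.
  by have := Ew i; under eq_fun do rewrite mxE.
have [s ss [v Hv]] := energy_compactness p1 bOmega uO ew.
have vv i j : i != j -> {ae mu, forall x, v i x * v j x = 0}.
  move=> ij; apply: ae_limit_disjoint (Hv i).2 (Hv j).2 => k.
  have [[mE [_ [_ EE]]] _] := HE (s k).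
  have nE := (ae_notin _ (measurableI _ _ (mE i) (mE j))).1 (EE i j ij).
  have ui := (energy_le_measurable (Hu (i, s k))).2.
  have uj := (energy_le_measurable (Hu (j, s k))).2.
  near=> x; have [Ei|Ei] := pselect (E (s k) i x); last first.
    have -> : u (i, s k) x = 0 by move: Ei; near: x.
    by rewrite mul0r.
  have -> : u (j, s k) x = 0; last by rewrite mulr0.
  have Ej : ~ E (s k) j x.
    have : ~ (E (s k) i `&` E (s k) j) x by near: x.
    by move=> H Ej; apply: H.
  by move: Ej; near: x.
have ve i := energy_le_nonzero (Hv i).1.
have lv i : (lambda1 p [set x | v i x != 0%R] <= (w 0%R i)%:E)%E by exact: lambda1_le (ve i).
exists (fun i => [set x | v i x != 0]) => [|i].
  split; first exact: nset_nonzero (fun i => (Hv i).1) vv.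
  by move=> i; exact: le_lt_trans (lv i) (ltry _).
rewrite mxE -lee_fin fineK // ge0_fin_numE ?lambda1_ge0 //.
exact: le_lt_trans (lv i) (ltry _).
Unshelve. all: end_near. Qed.

Lemma nset_finite (E : 'I_N -> set V) i : nset Omega E -> (mu (E i) < +oo)%E.
Proof.
move=> [mE [EO _]]; have [a [L [L0 OQ]]] := bounded_set_cell bOmega.
have mO : measurable (Omega : set T) by exact: measurable_open.
have H : (mu (E i) <= mu (E i `&` Omega) + mu (E i `\` Omega))%E.
  by rewrite -measureU ?setUIDK //; [exact: measurableI|exact: measurableD|apply/seteqP; split => x //= [[_ ?] [_]]].
apply: le_lt_trans H _; rewrite EO adde0.
apply: le_lt_trans (Leb_obox_lty a (a + const_mx L)).
apply: le_outer_measure; exact: subset_trans (@subIsetr _ _ _) OQ.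
Qed.

(** By homogeneity of the total variation, division of the indicator by the measure gives unit L^1
    norm and turns the perimeter into the Cheeger ratio. *)
Lemma cluster_energy (E : 'I_N -> set V) i : ncluster Omega E ->
  energy_le 1 Omega (fun x => (fine (mu (E i)))^-1 * \1_(E i) x)
    (fine (perimeter (E i)) / fine (mu (E i))).
Proof.
move=> [nE PE]; have [mE [EO [E0 _]]] := nE; have Ef := nset_finite i nE.
have m0 : 0 < fine (mu (E i)) by rewrite fine_gt0 // E0 Ef.
have [L1E J1] := L1_indic_set (mE i) Ef.
have Lu := L1Z (fine (mu (E i)))^-1 L1E.
have TVE : (TV (fun x => (fine (mu (E i)))^-1 * \1_(E i) x)%R <=
    (fine (perimeter (E i)) / fine (mu (E i)))%R%:E)%E.
  apply/(total_variation_leP _ Lu) => phi tphi; have Ld := L1_divergence L1E tphi.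
  rewrite (_ : (fun x => _) = fun x => (fine (mu (E i)))^-1 * (\1_(E i) x * divergence phi x)); last first.
    by apply/funext => x; rewrite mulrA.
  rewrite (JZ _ Ld) mulrC ler_wpM2r ?invr_ge0 ?(ltW m0) //.
  have : (TV (\1_(E i) : V -> R) <= (fine (perimeter (E i)))%:E)%E.
    by rewrite fineK // ge0_fin_numE ?total_variation_ge0 //; exact: PE.
  by move=> /(total_variation_leP _ L1E); apply.
rewrite /energy_le eqxx; split => //.
  split => //; split; first exact: le_lt_trans TVE (ltry _).
  have := (ae_notin _ (measurable_setD_Omega (mE i))).1 (EO i); apply: filterS => x H Ox.
  rewrite indicE memNset ?mulr0 // => Ex; exact: H.
rewrite (J_EFin (L1_norm Lu)) (_ : (fun x => _) = fun x => (fine (mu (E i)))^-1 * \1_(E i) x).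
  by rewrite (JZ _ L1E) J1 mulVf // gt_eqF.
by apply/funext => x; rewrite ger0_norm // mulr_ge0 // invr_ge0 ltW.
Qed.

(** Where the limit is nonzero the indicators are eventually 1, so c k itself tends to the value of
    v. All these nonzero values are limits of one sequence and hence equal. *)
Lemma limit_of_indicators (c : nat -> R) (A : nat -> set T) v : (forall k, 0 <= c k) ->
  ~ {ae mu, forall x, v x = 0} ->
  {ae mu, forall x, (fun k => c k * \1_(A k) x) @ \oo --> v x} ->
  exists2 C, 0 < C & {ae mu, forall x, v x = C * \1_[set x | v x != 0] x}.
Proof.
move=> c0 v0 cv.
have [x0 [cx0 vx0]] : exists x, (fun k => c k * \1_(A k) x) @ \oo --> v x /\ v x != 0.
  apply: contrapT => H; apply: v0; apply: filterS cv => x cx.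
  by apply/eqP/negPn/negP => vx; apply: H; exists x.
have c_cvg x : (fun k => c k * \1_(A k) x) @ \oo --> v x -> v x != 0 -> c @ \oo --> v x.
  move=> cx vx; apply: cvg_trans (cx); apply: near_eq_cvg.
  have nz : \forall k \near \oo, c k * \1_(A k) x != 0 by exact: cvgr_neq0 cx vx.
  apply: filterS nz => k; rewrite indicE; case: (_ \in _); first by rewrite mulr1.
  by rewrite mulr0 eqxx.
have C := c_cvg x0 cx0 vx0; exists (v x0).
  rewrite lt_neqAle eq_sym vx0 /= -oppr_le0; apply: (limit_le (cvgN C)).
  by apply: nearW => k; rewrite oppr_le0.
apply: filterS cv => x cx; rewrite indicE; have [vx|vx] := eqVneq (v x) 0.
  by rewrite memNset ?mulr0 //= vx eqxx.
rewrite mem_set //= mulr1.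
by rewrite -(cvg_lim (@Rhausdorff R) (c_cvg x cx vx)) -(cvg_lim (@Rhausdorff R) C).
Qed.

(** The unit norm of v forces C to be the inverse of the measure of E, so the energy bound on v is a
    bound on the ratio of E. *)
Lemma indicator_perimeter (E : set T) v (C e : R) : measurable E -> (mu E < +oo)%E -> 0 < C ->
  {ae mu, forall x, v x = C * \1_E x} -> energy_le 1 Omega v e ->
  (perimeter E < +oo)%E /\ fine (perimeter E) / fine (mu E) <= e.
Proof.
move=> mE Ef C0 vE; rewrite /energy_le eqxx => -[[Lv _] v1 ve].
have [L1E J1] := L1_indic_set mE Ef.
have Lu := L1Z C L1E.
have CE : C * fine (mu E) = 1.
  rewrite -J1 -(JZ C L1E); have -> : J (fun x => C * \1_E x) = J (fun x => `|v x|).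
    apply: (J_ae (L1_measurable Lu) (L1_measurable (L1_norm Lv))).
    apply: filterS vE => x ->; rewrite ger0_norm // mulr_ge0 // ltW //.
  by rewrite /integralR v1.
have m0 : 0 < fine (mu E).
  by rewrite -(pmulr_rgt0 _ C0) CE.
have PE : (perimeter E <= (e * fine (mu E))%:E)%E.
  apply/(total_variation_leP _ L1E) => phi tphi.
  have := (total_variation_leP e Lv).1 ve phi tphi.
  have Ld := L1_divergence L1E tphi; have Lvd := L1_divergence Lv tphi.
  have -> : J (fun x => v x * divergence phi x) = C * J (fun x => \1_E x * divergence phi x).
    rewrite -(JZ C Ld); apply: (J_ae (L1_measurable Lvd) (L1_measurable (L1Z C Ld))).
    by apply: filterS vE => x ->; rewrite mulrA.
  have -> : C = (fine (mu E))^-1 by apply: (mulIf (lt0r_neq0 m0)); rewrite CE mulVf // gt_eqF.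
  by rewrite mulrC ler_pdivrMr.
have Pf : (perimeter E < +oo)%E := le_lt_trans PE (ltry _).
split => //; rewrite ler_pdivrMr // -lee_fin fineK // ge0_fin_numE //.
exact: total_variation_ge0.
Qed.

Lemma Cheeger_closed (E : nat -> 'I_N -> set V) (w : 'rV[R]_N) :
  (forall k, ncluster Omega (E k)) ->
  (fun k => \row_i (fine (perimeter (E k i)) / fine (mu (E k i)))) @ \oo --> w ->
  exists2 G : 'I_N -> set V, ncluster Omega G &
    forall i, (\row_i (fine (perimeter (G i)) / fine (mu (G i))) : 'rV[R]_N) 0 i <= w 0 i.
Proof.
move=> HE /cvg_row_coord Ew.
pose u i k x := (fine (mu (E k i)))^-1 * \1_(E k i) x.
have [||s ss [v Hv]] := @energy_compactness R d 1 Omega (lexx 1) bOmega 'I_N u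
    (fun i k => fine (perimeter (E k i)) / fine (mu (E k i))) (fun i => w 0 i).
- by move=> i k; exact: cluster_energy.
- by move=> i; have := Ew i; under eq_fun do rewrite mxE.
have vv i j : i != j -> {ae mu, forall x, v i x * v j x = 0}.
  move=> ij; apply: ae_limit_disjoint (Hv i).2 (Hv j).2 => k.
  have [[mE [_ [_ EE]]] _] := HE (s k).
  have := (ae_notin _ (measurableI _ _ (mE i) (mE j))).1 (EE i j ij); apply: filterS => x H.
  rewrite /u; have [Ei|Ei] := pselect (E (s k) i x); last first.
    by rewrite indicE memNset // mulr0 mul0r.
  have Ej : ~ E (s k) j x by move=> Ej; apply: H.
  by rewrite mulrC indicE memNset // mulr0 mul0r.
have nG := nset_nonzero (lexx 1) (fun i => (Hv i).1) vv.
have key i : (perimeter [set x | v i x != 0%R] < +oo)%E /\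
   fine (perimeter [set x | v i x != 0]) / fine (mu [set x | v i x != 0]) <= w 0 i.
  have [ve vae] := Hv i.
  have [|||C C0 vC] := @limit_of_indicators (fun k => (fine (mu (E (s k) i)))^-1) (fun k => E (s k) i) (v i).
  - by move=> k; rewrite invr_ge0 fine_ge0.
  - exact: energy_le_ae_nonzero (lexx 1) ve.
  - exact: vae.
  by apply: indicator_perimeter C0 vC ve; [exact: nG.1|exact: nset_finite nG].
exists (fun i => [set x | v i x != 0]) => [|i]; last by rewrite mxE; exact: (key i).2.
by split => // i; exact: (key i).1.
Qed.
End closedness.

(** * Convergence of the three optimal values *)

Theorem mainTheorem19 (R : realType) (d N : nat) (Omega : set 'rV[R]_d)
    (Phik : nat -> 'rV[R]_N -> R) (Phi : 'rV[R]_N -> R) :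
  open Omega -> Omega !=set0 -> bounded_set Omega ->
  (forall k v, nonneg_vec v -> 0 <= Phik k v) ->
  (forall v, nonneg_vec v -> 0 <= Phi v) ->
  equicoercive Phik ->
  (forall v, nonneg_vec v -> (fun k => Phik k v) @ \oo --> Phi v) ->
  Gamma_limit Phik Phi ->
  monotone_Phi Phi ->
  ((fun k => Cheeger (Phik k) Omega) @ \oo --> Cheeger Phi Omega) /\
  (forall p : R, 1 <= p ->
     ((fun k => LambdaPhi p (Phik k) Omega) @ \oo --> LambdaPhi p Phi Omega) /\
     ((fun k => LPhi p (Phik k) Omega) @ \oo --> LPhi p Phi Omega)).
Proof.
move=> oO _ bO _ Phi0 co ptw Gam mono; split.
  apply: inf_image_cvg => //.
    by move=> E _ i; rewrite mxE divr_ge0 // fine_ge0 // ?total_variation_ge0.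
  by move=> E v HE Ev; exact: Cheeger_closed HE Ev.
move=> p p1; split; last first.
  apply: inf_image_cvg => //; first by move=> E _ i; rewrite mxE fine_ge0 // lambda1_ge0.
  by move=> E v HE Ev; exact: LPhi_closed HE Ev.
(* For p = 1 the infimum runs over functions, for p > 1 over functions paired with weak gradients,
   and each has its own closedness statement. *)
rewrite /LambdaPhi; have [_|pn1] := eqVneq p 1.
  apply: inf_image_cvg => //; first by move=> u _ i; rewrite mxE fine_ge0 // total_variation_ge0.
  by move=> u v Hu uv; exact: one_N_closed Hu uv.
apply: inf_image_cvg => //; first by move=> u _ i; rewrite mxE fine_ge0 // grad_pow_ge0.
move=> ug v Hu uv; apply: p_N_closed Hu uv => //.
by rewrite lt_neqAle eq_sym pn1.
Qed.
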